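(* Let $(R,\mathfrak m)$ be a Cohen–Macaulay local ring and let $E$ be a non-free ideal module of rank $e>0$ which is generically a complete intersection. Then $E$ is a complete intersection if and only if $E$ is equimultiple.
   Context: All rings are commutative and Noetherian. A finitely generated module $E$ has rank $e$ if $E\otimes_R Q\cong Q^e$, where $Q$ is the total ring of fractions of $R$. For a finitely generated torsionfree $R$-module $E$ of rank $e>0$ contained in a free module $G\cong R^e$, identify $G=R^e$ and let the Rees algebra $\mathcal R(E)$ be the $R$-subalgebra of $R[t_1,\dots,t_e]$ generated by the linear forms $a_1t_1+\dots+a_et_e$ with $(a_1,\dots,a_e)\in E$; up to isomorphism it does not depend on the embedding. $E^n$ denotes its degree-$n$ component. A submodule $U\subseteq E$ is a reduction of $E$ if $E^{r+1}=U\cdot E^r$ (product in $\mathcal R(E)$) for some $r\ge0$. If $(R,\mathfrak m)$ is local, the analytic spread $\ell(E)$ is the Krull dimension of $\mathcal R(E)/\mathfrak m\mathcal R(E)$, and $\mu(E)$ denotes the minimal number of generators. $F_i(E)$ is the $i$-th Fitting ideal: if $R^m\xrightarrow{\varphi}R^n\to E\to 0$ is a presentation, $F_i(E)$ is generated by the $(n-i)\times(n-i)$ minors of $\varphi$. For a finitely generated module $M$, $\operatorname{grade}M$ is the grade of the ideal $\operatorname{ann}_R M$ ($\infty$ if $M=0$). An ideal module is a finitely generated torsionfree $R$-module $E$ of rank $e>0$ that admits an embedding $E\subseteq G\cong R^e$ with $\operatorname{grade}(G/E)\ge 2$. For $(R,\mathfrak m)$ local and $E$ a non-free ideal module of rank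 $e$: $E$ is a complete intersection if $\mu(E)=\operatorname{ht}F_e(E)+e-1$; $E$ is equimultiple if $\ell(E)=\operatorname{ht}F_e(E)+e-1$; $E$ is generically a complete intersection if $\mu(E_{\mathfrak p})=\operatorname{ht}F_e(E)+e-1$ for every minimal prime $\mathfrak p$ of $F_e(E)$. *)

(* Defs.v *)
From HB Require Import structures.
From mathcomp Require Import all_boot all_order all_algebra.
From mathcomp Require Import mpoly.
From Stdlib Require Import ClassicalEpsilon.

Set Implicit Arguments.
Unset Strict Implicit.
Unset Printing Implicit Defensive.

Import GRing.Theory.
Local Open Scope ring_scope.

Section CommAlg.
Variable R : comNzRingType.

Definition sup_nat (Pn : nat -> Prop) : nat :=
  epsilon (inhabits 0%N) (fun n => Pn n /\ forall k, Pn k -> (k <= n)%N).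
Definition min_nat (Pn : nat -> Prop) : nat :=
  epsilon (inhabits 0%N) (fun n => Pn n /\ forall k, Pn k -> (n <= k)%N).

Definition is_ideal (I : R -> Prop) : Prop :=
  I 0 /\ (forall x y, I x -> I y -> I (x + y)) /\ (forall a x, I x -> I (a * x)).

Definition ideal_gen (S : R -> Prop) (x : R) : Prop :=
  exists (k : nat) (c g : 'I_k -> R),
    (forall j, S (g j)) /\ x = \sum_(j < k) c j * g j.

Definition ideal_span (k : nat) (g : 'I_k -> R) (x : R) : Prop :=
  exists c : 'I_k -> R, x = \sum_(j < k) c j * g j.

Definition noetherian : Prop :=
  forall I : R -> Prop, is_ideal I ->
    exists (k : nat) (g : 'I_k -> R), forall x, I x <-> ideal_span g x.

Definition local_ring (m : R -> Prop) : Prop :=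
  is_ideal m /\ ~ m 1 /\ (forall x, ~ m x -> exists y, x * y = 1).

End CommAlg.

Section Primes.
Variable A : comNzRingType.

Definition sub_prime (S P : A -> Prop) : Prop :=
  (forall x, P x -> S x) /\ P 0 /\
  (forall x y, P x -> P y -> P (x + y)) /\
  (forall a x, S a -> P x -> P (a * x)) /\
  ~ P 1 /\
  (forall a b, S a -> S b -> P (a * b) -> P a \/ P b).

Definition prime_chain (S J : A -> Prop) (n : nat) (P : nat -> A -> Prop) : Prop :=
  (forall i, (i <= n)%N -> sub_prime S (P i) /\ (forall x, J x -> P i x)) /\
  (forall i, (i < n)%N ->
     (forall x, P i x -> P i.+1 x) /\ exists x, P i.+1 x /\ ~ P i x).

(* Krull dimension of S / (J S) : sup of lengths of chains of primes of S over J *)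
Definition krull_dim_over (S J : A -> Prop) : nat :=
  sup_nat (fun n => exists P, prime_chain S J n P).

End Primes.

Section Module.
Variable R : comNzRingType.

Definition allR : R -> Prop := fun _ => True.
Definition noneR : R -> Prop := fun _ => False.

Definition is_prime (P : R -> Prop) : Prop := sub_prime allR P.

Definition krull_dim : nat := krull_dim_over allR noneR.

Definition height_prime (Q : R -> Prop) : nat :=
  sup_nat (fun n => exists P, prime_chain allR noneR n P /\ forall x, P n x <-> Q x).

Definition height (I : R -> Prop) : nat :=
  min_nat (fun n => exists Q, is_prime Q /\ (forall x, I x -> Q x) /\ height_prime Q = n).

Definition minimal_prime (I P : R -> Prop) : Prop :=
  is_prime P /\ (forall x, I x -> P x) /\
  forall Q, is_prime Q -> (forall x, I x -> Q x) -> (forall x, Q x -> P x) ->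
    forall x, P x -> Q x.

Definition regular_seq (k : nat) (x : 'I_k -> R) : Prop :=
  (forall i : 'I_k, forall r,
     ideal_span (fun j : 'I_i => x (widen_ord (ltnW (ltn_ord i)) j)) (x i * r) ->
     ideal_span (fun j : 'I_i => x (widen_ord (ltnW (ltn_ord i)) j)) r) /\
  ~ ideal_span x 1.

(* grade I >= k  (grade of the unit ideal is infinite) *)
Definition grade_ge (I : R -> Prop) (k : nat) : Prop :=
  I 1 \/ exists x : 'I_k -> R, (forall i, I (x i)) /\ regular_seq x.

Definition cohen_macaulay_local (m : R -> Prop) : Prop :=
  noetherian R /\ local_ring m /\ grade_ge m krull_dim.

Variable e : nat.
Notation vec := 'rV[R]_e.

Definition is_submodule (E : vec -> Prop) : Prop :=
  E 0 /\ (forall u v, E u -> E v -> E (u + v)) /\ (forall a v, E v -> E (a *: v)).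

Definition generated_by (E : vec -> Prop) (n : nat) (X : 'I_n -> vec) : Prop :=
  forall v, E v <-> exists c : 'I_n -> R, v = \sum_(i < n) c i *: X i.

Definition free_module (E : vec -> Prop) : Prop :=
  exists (n : nat) (X : 'I_n -> vec), generated_by E X /\
    forall c : 'I_n -> R, \sum_(i < n) c i *: X i = 0 -> forall i, c i = 0.

Definition ann_quot (E : vec -> Prop) (r : R) : Prop := forall v : vec, E (r *: v).

(* ideal module of rank e, realized as a submodule E of G = R^e with grade(G/E) >= 2 *)
Definition ideal_module (E : vec -> Prop) : Prop :=
  (0 < e)%N /\ is_submodule E /\
  (exists (n : nat) (X : 'I_n -> vec), generated_by E X) /\
  grade_ge (ann_quot E) 2.

Definition mu (E : vec -> Prop) : nat :=
  min_nat (fun n => exists X : 'I_n -> vec, generated_by E X).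

(* minimal number of generators of the localization E_p:
   E_p is generated by x_1/1,...,x_n/1 (x_i in E) iff s E <= <x_1..x_n> for some s notin p *)
Definition mu_loc (E : vec -> Prop) (p : R -> Prop) : nat :=
  min_nat (fun n => exists (X : 'I_n -> vec) (s : R),
    (forall i, E (X i)) /\ ~ p s /\
    forall v, E v -> exists c : 'I_n -> R, s *: v = \sum_(i < n) c i *: X i).

Definition Fitting_of (n : nat) (X : 'I_n -> vec) (i : nat) : R -> Prop :=
  ideal_gen (fun d => exists (r : 'I_(n - i) -> 'rV[R]_n) (f : 'I_(n - i) -> 'I_n),
    (forall a, \sum_(j < n) r a 0 j *: X j = 0) /\
    d = \det (\matrix_(a < n - i, b < n - i) r a 0 (f b))).

Definition gens (E : vec -> Prop) : {n : nat & 'I_n -> vec} :=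
  epsilon (inhabits (existT (fun n => 'I_n -> vec) 0%N (fun _ => 0)))
    (fun nX => generated_by E (projT2 nX)).

Definition Fitting (i : nat) (E : vec -> Prop) : R -> Prop :=
  Fitting_of (projT2 (gens E)) i.

Inductive Rees (E : vec -> Prop) : {mpoly R[e]} -> Prop :=
| Rees_const (c : R) : Rees E c%:MP
| Rees_lin (a : vec) : E a -> Rees E (\sum_(i < e) a 0 i *: 'X_i)
| Rees_add p q : Rees E p -> Rees E q -> Rees E (p + q)
| Rees_mul p q : Rees E p -> Rees E q -> Rees E (p * q).

Definition analytic_spread (m : R -> Prop) (E : vec -> Prop) : nat :=
  krull_dim_over (Rees E) (fun p => exists c, m c /\ p = c%:MP).

Definition complete_intersection (E : vec -> Prop) : Prop :=
  mu E = (height (Fitting e E) + e - 1)%N.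

Definition equimultiple (m : R -> Prop) (E : vec -> Prop) : Prop :=
  analytic_spread m E = (height (Fitting e E) + e - 1)%N.

Definition generically_ci (E : vec -> Prop) : Prop :=
  forall p, minimal_prime (Fitting e E) p ->
    mu_loc E p = (height (Fitting e E) + e - 1)%N.

End Module.

(* Main.v *)
(** Let U be spanned by r generic elements z_0, ..., z_(r-1) of E, with coefficients in an
    iterated polynomial ring S over R.  If r is at least the analytic spread, a power of the
    ideal generated by the linear forms of E falls into (z_0, ..., z_(r-1)) up to some f outside
    m S; hence U contains (f b)^N S^e for b annihilating R^e / E.  On the other hand,
    successively splitting off the z_j and the basis vectors shows that S^e / U has depth at
    least depth S - (r - e + 1) along any ideal.  If r = c + e - 2 with c the height of the
    Fitting ideal, depth 1 remains along ann (R^e / E), so f^N S^e lies in U and E would be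
    free: thus the analytic spread is at least c + e - 1.  If r = c + e - 1, the depth is gained
    by adding elements h with h E in U, available at every prime of height c over the Fitting
    ideal because E is generically a complete intersection; then f^N E lies in U, and
    Nakayama gives at most r generators. *)
Require Import Defs.
From mathcomp Require Import all_boot all_order all_algebra.
From mathcomp Require Import perm mpoly.
From mathcomp Require Import ring zify.
From mathcomp Require classical_sets.
From Stdlib Require Import ClassicalEpsilon FunctionalExtensionality PropExtensionality.

Set Implicit Arguments.
Unset Strict Implicit.
Unset Printing Implicit Defensive.

Import GRing.Theory.
Local Open Scope ring_scope.

(** The residue field may be finite, so general elements of E need not exist; indeterminate
    coefficients replace them, and each requirement on the [z_j] costs further variables. The
    reduction property at a prime survives a change of coefficients because it reappears when the
    new variable is specialized. Two devices lead back from S to R. McCoy's theorem turns an element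
    of S killed by polynomials, modulo an ideal of R, into an element of R killed by all their
    coefficients. A linear relation over S between vectors defined over R, with one coefficient
    outside m S, yields a relation over R with a unit coefficient; this is what discards [f ^+ N].
    The loss r - e + 1 is the generic codimension of the locus where an e by r matrix has rank less
    than e. The Cohen-Macaulay hypothesis supplies depth c, by a regular sequence inside the ideal
    of those x in R that f carries into the annihilator of S^e / U. Unmixedness supplies one more:
    an associated prime of that sequence over the Fitting ideal has height at most c, so it is
    minimal over it. *)

Lemma predext T (A B : T -> Prop) : (forall x, A x <-> B x) -> A = B.
Proof. by move=> h; apply: functional_extensionality => x; apply: propositional_extensionality. Qed.

Lemma lem (P : Prop) : P \/ ~ P.
Proof. by case: (excluded_middle_informative P); [left|right]. Qed.

Lemma not_forall T (P : T -> Prop) : ~ (forall x, P x) -> exists x, ~ P x.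
Proof.
move=> h; case: (lem (exists x, ~ P x)) => // h1; case: h => x.
by case: (lem (P x)) => // h2; case: h1; exists x.
Qed.

Lemma not_imply (P Q : Prop) : ~ (P -> Q) -> P /\ ~ Q.
Proof. by case: (lem P) => hP; case: (lem Q) => hQ h; split=> //; case: h. Qed.

Lemma nnpp (P : Prop) : ~ ~ P -> P.
Proof. by case: (lem P). Qed.

Lemma choose_fun (A B : Type) (b0 : B) (Q : A -> Prop) (P : A -> B -> Prop) :
  (forall a, Q a -> exists b, P a b) -> exists g : A -> B, forall a, Q a -> P a (g a).
Proof.
move=> h; exists (fun a => epsilon (inhabits b0) (P a)) => a ha.
exact: (epsilon_spec (inhabits b0) (P a) (h a ha)).
Qed.

(** * Submodules of free modules, their polynomial extensions, McCoy's theorem *)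

Section Sub.
Variables (R : comNzRingType) (N : nat) (L : 'rV[R]_N -> Prop).
Hypothesis hL : is_submodule L.

Lemma sub0 : L 0. Proof. by case: hL. Qed.
Lemma subD u v : L u -> L v -> L (u + v). Proof. by case: hL => _ [h _]; apply: h. Qed.
Lemma subZ a v : L v -> L (a *: v). Proof. by case: hL => _ [_ h]; apply: h. Qed.
Lemma subN v : L v -> L (- v). Proof. by rewrite -scaleN1r; apply: subZ. Qed.
Lemma subB u v : L u -> L v -> L (u - v). Proof. by move=> hu hv; apply: subD => //; apply: subN. Qed.
Lemma sub_sum (I : Type) (r : seq I) (P : pred I) (F : I -> 'rV[R]_N) :
  (forall i, P i -> L (F i)) -> L (\sum_(i <- r | P i) F i).
Proof. by move=> h; apply: big_ind => //; [exact: sub0 | move=> *; exact: subD]. Qed.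
End Sub.

Section Coef.
Variables (R : comNzRingType) (N : nat).
Implicit Types (v w : 'rV[{poly R}]_N) (u : 'rV[R]_N) (f : {poly R}).

Definition cf (i : nat) v : 'rV[R]_N := \row_j (v 0 j)`_i.
Definition cst u : 'rV[{poly R}]_N := \row_j (u 0 j)%:P.

Lemma cfD i v w : cf i (v + w) = cf i v + cf i w.
Proof. by apply/rowP => j; rewrite !mxE coefD. Qed.
Lemma cfB i v w : cf i (v - w) = cf i v - cf i w.
Proof. by apply/rowP => j; rewrite !mxE coefB. Qed.
Lemma cf0 i : cf i 0 = 0.
Proof. by apply/rowP => j; rewrite !mxE coef0. Qed.
Lemma cf_sum i (I : Type) (r : seq I) (P : pred I) (F : I -> 'rV[{poly R}]_N) :
  cf i (\sum_(k <- r | P k) F k) = \sum_(k <- r | P k) cf i (F k).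
Proof. by apply: (big_morph (cf i)) => [x y|]; [exact: cfD | exact: cf0]. Qed.
Lemma cfZ i f v : cf i (f *: v) = \sum_(j < i.+1) f`_j *: cf (i - j) v.
Proof. by apply/rowP => k; rewrite !mxE coefM summxE; apply: eq_bigr => j _; rewrite !mxE. Qed.
Lemma cfZC i a v : cf i (a%:P *: v) = a *: cf i v.
Proof. by apply/rowP => k; rewrite !mxE coefCM. Qed.
Lemma cf_ext v w : (forall i, cf i v = cf i w) -> v = w.
Proof.
move=> h; apply/rowP => j; apply/polyP => i.
by move/rowP: (h i) => /(_ j); rewrite !mxE.
Qed.
Lemma cf_cst i u : cf i (cst u) = if i == 0%N then u else 0.
Proof. by apply/rowP => j; rewrite !mxE coefC; case: eqP; rewrite ?mxE. Qed.
Lemma cfXn i k v : cf i ('X^k *: v) = if (i < k)%N then 0 else cf (i - k) v.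
Proof. by apply/rowP => j; rewrite !mxE coefXnM; case: ifP; rewrite ?mxE. Qed.
Lemma cf_bound v : exists n, forall i, (n <= i)%N -> cf i v = 0.
Proof.
exists (\max_j size (v 0%R j))%N => i hi; apply/rowP => j; rewrite !mxE.
by apply: nth_default; apply: leq_trans hi; apply: (leq_bigmax j).
Qed.
Lemma cstD u u' : cst (u + u') = cst u + cst u'.
Proof. by apply/rowP => j; rewrite !mxE polyCD. Qed.
Lemma cstZ a u : cst (a *: u) = a%:P *: cst u.
Proof. by apply/rowP => j; rewrite !mxE polyCM. Qed.
(** The extension L[X], described through coefficients, so that the quotient by [Lx L] is (R^N /
    L)[X]. *)
Definition Lx (L : 'rV[R]_N -> Prop) v := forall i, L (cf i v).

Variable L : 'rV[R]_N -> Prop.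
Hypothesis hL : is_submodule L.

Lemma Lx_sub : is_submodule (Lx L).
Proof.
split; [|split] => [i|u v hu hv i|a v hv i].
- by rewrite cf0; apply: sub0.
- by rewrite cfD; apply: subD.
- by rewrite cfZ; apply: sub_sum => // j _; apply: subZ.
Qed.

Lemma Lx_cst u : Lx L (cst u) <-> L u.
Proof.
split=> [/(_ 0%N)|h i]; rewrite cf_cst //=.
by case: ifP => // _; apply: sub0.
Qed.

(** McCoy's theorem for a family W acting on (R^N / L)[X]. Take f in W and its last coefficient f_j
    not killing g: then f_j g is again killed by W, and its leading term has disappeared. The
    induction is on a bound for the degree of g modulo L. *)
Lemma mccoy (W : {poly R} -> Prop) (g : 'rV[{poly R}]_N) :
  (forall f, W f -> Lx L (f *: g)) -> ~ Lx L g ->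
  exists gam, ~ L gam /\ forall f, W f -> forall j, L (f`_j *: gam).
Proof.
have [n hn] := cf_bound g.
have {hn} : forall i, (n <= i)%N -> L (cf i g) by move=> i hi; rewrite hn //; apply: sub0.
elim: n g => [|n IH] g hn hW hg; first by case: hg => i; apply: hn.
case: (lem (forall f, W f -> forall j, Lx L ((f`_j)%:P *: g))) => [h|].
  have [i hi] := not_forall hg; exists (cf i g); split=> // f hf j.
  by move: (h f hf j i); rewrite cfZC.
move=> h; have [f h1] := not_forall h; have [hf h2] := not_imply h1; have [j0 hj0] := not_forall h2.
have [j [hj hjmax]] : exists j, ~ Lx L ((f`_j)%:P *: g) /\
    forall k, (j < k)%N -> Lx L ((f`_k)%:P *: g).
  apply: nnpp => hno; apply: hj0.
  suff hall : forall d k, (size f <= k + d)%N -> Lx L ((f`_k)%:P *: g).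
    by apply: (hall (size f)); rewrite leq_addl.
  elim=> [|d IHd] k hk.
    by rewrite addn0 in hk; rewrite nth_default // polyC0 scale0r; exact: (sub0 Lx_sub).
  apply: nnpp => hk2; apply: hno; exists k; split=> // k' hk'.
  by apply: IHd; apply: leq_trans hk _; rewrite addnS -addSn leq_add2r.
apply: (IH ((f`_j)%:P *: g)) => //; last first.
  move=> f' hf'; rewrite scalerA mulrC -scalerA; apply: (subZ Lx_sub); exact: hW.
move=> i; rewrite leq_eqVlt => /orP [/eqP <-|hi]; last by rewrite cfZC; apply: subZ => //; apply: hn.
(* Modulo L the coefficient of X^(n+j) in f g is f_j g_n alone: the terms of index above j vanish by
   the choice of j, those of index below j by the degree of g. *)
have := hW f hf (n + j)%N; rewrite cfZ cfZC.
have hjn : (j < (n + j).+1)%N by rewrite ltnS leq_addl.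
rewrite (bigD1 (Ordinal hjn)) //= addnK => h3.
rewrite -[X in L X](addrK (\sum_(i0 < (n + j).+1 | i0 != Ordinal hjn) f`_i0 *: cf (n + j - i0) g)).
apply: subB => //; apply: sub_sum => // k hk.
case: (ltngtP k j) => hkj.
- by apply: subZ => //; apply: hn; rewrite ltn_subRL addnC ltn_add2l.
- by rewrite -cfZC; apply: hjmax.
- by case/eqP: hk; apply: val_inj.
Qed.

End Coef.

(** * Depth along an ideal *)

Section ImPre.
Variables (R : comNzRingType) (N' N : nat) (Z : 'M[R]_(N', N)) (L : 'rV[R]_N -> Prop).
Hypothesis hL : is_submodule L.

(** With [pre_im], the ends of the exact sequence 0 -> R^N' / [pre_im Z L] -> R^N / L -> R^N /
    [im_add Z L] -> 0 induced by Z, along which depth is compared below. *)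
Definition im_add : 'rV[R]_N -> Prop := fun v => exists u, L (v - u *m Z).
Definition pre_im : 'rV[R]_N' -> Prop := fun u => L (u *m Z).

Lemma im_sub : is_submodule im_add.
Proof.
split; [|split].
- by exists 0; rewrite mul0mx subr0; apply: sub0.
- move=> u v [a ha] [b hb]; exists (a + b).
  by rewrite mulmxDl opprD addrACA; apply: subD.
- by move=> c v [u hu]; exists (c *: u); rewrite -scalemxAl -scalerBr; apply: subZ.
Qed.

Lemma pre_sub : is_submodule pre_im.
Proof.
rewrite /pre_im; split; [|split].
- by rewrite mul0mx; apply: sub0.
- by move=> u v hu hv; rewrite mulmxDl; apply: subD.
- by move=> c v hv; rewrite -scalemxAl; apply: subZ.
Qed.

Lemma im_le v : L v -> im_add v.
Proof. by exists 0; rewrite mul0mx subr0. Qed.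

End ImPre.

Section Gen.
Variables (R : comNzRingType) (N : nat) (L : 'rV[R]_N -> Prop) (w : seq R).
Hypothesis hL : is_submodule L.

Definition nzd (f : R) := forall v, L (f *: v) -> L v.
Definition torsion_free := forall v, (forall a, a \in w -> L (a *: v)) -> L v.
(* The generic element [Poly w] of the ideal generated by w, over R[X]. *)
Definition Lq : 'rV[{poly R}]_N -> Prop := fun v => exists u, Lx L (v - Poly w *: u).

Lemma Lq_sub : is_submodule Lq.
Proof.
have hx := Lx_sub hL; split; [|split].
- by exists 0; rewrite scaler0 subr0; apply: (sub0 hx).
- move=> u v [a ha] [b hb]; exists (a + b).
  by rewrite scalerDr opprD addrACA; apply: (subD hx).
- move=> c v [u hu]; exists (c *: u).
  by rewrite scalerA mulrC -scalerA -scalerBr; apply: (subZ hx).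
Qed.

(** The reason for testing depth on [Poly w]: by McCoy, a nonzero class killed by the generic
    element produces a nonzero class of R^N / L killed by every element of w. *)
Lemma generic_nzd : torsion_free -> forall v, Lx L (Poly w *: v) -> Lx L v.
Proof.
move=> ht v hv; apply: nnpp => hn.
have hW f : f = Poly w -> Lx L (f *: v) by move=> ->.
have [gam [h1 h2]] := mccoy hL hW hn.
apply: h1; apply: ht => a /(nthP 0) [i _ <-].
by rewrite -coef_Poly; exact: h2.
Qed.
End Gen.

Lemma Lx_nzd (R : comNzRingType) N (L : 'rV[R]_N -> Prop) a :
  nzd L a -> nzd (Lx L) a%:P.
Proof. by move=> h v hv i; apply: h; rewrite -cfZC; apply: hv. Qed.

(* R^N / L has depth at least k along the ideal (w): the generic elements [Poly w] over R[X], R[X][X'], ... form a regular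
   sequence. This form of depth needs no Noetherian hypothesis, so that it survives passing to towers of polynomial rings. *)
Fixpoint D (k : nat) : forall (R : comNzRingType) (N : nat), ('rV[R]_N -> Prop) -> seq R -> Prop :=
  if k is k'.+1 then fun R N L w => torsion_free L w /\ @D k' {poly R} N (Lq L w) (map polyC w)
  else fun _ _ _ _ => True.

Lemma D_mono k (R : comNzRingType) N (L : 'rV[R]_N -> Prop) w : D k.+1 L w -> D k L w.
Proof.
elim: k R N L w => [|k IH] R N L w //.
by move=> [h1 h2]; split=> //; apply: IH.
Qed.

Lemma D_le j k (R : comNzRingType) N (L : 'rV[R]_N -> Prop) w : (j <= k)%N -> D k L w -> D j L w.
Proof.
move/subnK <-; elim: (k - j)%N => [|d IH] //; rewrite addSn => h; apply: IH; exact: D_mono.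
Qed.

Lemma D_full k (R : comNzRingType) N (L : 'rV[R]_N -> Prop) w : (forall v, L v) -> D k L w.
Proof.
elim: k R N L w => [|k IH] R N L w // h; split; first by move=> v _; apply: h.
by apply: IH => v; exists 0 => i; apply: h.
Qed.

Section Exact.
Variables (R : comNzRingType) (N' N : nat) (Z : 'M[R]_(N', N)) (L : 'rV[R]_N -> Prop) (w : seq R).
Hypothesis hL : is_submodule L.
Let Zc := map_mx polyC Z.

Lemma cf_mulmx i (u : 'rV[{poly R}]_N') : cf i (u *m Zc) = cf i u *m Z.
Proof.
apply/rowP => j; rewrite !mxE coef_sum; apply: eq_bigr => k _.
by rewrite !mxE coefMC.
Qed.
Lemma cst_mulmx (u : 'rV[R]_N') : cst (u *m Z) = cst u *m Zc.
Proof.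
by apply: cf_ext => i; rewrite cf_mulmx !cf_cst; case: ifP; rewrite ?mul0mx.
Qed.

Lemma Lx_im : Lx (im_add Z L) = im_add Zc (Lx L).
Proof.
apply: predext => v; split; last first.
  by move=> [u hu] i; exists (cf i u); rewrite -cf_mulmx -cfB; exact: (hu i).
move=> h; have [n hn] := cf_bound v.
have [g hg] := @choose_fun nat _ 0 (fun _ => True) (fun i u => L (cf i v - u *m Z)) (fun i _ => h i).
exists (\sum_(i < n) 'X^i *: cst (g i)) => i.
rewrite cfB cf_mulmx cf_sum.
case: (ltnP i n) => hi.
  rewrite (bigD1 (Ordinal hi)) //= big1 => [|j hj].
    by rewrite addr0 cfXn ltnn subnn cf_cst /=; exact: hg.
  rewrite cfXn cf_cst; case: ltnP => // h1; case: eqP => // h2.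
  by case/eqP: hj; apply/val_inj/eqP; rewrite /= eqn_leq h1 -subn_eq0 h2.
rewrite hn // big1 => [|j _]; first by rewrite mul0mx subrr; apply: (sub0 hL).
rewrite cfXn cf_cst; case: ltnP => // h1; case: eqP => // h2.
by move: (ltn_ord j); rewrite ltnNge (leq_trans hi) // -subn_eq0 h2.
Qed.

Lemma Lq_im : Lq (im_add Z L) w = im_add Zc (Lq L w).
Proof.
rewrite /Lq Lx_im; apply: predext => v; split=> [[u [u' h]]|[u [u' h]]].
  by exists u', u; rewrite addrAC.
by exists u', u; rewrite addrAC.
Qed.

(** The exact sequence of Z stays exact modulo [Poly w], because [Poly w] is regular on the
    cokernel: if u Z = [Poly w] t modulo L, then t lies in the image of Z modulo L, and u differs
    from a multiple of [Poly w] by an element of the kernel. *)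
Lemma pre_Lq : torsion_free (im_add Z L) w -> pre_im Zc (Lq L w) = Lq (pre_im Z L) w.
Proof.
move=> ht; apply: predext => u; split=> [[t h]|[t h]].
  have hx := Lx_sub hL.
  have : Lx (im_add Z L) (Poly w *: t).
    rewrite Lx_im; exists u.
    by rewrite -opprB; apply: (subN hx).
  move/(generic_nzd (im_sub Z hL) ht); rewrite Lx_im => -[u' hu'].
  exists u' => i; rewrite /pre_im -cf_mulmx.
  suff: Lx L ((u - Poly w *: u') *m Zc) by apply.
  rewrite mulmxBl -scalemxAl -(subrK (Poly w *: t) (u *m Zc)) -addrA -scalerBr.
  by apply: (subD hx) => //; apply: (subZ hx).
exists (t *m Zc) => i; rewrite scalemxAl -mulmxBl cf_mulmx; exact: h.
Qed.

End Exact.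

(** The depth lemma depth C >= min (depth B, depth A - 1) for 0 -> A -> B -> C -> 0. Only
    torsion-freeness of C needs an argument; afterwards the whole sequence is reduced modulo the
    generic element. *)
Lemma D_im k (R : comNzRingType) N' N (Z : 'M[R]_(N', N)) (L : 'rV[R]_N -> Prop) w :
  is_submodule L -> D k L w -> D k.+1 (pre_im Z L) w -> D k (im_add Z L) w.
Proof.
elim: k R N' N Z L w => [|k IH] R N' N Z L w hL // [hL1 hL2] [hP1 hP2].
have hx := Lx_sub hL.
have ht : torsion_free (im_add Z L) w.
  move=> c hc.
  have [g hg] := @choose_fun R _ 0 (fun a => a \in w) (fun a u => L (a *: c - u *m Z)) hc.
  (* The connecting map: if w kills c in C, then [Poly w] c = u Z for this u. The class of u in A
     modulo [Poly w] is killed by w, hence zero because A has depth at least two. *)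
  pose u := \sum_(i < size w) 'X^i *: cst (g w`_i).
  have e : Poly w = \sum_(i < size w) 'X^i * (w`_i)%:P.
    apply/polyP => k0; rewrite coef_Poly coef_sum.
    case: (ltnP k0 (size w)) => hk.
      rewrite (bigD1 (Ordinal hk)) //= big1 => [|i /eqP hi]; rewrite coefXnM coefC ?ltnn ?subnn ?addr0 //.
      case: ltnP => // h1; case: eqP => // h2; case: hi; apply/val_inj/eqP; rewrite /= eqn_leq h1.
      by rewrite -subn_eq0 h2.
    rewrite nth_default // big1 // => i _; rewrite coefXnM coefC; case: ltnP => // h1.
    case: eqP => // h2; move: (ltn_ord i); rewrite ltnNge (leq_trans hk) //.
    by rewrite -subn_eq0 h2.
  have h1 : Lx L (Poly w *: cst c - u *m map_mx polyC Z).
    rewrite e scaler_suml mulmx_suml -sumrB; apply: (sub_sum hx) => i _.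
    rewrite -scalerA -cstZ -scalemxAl -scalerBr; apply: (subZ hx) => //.
    rewrite -cst_mulmx -[X in Lx L X]/(cst _ - cst _) -[- cst _]scaleN1r -polyCN -cstZ -cstD scaleN1r.
    by apply/Lx_cst => //; apply/hg/mem_nth.
  have hP := pre_sub Z hL.
  have : Lq (pre_im Z L) w u.
    have [htq _] := hP2.
    apply: htq => b /mapP [a ha ->]; exists (cst (g a)).
    suff: Lx L ((a%:P *: u - Poly w *: cst (g a)) *m map_mx polyC Z).
      by move=> h i; rewrite /pre_im -cf_mulmx; apply: h.
    have -> : (a%:P *: u - Poly w *: cst (g a)) *m map_mx polyC Z
      = Poly w *: cst (a *: c - g a *m Z)
        - a%:P *: (Poly w *: cst c - u *m map_mx polyC Z).
      rewrite mulmxBl -!scalemxAl cstD -[- (g a *m Z)]scaleN1r cstZ cstZ cst_mulmx polyCN scaleN1r.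
      by rewrite !scalerBr !scalerA [a%:P * Poly w]mulrC opprB [RHS]addrC addrA subrK.
    apply: (subB hx) => //; apply: (subZ hx) => //.
    by apply/Lx_cst => //; apply: hg.
  case=> u' hu'.
  (* As u is [Poly w] u' modulo the kernel, the regular element [Poly w] cancels, and constant
     coefficients exhibit c in the image. *)
  have h2 : Lx L (Poly w *: (cst c - u' *m map_mx polyC Z)).
    have -> : Poly w *: (cst c - u' *m map_mx polyC Z)
      = (Poly w *: cst c - u *m map_mx polyC Z) + (u - Poly w *: u') *m map_mx polyC Z.
      by rewrite mulmxBl -scalemxAl scalerBr addrA subrK.
    by apply: (subD hx) => // i; rewrite cf_mulmx; apply: hu'.
  have /(_ 0%N) := generic_nzd hL hL1 h2.
  by rewrite cfB cf_cst cf_mulmx /= => h3; exists (cf 0 u').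
split=> //; rewrite Lq_im //.
by apply: IH => //; [exact: Lq_sub | rewrite pre_Lq].
Qed.

(** The companion inequality depth A >= min (depth B, depth C + 1); torsion-freeness of A is
    inherited from B. *)
Lemma D_pre k (R : comNzRingType) N' N (Z : 'M[R]_(N', N)) (L : 'rV[R]_N -> Prop) w :
  is_submodule L -> D k.+1 L w -> D k (im_add Z L) w -> D k.+1 (pre_im Z L) w.
Proof.
elim: k R N' N Z L w => [|k IH] R N' N Z L w hL [hL1 hL2].
  move=> _; split=> // v hv; apply: hL1 => a ha.
  by rewrite scalemxAl; apply: hv.
move=> [hi1 hi2]; split.
  by move=> v hv; apply: hL1 => a ha; rewrite scalemxAl; apply: hv.
rewrite -pre_Lq //; apply: IH => //; first exact: Lq_sub.
by rewrite -Lq_im.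
Qed.

Definition addf (R : comNzRingType) N (f : R) (L : 'rV[R]_N -> Prop) := im_add f%:M L.

Lemma pre_nzd (R : comNzRingType) N (f : R) (L : 'rV[R]_N -> Prop) :
  is_submodule L -> nzd L f -> pre_im f%:M L = L.
Proof.
move=> hL hf; apply: predext => v; rewrite /pre_im mul_mx_scalar.
by split; [exact: hf | exact: subZ].
Qed.

(** This is [D_im] for 0 -> M -> M -> M / f M -> 0; f may lie outside (w). *)
Lemma D_quot k (R : comNzRingType) N (f : R) (L : 'rV[R]_N -> Prop) w :
  is_submodule L -> nzd L f -> D k.+1 L w -> D k (addf f L) w.
Proof. by move=> hL hf h; apply: D_im => //; [exact: D_mono | rewrite pre_nzd]. Qed.

(** The generic element is regular modulo a; exchanging the two shows that a is regular modulo the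
    generic element, so that the induction continues over R[X]. *)
Lemma D_reg k (R : comNzRingType) N (a : R) (L : 'rV[R]_N -> Prop) w :
  is_submodule L -> a \in w -> nzd L a -> D k (addf a L) w -> D k.+1 L w.
Proof.
elim: k R N a L w => [|k IH] R N a L w hL ha hn.
  by move=> _; split=> // v hv; apply: hn; apply: hv.
move=> [h1 h2]; split; first by move=> v hv; apply: hn; apply: hv.
have ea : map_mx polyC (a%:M : 'M_N) = (a%:P)%:M by rewrite map_scalar_mx.
apply: (IH _ _ a%:P); [exact: Lq_sub|exact: map_f| |by rewrite /addf -ea -Lq_im].
have hx := Lx_sub hL.
move=> v [u hu].
have : Lx (addf a L) (Poly w *: u).
  rewrite /addf Lx_im //; exists v; rewrite ea mul_mx_scalar.
  by rewrite -opprB; apply: (subN hx).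
move/(generic_nzd (im_sub _ hL) h1); rewrite /addf Lx_im // ea => -[u' hu'].
exists u'; apply: (Lx_nzd hn).
rewrite scalerBr -(subrK (Poly w *: u) (a%:P *: v)) -addrA; apply: (subD hx) => //.
rewrite scalerA mulrC -scalerA -scalerBr; apply: (subZ hx) => //.
by move: hu'; rewrite mul_mx_scalar.
Qed.

(** The quotient is a power of R / K, with one copy for each coordinate in P. *)
Lemma D_coord k (R : comNzRingType) N (P : pred 'I_N) (K : 'rV[R]_1 -> Prop) w :
  D k K w -> D k (fun v : 'rV[R]_N => forall i, P i -> K (v 0 i)%:M) w.
Proof.
elim: k R K w => [|k IH] R K w // [h1 h2].
split=> [v hv i hi|].
  by apply: h1 => a ha; have := hv a ha i hi; rewrite mxE scale_scalar_mx.
suff -> : Lq (fun v : 'rV[R]_N => forall i, P i -> K (v 0 i)%:M) w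
   = (fun v => forall i, P i -> Lq K w (v 0 i)%:M) by apply: IH.
have ec (x : {poly R}) j : cf j (x%:M : 'rV_1) = (x`_j)%:M.
  by apply/rowP => i; rewrite !mxE !ord1 /= !mulr1n.
apply: predext => v; split=> [[u hu] i hi|h].
  exists (u 0 i)%:M => j; have := hu j i hi; rewrite !mxE => hh.
  by rewrite scale_scalar_mx -raddfB /= ec.
have [g hg] := choose_fun 0 h.
exists (\row_i (g i 0 0)) => j i hi; have := hg i hi j.
rewrite [g i]mx11_scalar scale_scalar_mx -raddfB /= ec.
by rewrite !mxE.
Qed.

(** * Primes *)

Section PrimeExistence.
Variables (C : comNzRingType) (S J M : C -> Prop).
Hypotheses (S0 : S 0) (S1 : S 1) (SD : forall x y, S x -> S y -> S (x + y))
  (SM : forall x y, S x -> S y -> S (x * y)).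
Hypotheses (JS : forall x, J x -> S x) (J0 : J 0)
  (JD : forall x y, J x -> J y -> J (x + y)) (JM : forall a x, S a -> J x -> J (a * x)).
Hypotheses (M1 : M 1) (MM : forall x y, M x -> M y -> M (x * y)).
Hypothesis disj : forall x, J x -> ~ M x.

(** Primes are taken in a subset S of the ambient ring because Rees algebras occur as subsets of a
    polynomial ring. An ideal maximal among those containing J and missing M is prime. *)
Lemma prime_avoiding : exists P, sub_prime S P /\ (forall x, J x -> P x) /\ forall x, M x -> ~ P x.
Proof.
pose good (Y : C -> Prop) := [/\ (forall x, Y x -> S x), (forall x y, Y x -> Y y -> Y (x + y)),
  (forall a x, S a -> Y x -> Y (a * x)) & forall x, Y x -> ~ M x].
(* Adding J keeps the union of the empty chain admissible. *)
pose hull (X : C -> Prop) := fun x => J x \/ X x.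
have [F hF htot|A [hA hmax]] := @classical_sets.Zorn_bigcup C (fun X => good (hull X)).
  case: (lem (exists X, F X)) => [[X0 hX0]|hno]; last first.
    have e : hull (classical_sets.bigcup F id) = J.
      apply: predext => x; split; last by left.
      by case=> // -[X hX _]; case: hno; exists X.
    by rewrite e; split.
  have up X x : F X -> hull X x -> hull (classical_sets.bigcup F id) x.
    by move=> hX [h|h]; [left | right; exists X].
  have dn x : hull (classical_sets.bigcup F id) x -> exists2 X, F X & hull X x.
    by case=> [h|[X hX h]]; [exists X0 => //; left | exists X => //; right].
  have mono X Y x : (forall z, X z -> Y z) -> hull X x -> hull Y x.
    by move=> h [h1|h1]; [left | right; apply: h].
  split=> [x /dn [X hX]|x y /dn [X hX hx] /dn [Y hY hy]|a x ha /dn [X hX hx]|x /dn [X hX hx]].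
  - by have [h _ _ _] := hF _ hX; apply: h.
  - case: (htot _ _ hX hY) => h.
      by have [_ h2 _ _] := hF _ hY; apply: (up Y) => //; apply: h2 => //; apply: mono hx.
    by have [_ h2 _ _] := hF _ hX; apply: (up X) => //; apply: h2 => //; apply: mono hy.
  - by have [_ _ h2 _] := hF _ hX; apply: (up X) => //; apply: h2.
  - by have [_ _ _ h2] := hF _ hX; apply: h2.
pose P := hull A; have [PS PD PM PN] := hA.
have P0 : P 0 by left.
exists P; split; last by split=> [x hx|x hM hP]; [left | exact: PN hM].
split=> //; split=> //; split=> //; split=> //; split; first by move=> h; exact: (PN _ h).
move=> a b ha hb hab; apply: nnpp => hno.
have meet c : S c -> ~ P c -> exists s p, [/\ S s, P p & M (p + s * c)].
  move=> hc hPc; pose B x := exists s p, [/\ S s, P p & x = p + s * c].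
  apply: nnpp => hne; apply: (hmax B).
    split=> [x hx|hBA]; first by exists 0, x; rewrite mul0r addr0; split=> //; right.
    by apply: hPc; right; apply: hBA; exists 1, 0; rewrite mul1r add0r.
  have e : hull B = B.
    apply: predext => x; split; last by right.
    by case=> // hx; exists 0, x; rewrite mul0r addr0; split=> //; left.
  rewrite e; split.
  - by move=> x [s [p [hs hp ->]]]; apply: SD; [apply: PS | apply: SM].
  - move=> x y [s [p [hs hp ->]]] [s' [p' [hs' hp' ->]]].
    by exists (s + s'), (p + p'); rewrite mulrDl addrACA; split; [apply: SD|apply: PD|].
  - move=> d x hd [s [p [hs hp ->]]].
    by exists (d * s), (d * p); rewrite mulrDr mulrA; split; [apply: SM|apply: PM|].
  - by move=> x [s [p [hs hp ->]]] hM; apply: hne; exists s, p.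
case: (lem (P a)) => hPa; first by apply: hno; left.
case: (lem (P b)) => hPb; first by apply: hno; right.
have [s [p [hs hp h1]]] := meet a ha hPa.
have [s' [p' [hs' hp' h2]]] := meet b hb hPb.
apply: (PN _ _ (MM h1 h2)).
have -> : (p + s * a) * (p' + s' * b) = (p' + s' * b) * p + (s * a) * p' + (s * s') * (a * b) by ring.
apply: (PD); first apply: (PD); apply: (PM) => //; try exact: SM.
by apply: SD; [apply: PS | apply: SM].
Qed.
End PrimeExistence.

Section Ideals.
Variable R : comNzRingType.
Implicit Types (I J K P Q : R -> Prop).

Lemma id0 I : is_ideal I -> I 0. Proof. by case. Qed.
Lemma idD I x y : is_ideal I -> I x -> I y -> I (x + y). Proof. by case=> _ [h _]; apply: h. Qed.
Lemma idM I a x : is_ideal I -> I x -> I (a * x). Proof. by case=> _ [_ h]; apply: h. Qed.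
Lemma idMr I a x : is_ideal I -> I x -> I (x * a). Proof. by rewrite mulrC; apply: idM. Qed.
Lemma idN I x : is_ideal I -> I x -> I (- x). Proof. by rewrite -mulN1r; apply: idM. Qed.
Lemma idB I x y : is_ideal I -> I x -> I y -> I (x - y).
Proof. by move=> hI hx hy; apply: idD => //; apply: idN. Qed.
Lemma id_sum I (T : Type) (r : seq T) (p : pred T) (F : T -> R) :
  is_ideal I -> (forall i, p i -> I (F i)) -> I (\sum_(i <- r | p i) F i).
Proof. by move=> hI h; apply: big_ind => //; [exact: id0 | move=> *; exact: idD]. Qed.

Lemma prime_ideal P : is_prime P -> is_ideal P.
Proof. by case=> _ [h0 [hD [hM _]]]; split=> //; split=> // a x; apply: hM. Qed.
Lemma prime1 P : is_prime P -> ~ P 1.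
Proof. by case=> _ [_ [_ [_ []]]]. Qed.
Lemma primeM P a b : is_prime P -> P (a * b) -> P a \/ P b.
Proof. by case=> _ [_ [_ [_ [_ h]]]]; apply: h. Qed.
Lemma primeNM P a b : is_prime P -> ~ P a -> ~ P b -> ~ P (a * b).
Proof. by move=> hP ha hb /(primeM hP) []. Qed.
Lemma primeX P a n : is_prime P -> P (a ^+ n) -> P a.
Proof.
move=> hP; elim: n => [|n IH]; first by rewrite expr0 => /(prime1 hP).
by rewrite exprS => /(primeM hP) [].
Qed.
Lemma prime_prod P (T : Type) (r : seq T) (p : pred T) (F : T -> R) :
  is_prime P -> (forall i, p i -> ~ P (F i)) -> ~ P (\prod_(i <- r | p i) F i).
Proof.
move=> hP h; apply: (big_ind (fun x => ~ P x)) => //; first exact: prime1.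
by move=> x y; apply: primeNM.
Qed.
Lemma mk_prime P : is_ideal P -> ~ P 1 -> (forall a b, P (a * b) -> P a \/ P b) -> is_prime P.
Proof.
move=> [h0 [hD hM]] h1 hP; do ![split=> //].
  by move=> a x _; apply: hM.
by move=> a b _ _; apply: hP.
Qed.

Lemma exists_prime_avoiding (J M : R -> Prop) : is_ideal J ->
  M 1 -> (forall x y, M x -> M y -> M (x * y)) -> (forall x, J x -> ~ M x) ->
  exists P, is_prime P /\ (forall x, J x -> P x) /\ forall x, M x -> ~ P x.
Proof.
move=> [J0 [JD JM]] M1 MM dis.
by apply: prime_avoiding => //; move=> a x _; apply: JM.
Qed.

(** Otherwise repeated choice of a strictly larger member gives an ascending chain whose union is
    not finitely generated. *)
Lemma noeth_max (F : (R -> Prop) -> Prop) : noetherian R ->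
  (forall I, F I -> is_ideal I) -> (exists I, F I) ->
  exists I, F I /\ forall J, F J -> (forall x, I x -> J x) -> forall x, J x -> I x.
Proof.
move=> hN hF [I0 hI0]; apply: nnpp => hno.
have nx I : F I -> exists J, F J /\ ((forall x, I x -> J x) /\ exists x, J x /\ ~ I x).
  move=> hI; apply: nnpp => h; apply: hno; exists I; split=> // J hJ hIJ x hx.
  by apply: nnpp => hx'; apply: h; exists J; do !split=> //; exists x.
have [g hg] := choose_fun (fun _ => True) nx.
pose ch k := iter k g I0.
have hch k : F (ch k) by elim: k => [|k IH] //=; case: (hg _ IH).
have up k d x : ch k x -> ch (d + k)%N x.
  by elim: d => [|d IH] // h; rewrite addSn /=; have [_ [h2 _]] := hg _ (hch (d + k)%N); apply: h2; apply: IH.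
have le i j x : (i <= j)%N -> ch i x -> ch j x by move/subnK <-; apply: up.
have hU : is_ideal (fun x => exists k, ch k x).
  split; first by exists 0%N; exact: (id0 (hF _ (hch 0%N))).
  split=> [x y [i hi] [j hj]|a x [i hi]]; last by exists i; apply: (idM _ (hF _ (hch i))).
  by exists (maxn i j); apply: (idD (hF _ (hch _))); [apply: le hi; apply: leq_maxl|apply: le hj; apply: leq_maxr].
have [n [s hs]] := hN _ hU.
have hs1 (i : 'I_n) : exists k, ch k (s i).
  apply/hs; exists (fun j => (j == i)%:R); rewrite (bigD1 i) //= eqxx mul1r big1 ?addr0 // => j /negbTE ->.
  by rewrite mul0r.
have [f hf] := @choose_fun 'I_n _ 0%N (fun _ => True) (fun i k => ch k (s i)) (fun i _ => hs1 i).
have [_ [_ [x [hx hx']]]] := hg _ (hch (\max_i f i)).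
have [|c ec] := (hs x).1; first by exists (\max_i f i).+1.
apply: hx'; rewrite ec; apply: id_sum; first exact: (hF _ (hch _)).
move=> i _; apply: (idM _ (hF _ (hch _))).
by apply: le (hf i I); apply: (leq_bigmax i).
Qed.

(** The colon ideal (K : g); the associated primes of R / K are the prime ones among them with g
    outside K. *)
Definition ann (K : R -> Prop) (g r : R) : Prop := K (r * g).

Lemma ann_ideal K g : is_ideal K -> is_ideal (ann K g).
Proof.
move=> hK; rewrite /ann; split; first by rewrite mul0r; apply: id0.
split=> [x y hx hy|a x hx]; first by rewrite mulrDl; apply: idD.
by rewrite -mulrA; apply: idM.
Qed.

Lemma max_ann_prime K g : is_ideal K -> ~ K g ->
  (forall h, ~ K h -> (forall x, ann K g x -> ann K h x) -> forall x, ann K h x -> ann K g x) ->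
  is_prime (ann K g).
Proof.
move=> hK hg hmax; apply: mk_prime; first exact: ann_ideal.
  by rewrite /ann mul1r.
move=> a b hab; case: (lem (ann K g b)) => hb; [by right | left].
apply: (hmax (b * g)) => //; last by rewrite /ann mulrA.
by move=> x hx; rewrite /ann mulrCA; apply: idM.
Qed.

Lemma exists_max_ann K : noetherian R -> is_ideal K -> forall v, ~ K v ->
  exists g, [/\ ~ K g, is_prime (ann K g), (forall x, ann K v x -> ann K g x) &
   forall h, ~ K h -> (forall x, ann K g x -> ann K h x) -> forall x, ann K h x -> ann K g x].
Proof.
move=> hN hK v hv.
pose F I := exists g, [/\ ~ K g, I = ann K g & forall x, ann K v x -> ann K g x].
have [_ [g [_ -> _]]||I [[g [hg -> hvg]] hmax]] := @noeth_max F hN; first exact: ann_ideal.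
  by exists (ann K v), v.
have hm h : ~ K h -> (forall x, ann K g x -> ann K h x) -> forall x, ann K h x -> ann K g x.
  by move=> hh hle; apply: hmax => //; exists h; split=> // x hx; apply: hle; apply: hvg.
by exists g; split=> //; apply: max_ann_prime.
Qed.

Lemma prod_mod I (T : Type) (r : seq T) (p : pred T) (F G : T -> R) : is_ideal I ->
  (forall i, p i -> I (F i - G i)) -> I (\prod_(i <- r | p i) F i - \prod_(i <- r | p i) G i).
Proof.
move=> hI h; apply: (big_ind2 (fun a b => I (a - b))) => //; first by rewrite subrr; apply: id0.
move=> a b a' b' h1 h2; have -> : a * a' - b * b' = a' * (a - b) + b * (a' - b') by ring.
by apply: idD => //; apply: idM.
Qed.

Lemma det_mod I n (A B : 'M[R]_n) : is_ideal I ->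
  (forall i j, I (A i j - B i j)) -> I (\det A - \det B).
Proof.
move=> hI h; rewrite /determinant -sumrB; apply: id_sum => // s _.
by rewrite -mulrBr; apply: idM => //; apply: prod_mod.
Qed.

(** Cramer's rule in quotient form. L is a bare predicate with the closure properties of a
    submodule, so that the lemma yields Nakayama arguments both for ideals and for graded pieces of
    algebras. *)
Lemma det_trick (V : lmodType R) (L : V -> Prop) n (A : 'M[R]_n) (r : 'I_n -> V) :
  L 0 -> (forall u v, L u -> L v -> L (u + v)) -> (forall a v, L v -> L (a *: v)) ->
  (forall i, L (\sum_j A i j *: r j)) -> forall k, L (\det A *: r k).
Proof.
move=> L0 LD LZ h k.
have -> : \det A *: r k = \sum_i (\adj A) k i *: \sum_j A i j *: r j.
  under eq_bigr do rewrite scaler_sumr.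
  rewrite exchange_big /= (bigD1 k) //= [X in _ + X]big1 ?addr0 => [|j hj].
    under eq_bigr do rewrite scalerA.
    rewrite -scaler_suml; congr (_ *: _).
    by have := mul_adj_mx A => /matrixP /(_ k k); rewrite !mxE eqxx mulr1n => <-.
  under eq_bigr do rewrite scalerA.
  rewrite -scaler_suml.
  have := mul_adj_mx A => /matrixP /(_ k j); rewrite !mxE eq_sym (negbTE hj) mulr0n => ->.
  by rewrite scale0r.
by apply: big_ind => // i _; apply: LZ.
Qed.
End Ideals.

(** * Krull's height theorem *)

Section PIT.
Variables (R : comNzRingType) (hN : noetherian R).
Variables (P P0 : R -> Prop) (x : R).
Hypotheses (hP : is_prime P) (hP0 : is_prime P0) (hx : P x).
Hypothesis hmin : forall Q, is_prime Q -> (forall z, P0 z -> Q z) -> (forall z, Q z -> P z) -> Q x ->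
  forall z, P z -> Q z.

Let I0 := prime_ideal hP0.
Let IP := prime_ideal hP.

(** The contraction to R of the localization of L at P. *)
Definition sat (L : R -> Prop) r := exists s, ~ P s /\ L (s * r).

Lemma sat_ideal L : is_ideal L -> is_ideal (sat L).
Proof.
move=> hL; split; first by exists 1; rewrite mulr0; split; [exact: prime1 | exact: id0].
split=> [a b [s [hs ha]] [t [ht hb]]|a b [s [hs hb]]].
  exists (s * t); split; first exact: primeNM.
  by rewrite mulrDr; apply: idD => //; [rewrite mulrAC mulrC; apply: idM | rewrite -mulrA; apply: idM].
by exists s; split=> //; rewrite mulrCA; apply: idM.
Qed.

Lemma sat_sat L s r : ~ P s -> sat L (s * r) -> sat L r.
Proof. by move=> hs [t [ht h]]; exists (t * s); split; [exact: primeNM | rewrite -mulrA]. Qed.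

Lemma sat_le L r : L r -> sat L r.
Proof. by exists 1; rewrite mul1r; split=> //; exact: prime1. Qed.

Variable y : R.

(** The contraction to R of the ideal generated by y^j in the localization of R / P0 at P with x
    inverted. These decreasing ideals take the place of symbolic powers in Krull's argument. *)
Definition JJ (j : nat) (r : R) := exists s i c, ~ P s /\ P0 (s * x ^+ i * r - c * y ^+ j).

Lemma JJ_ideal j : is_ideal (JJ j).
Proof.
split.
  exists 1, 0%N, 0; rewrite mulr0 mul0r subrr; split; [exact: prime1 | exact: id0].
split=> [a b [s [i [c [hs ha]]]] [t [k [d [ht hb]]]]|a b [s [i [c [hs hb]]]]].
  exists (s * t), (i + k)%N, (t * x ^+ k * c + s * x ^+ i * d); split; first exact: primeNM.
  have -> : s * t * x ^+ (i + k) * (a + b) - (t * x ^+ k * c + s * x ^+ i * d) * y ^+ j =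
    (t * x ^+ k) * (s * x ^+ i * a - c * y ^+ j) + (s * x ^+ i) * (t * x ^+ k * b - d * y ^+ j).
    by rewrite exprD; ring.
  by apply: idD => //; apply: idM.
exists s, i, (a * c); split=> //.
have -> : s * x ^+ i * (a * b) - a * c * y ^+ j = a * (s * x ^+ i * b - c * y ^+ j) by ring.
exact: idM.
Qed.

Lemma JJ_sat j s r : ~ P s -> JJ j (s * r) -> JJ j r.
Proof.
move=> hs [t [i [c [ht h]]]]; exists (t * s), i, c; split; first exact: primeNM.
by have -> : t * s * x ^+ i * r = t * x ^+ i * (s * r) by ring.
Qed.

Lemma JJ_x j r : JJ j (x * r) -> JJ j r.
Proof.
move=> [t [i [c [ht h]]]]; exists t, i.+1, c; split=> //.
by have -> : t * x ^+ i.+1 * r = t * x ^+ i * (x * r) by rewrite exprSr; ring.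
Qed.

Lemma JJ_anti j r : JJ j.+1 r -> JJ j r.
Proof.
move=> [t [i [c [ht h]]]]; exists t, i, (c * y); split=> //.
by have -> : c * y * y ^+ j = c * y ^+ j.+1 by rewrite exprS mulrA.
Qed.

Lemma JJ_le i j r : (i <= j)%N -> JJ j r -> JJ i r.
Proof. by move/subnK <-; elim: (j - i)%N => [|d IH] // /JJ_anti. Qed.

Lemma JJ_P0 j r : P0 r -> JJ j r.
Proof.
move=> h; exists 1, 0%N, 0; rewrite mul0r subr0 mulr1; split; first exact: prime1.
exact: idM.
Qed.

Definition stab (L : R -> Prop) := exists j0, forall j, (j0 <= j)%N -> forall r, JJ j r ->
  exists s r' l, [/\ ~ P s, JJ j.+1 r', L l & s * r = r' + l].

(* R/(x) is Artinian at P, so the descending sequence JJ stabilizes modulo any saturated ideal above (x). *)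
Lemma stab_all L : is_ideal L -> (forall s r, ~ P s -> L (s * r) -> L r) ->
  (forall z, P0 z -> L z) -> L x -> stab L.
Proof.
move=> hL hs h0 hLx; apply: nnpp => hns.
pose F L := [/\ is_ideal L, (forall s r, ~ P s -> L (s * r) -> L r),
  (forall z, P0 z -> L z), L x & ~ stab L].
have hFi I : F I -> is_ideal I by case.
have hFe : exists I, F I by exists L.
have [{hFi hFe}L {hL hs h0 hLx hns}[[hL hs h0 hLx hns] hmax]] := noeth_max hN hFi hFe.
have hL1 : ~ L 1.
  move=> h1; apply: hns; exists 0%N => j _ r _; exists 1, 0, r; split.
  - exact: prime1.
  - exact: (id0 (JJ_ideal _)).
  - by rewrite -(mulr1 r); apply: idM.
  - by rewrite mul1r add0r.
have [g [hg hq _ _]] := exists_max_ann hN hL hL1.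
(* (L : g) is a prime containing x and P0, and it lies in P by saturation, so it is P by minimality:
   locally L + (g) over L is the residue field. *)
have hqP : forall z, P z -> ann L g z.
  apply: hmin => //.
  - by move=> z hz; apply: idMr => //; apply: h0.
  - move=> z hz; apply: nnpp => hzP; apply: hg; exact: hs hzP hz.
  - exact: idMr.
pose L1 z := exists l a, L l /\ z = l + a * g.
have hL1i : is_ideal L1.
  split; first by exists 0, 0; rewrite mul0r addr0; split=> //; apply: id0.
  split=> [a b [l [c [hl ->]]] [l' [c' [hl' ->]]]|a b [l [c [hl ->]]]].
    by exists (l + l'), (c + c'); rewrite mulrDl addrACA; split=> //; apply: idD.
  by exists (a * l), (a * c); rewrite mulrDr mulrA; split=> //; apply: idM.
have hL1L z : L z -> sat L1 z.
  by move=> h; apply: sat_le; exists z, 0; rewrite mul0r addr0.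
have [j0 hj0] : stab (sat L1).
  apply: nnpp => hn; apply: hg; apply: (hmax (sat L1)).
  - split=> //; [exact: sat_ideal|exact: sat_sat|by move=> z /h0 /hL1L|exact: hL1L].
  - exact: hL1L.
  by apply: sat_le; exists 0, 1; rewrite mul1r add0r; split=> //; apply: id0.
(* [G j] says that g lies locally in [JJ j] + L. If it holds for all j, the multiple of g left over
   by [sat L1] is absorbed at every step; if it fails at [j1], then from there on the coefficient a
   of g lies in P and a g is already in L. *)
pose G j := exists s r' l, [/\ ~ P s, JJ j r', L l & s * g = r' + l].
apply: hns.
case: (lem (forall j, G j)) => [hall|/not_forall [j1 hj1]].
  exists j0 => j hj r hr; have [s [r' [l [h1 h2 [t [ht [l' [a [hl' e']]]]] e]]]] := hj0 j hj r hr.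
  have [u [r2 [l2 [hu hr2 hl2 e2]]]] := hall j.+1.
  exists (u * (t * s)), (u * t * r' + a * r2), (u * l' + a * l2); split.
  - by do 2![apply: primeNM => //].
  - by apply: (idD (JJ_ideal _)); apply: (idM _ (JJ_ideal _)).
  - by apply: idD => //; apply: idM.
  - have -> : u * (t * s) * r = u * (t * (s * r)) by ring.
    rewrite e mulrDr e'.
    have -> : u * (t * r' + (l' + a * g)) = u * t * r' + u * l' + a * (u * g) by ring.
    by rewrite e2; ring.
exists (maxn j0 j1) => j; rewrite geq_max => /andP [hj hjj] r hr.
have [s [r' [l [h1 h2 [t [ht [l' [a [hl' e']]]]] e]]]] := hj0 j hj r hr.
exists (t * s), (t * r'), (t * l); split; [exact: primeNM|exact: (idM _ (JJ_ideal _))| |].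
  rewrite e'; apply: idD => //.
  case: (lem (P a)) => ha; first exact: hqP.
  case: hj1; exists a, (t * s * r - t * r'), (- l'); split=> //.
  - apply: (idB (JJ_ideal _)); apply: (idM _ (JJ_ideal _)); first exact: JJ_le hr.
    by apply: JJ_le h2; exact: leqW.
  - exact: idN.
  - by rewrite -mulrA e mulrDr e'; ring.
by rewrite -mulrA e mulrDr.
Qed.

(** Stability modulo x puts [JJ j] locally into [JJ j.+1] + x [JJ j], since x times an element lies
    in [JJ j] only if the element does. As x is in P, Nakayama concludes; a determinant outside P
    replaces the localization. *)
Lemma JJ_stable : exists j, forall r, JJ j r -> JJ j.+1 r.
Proof.
pose L0 z := exists a b, P0 a /\ z = a + b * x.
have hL0 : is_ideal L0.
  split; first by exists 0, 0; rewrite mul0r addr0; split=> //; apply: id0.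
  split=> [a b [l [c [hl ->]]] [l' [c' [hl' ->]]]|a b [l [c [hl ->]]]].
    by exists (l + l'), (c + c'); rewrite mulrDl addrACA; split=> //; apply: idD.
  by exists (a * l), (a * c); rewrite mulrDr mulrA; split=> //; apply: idM.
have [] := @stab_all (sat L0).
- exact: sat_ideal.
- exact: sat_sat.
- by move=> z hz; apply: sat_le; exists z, 0; rewrite mul0r addr0.
- by apply: sat_le; exists 0, 1; rewrite add0r mul1r; split=> //; apply: id0.
move=> j /(_ j (leqnn j)) hj; exists j.
have step r : JJ j r -> exists s t, [/\ ~ P s, JJ j t & JJ j.+1 (s * r - t * x)].
  move=> hr; have [s [r' [l [h1 h2 [t [ht [a [b [ha e']]]]] e]]]] := hj r hr.
  have h3 : JJ j.+1 (t * s * r - b * x).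
    have -> : t * s * r - b * x = t * r' + a by rewrite -mulrA e mulrDr e'; ring.
    apply: (idD (JJ_ideal _)); [exact: (idM _ (JJ_ideal _)) | exact: JJ_P0].
  exists (t * s), b; split=> //; first exact: primeNM.
  apply: JJ_x; have -> : x * b = t * s * r - (t * s * r - b * x) by ring.
  apply: (idB (JJ_ideal _)); [exact: (idM _ (JJ_ideal _)) | exact: JJ_anti].
have [n [g hg]] := hN (JJ_ideal j).
have hgi i : JJ j (g i).
  apply/hg; exists (fun k => (k == i)%:R); rewrite (bigD1 i) //= eqxx mul1r big1 ?addr0 // => k /negbTE ->.
  by rewrite mul0r.
have hi i : exists p : R * ('I_n -> R), ~ P p.1 /\ JJ j.+1 (p.1 * g i - x * \sum_k p.2 k * g k).
  have [s [t [hs ht h]]] := step _ (hgi i).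
  have [c ec] := (hg t).1 ht.
  by exists (s, c); split=> //=; rewrite -ec [x * t]mulrC.
have [f hf] := choose_fun (0, fun _ => 0) (fun i (_ : True) => hi i).
pose A : 'M[R]_n := \matrix_(i, k) ((f i).1 *+ (i == k) - x * (f i).2 k).
have hdet : ~ P (\det A).
  have h1 : P (\det A - \det (\matrix_(i, k) ((f i).1 *+ (i == k)))).
    apply: det_mod => // i k; rewrite !mxE addrAC subrr add0r.
    by apply: idN => //; apply: idMr.
  have -> : \det A = (\det A - \det (\matrix_(i, k) ((f i).1 *+ (i == k)))) + \prod_i (f i).1.
    have -> : (\matrix_(i, k) ((f i).1 *+ (i == k))) = diag_mx (\row_i (f i).1).
      by apply/matrixP => a b; rewrite !mxE; case: eqP => [->|].
    rewrite det_diag; have -> : \prod_i (\row_i0 (f i0).1) 0 i = \prod_i (f i).1 by apply: eq_bigr => i _; rewrite mxE.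
    by rewrite subrK.
  move=> h2; have : P (\prod_i (f i).1).
    by rewrite -[X in P X](addKr (\det A - \det (\matrix_(i, k) ((f i).1 *+ (i == k))))) addrC; apply: idB.
  by apply: prime_prod => // i _; have [] := hf i I.
have hA i : JJ j.+1 (\sum_k A i k * g k).
  have [_] := hf i I; congr JJ.
  under [RHS]eq_bigr do rewrite mxE mulrBl.
  rewrite sumrB; congr (_ - _).
    rewrite (bigD1 i) //= eqxx mulr1n big1 ?addr0 // => k /negbTE hk.
    by rewrite eq_sym hk mulr0n mul0r.
  by rewrite mulr_sumr; apply: eq_bigr => k _; rewrite mulrA.
have hgj i : JJ j.+1 (g i).
  apply: (JJ_sat hdet).
  exact: (@det_trick R R^o (JJ j.+1) n A g (id0 (JJ_ideal _))
    (fun u v => idD (JJ_ideal _)) (fun a v => idM a (JJ_ideal _)) hA i).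
move=> r /hg [c ->]; apply: id_sum; [exact: (JJ_ideal _)|move=> i _].
exact: (idM _ (JJ_ideal _)).
Qed.
End PIT.

(** If there were no such Q, P would be minimal over P0 + (x) and [JJ] would become stationary for a
    y in P1 outside P0. Then y^j (s x^i - c y) lies in P0 for some j, so x lies in P1, against the
    minimality of P. *)
Lemma krull_pit (R : comNzRingType) (P P0 P1 : R -> Prop) (x : R) :
  noetherian R -> is_prime P -> is_prime P0 -> is_prime P1 -> P x ->
  (forall z, P0 z -> P1 z) -> (forall z, P1 z -> P z) -> (exists y, P1 y /\ ~ P0 y) ->
  (exists y, P y /\ ~ P1 y) ->
  exists Q, [/\ is_prime Q, (forall z, P0 z -> Q z), (forall z, Q z -> P z), Q x & exists y, P y /\ ~ Q y].
Proof.
move=> hN hP hP0 hP1 hx h01 h1 [y [hy hy0]] [z [hz hz1]]; apply: nnpp => hno.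
have hmin Q : is_prime Q -> (forall z, P0 z -> Q z) -> (forall z, Q z -> P z) -> Q x ->
    forall z, P z -> Q z.
  move=> hQ h0Q hQP hQx t ht; apply: nnpp => htQ; apply: hno; exists Q; split=> //.
  by exists t.
have [j hj] := JJ_stable hN hP hP0 hx hmin y.
have [|s [i [c [hs h]]]] := hj (y ^+ j).
  exists 1, 0%N, 1; split; first exact: prime1.
  by rewrite expr0 !mul1r subrr; exact: (id0 (prime_ideal hP0)).
have : P0 (y ^+ j * (s * x ^+ i - c * y)) by move: h; congr P0; rewrite exprS; ring.
case/(primeM hP0) => [/(primeX hP0) //|/h01 h2].
have : P1 (s * x ^+ i).
  rewrite -(subrK (c * y) (s * _)); apply: (idD (prime_ideal hP1)) => //.
  exact: (idM _ (prime_ideal hP1)).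
case/(primeM hP1) => [/h1 //|/(primeX hP1) hx1].
by apply: hz1; apply: hmin.
Qed.

Definition chain (R : comNzRingType) (k : nat) (P : nat -> R -> Prop) :=
  (forall i, (i <= k)%N -> is_prime (P i)) /\
  (forall i, (i < k)%N -> (forall x, P i x -> P i.+1 x) /\ exists x, P i.+1 x /\ ~ P i x).

Lemma chain_le (R : comNzRingType) k (P : nat -> R -> Prop) i j x : chain k P -> (i <= j)%N -> (j <= k)%N ->
  P i x -> P j x.
Proof.
move=> [_ h] /subnK <-; elim: (j - i)%N => [|d IH] // hk hx; rewrite addSn in hk *.
by have [h1 _] := h _ hk; apply: h1; apply: IH => //; apply: ltnW.
Qed.

Lemma chain_rcons (R : comNzRingType) k (P : nat -> R -> Prop) Q : chain k P -> is_prime Q ->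
  (forall x, P k x -> Q x) -> (exists x, Q x /\ ~ P k x) ->
  chain k.+1 (fun i => if (i <= k)%N then P i else Q).
Proof.
move=> [h1 h2] hQ hle hne; split=> i.
  by case: ifP => // hi _; apply: h1.
move=> hik; have : (i == k) || (i < k)%N by rewrite -leq_eqVlt -ltnS.
case/orP => [/eqP ->|hi]; first by rewrite /= leqnn ltnn.
by rewrite /= ltnW // hi; apply: h2.
Qed.

Lemma chain_exchange (R : comNzRingType) k (P : nat -> R -> Prop) g : noetherian R ->
  chain k.+1 P -> P k.+1 g ->
  exists P', [/\ chain k.+1 P', (forall x, P 0%N x -> P' 0%N x), P' 1%N g & forall x, P' k.+1 x <-> P k.+1 x].
Proof.
move=> hN; elim: k P => [|k IH] P hP hg; first by exists P.
have [h1 h2] := hP.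
have hsub : chain k.+1 P.
  by split=> i hi; [apply: h1 | apply: h2]; rewrite // ltnW // ltnS.
have fin (P1 : nat -> R -> Prop) : chain k.+1 P1 -> (forall x, P 0%N x -> P1 0%N x) -> P1 k.+1 g ->
   (forall x, P1 k.+1 x -> P k.+2 x) -> (exists x, P k.+2 x /\ ~ P1 k.+1 x) ->
   exists P', [/\ chain k.+2 P', (forall x, P 0%N x -> P' 0%N x), P' 1%N g & forall x, P' k.+2 x <-> P k.+2 x].
  move=> hc hc0 hcg hle [t [ht htn]]; have [P' [hP' h0 h1' htop]] := IH P1 hc hcg.
  exists (fun i => if (i <= k.+1)%N then P' i else P k.+2); split.
  - apply: chain_rcons => //; first exact: h1.
      by move=> z /htop; apply: hle.
    by exists t; split=> // /htop.
  - by move=> z /hc0 /h0.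
  - by [].
  - by rewrite ltnn.
case: (lem (P k.+1 g)) => hgk.
  by apply: (fin P) => //; have [] := h2 k.+1 (ltnSn _).
have [le1 ne1] := h2 k.+1 (ltnSn _); have [le0 ne0] := h2 k (ltnW (ltnSn _)).
have [|||Q [hQ hle hleP hQg hne]] := krull_pit hN (h1 k.+2 _) (h1 k _) (h1 k.+1 _) hg le0 le1 ne0 ne1; try by rewrite ?leqnn ?leqnSn // ltnW.
have hck : chain k P.
  by split=> i hi; [apply: h1 | apply: h2]; rewrite ?ltnS ltnW // ltnW // ltnS.
apply: (fin (fun i => if (i <= k)%N then P i else Q)); rewrite ?ltnn //.
apply: chain_rcons => //; exists g; split=> // /le0; exact: hgk.
Qed.

(** After an exchange the second member contains [g ord0]; dropping the bottom prime and adding this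
    element to J takes the place of passing to a quotient ring. *)
Lemma krull_height (R : comNzRingType) n (g : 'I_n -> R) (J : R -> Prop) k P : noetherian R ->
  chain k P -> (forall x, J x -> P 0%N x) -> (forall i, P k (g i)) ->
  (forall Q, is_prime Q -> (forall x, J x -> Q x) -> (forall i, Q (g i)) -> (forall x, Q x -> P k x) ->
     forall x, P k x -> Q x) -> (k <= n)%N.
Proof.
move=> hN; elim: n g J k P => [|n IH] g J k P hP hJ hg hmin.
  case: k hP hg hmin => // k hP hg hmin.
  have [h1 h2] := hP; have [_ [x [hx hx0]]] := h2 k (ltnSn _).
  case: hx0; apply: (@chain_le _ _ _ 0%N _ _ hP) => //.
  apply: (hmin (P 0%N)) => //; [exact: h1 | by case | by move=> z; apply: (chain_le hP)].
case: k hP hg hmin => // k hP hg hmin; rewrite ltnS.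
have [P' [hP' h0 h1 htop]] := chain_exchange hN hP (hg ord0).
have [hp1 hp2] := hP'.
apply: (IH (fun i => g (lift ord0 i)) (fun x => J x \/ x = g ord0) k (fun i => P' i.+1)).
- by split=> i hi; [apply: hp1 | apply: hp2].
- move=> x [/hJ /h0|-> //]; exact: (chain_le hP').
- by move=> i; apply/htop.
- move=> Q hQ hJQ hgQ hle x /htop; apply: hmin => //.
  + by move=> z hz; apply: hJQ; left.
  + move=> i; case: (unliftP ord0 i) => [j ->|->] //; by apply: hJQ; right.
  + by move=> z /hle /htop.
Qed.

(** Heights and dimensions are defined by [sup_nat], which is meaningful only for bounded sets.
    Every prime lies in m, whose finitely many generators bound the length of chains. *)
Lemma chain_bound (R : comNzRingType) (m : R -> Prop) : noetherian R -> local_ring m ->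
  exists n, forall k (P : nat -> R -> Prop), chain k P -> (k <= n)%N.
Proof.
move=> hN [hm [hm1 hmu]].
have mmax Q x : is_prime Q -> Q x -> m x.
  move=> hQ hx; apply: nnpp => hxm; have [y hy] := hmu x hxm.
  by apply: (prime1 hQ); rewrite -hy; apply: (idMr _ (prime_ideal hQ)).
have hmp : is_prime m.
  apply: mk_prime => // a b hab; case: (lem (m a)); [by left | move=> /hmu [y hy]; right].
  by rewrite -(mul1r b) -hy mulrAC mulrC; apply: idM.
have [n [g hg]] := hN _ hm; exists n => k P hP.
have hgi i : m (g i).
  apply/hg; exists (fun k => (k == i)%:R); rewrite (bigD1 i) //= eqxx mul1r big1 ?addr0 // => j /negbTE ->.
  by rewrite mul0r.
have mgen Q : is_prime Q -> (forall i, Q (g i)) -> forall x, m x -> Q x.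
  move=> hQ hgQ x /hg [c ->]; apply: id_sum; [exact: (prime_ideal hQ)|move=> i _].
  exact: (idM _ (prime_ideal hQ)).
have [h1 _] := hP.
case: (lem (exists x, m x /\ ~ P k x)) => [hne|hno].
  apply: leq_trans (leqnSn _) _.
  apply: (krull_height (g := g) (J := fun _ => False) hN (chain_rcons hP hmp _ hne)) => //.
  - by move=> x; apply: mmax; apply: h1.
  - by move=> i; rewrite ltnn.
  - by move=> Q hQ _ hgQ _ x; rewrite ltnn; apply: mgen.
apply: (krull_height (g := g) (J := fun _ => False) hN hP) => //.
  by move=> i; apply: nnpp => hgn; apply: hno; exists (g i).
by move=> Q hQ _ hgQ _ x hx; apply: mgen => //; apply: mmax hx; apply: h1.
Qed.

Lemma nat_max (Q : nat -> Prop) b : (exists n, Q n) -> (forall k, Q k -> (k <= b)%N) ->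
  exists n, Q n /\ forall k, Q k -> (k <= n)%N.
Proof.
elim: b => [|b IH] hex hb.
  have [n hn] := hex; exists n; split=> // k /hb; rewrite leqn0 => /eqP ->; exact: leq0n.
case: (lem (Q b.+1)) => hQ; first by exists b.+1.
apply: IH => // k hk; rewrite -ltnS ltn_neqAle (hb _ hk) andbT.
by apply/eqP => e; apply: hQ; rewrite -e.
Qed.

Lemma nat_min (Q : nat -> Prop) : (exists n, Q n) -> exists n, Q n /\ forall k, Q k -> (n <= k)%N.
Proof.
case=> n; elim/ltn_ind: n => n IH hn.
case: (lem (exists k, Q k /\ (k < n)%N)) => [[k [hk hkn]]|hno]; first exact: IH hkn hk.
exists n; split=> // k hk; rewrite leqNgt; apply/negP => h; apply: hno; by exists k.
Qed.

Lemma sup_natP (Q : nat -> Prop) b : (exists n, Q n) -> (forall k, Q k -> (k <= b)%N) ->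
  Q (sup_nat Q) /\ forall k, Q k -> (k <= sup_nat Q)%N.
Proof.
move=> h1 h2; exact: (epsilon_spec (inhabits 0%N) (fun n => Q n /\ forall k, Q k -> (k <= n)%N) (nat_max h1 h2)).
Qed.

Lemma min_natP (Q : nat -> Prop) : (exists n, Q n) ->
  Q (min_nat Q) /\ forall k, Q k -> (min_nat Q <= k)%N.
Proof.
move=> h1; exact: (epsilon_spec (inhabits 0%N) (fun n => Q n /\ forall k, Q k -> (n <= k)%N) (nat_min h1)).
Qed.

(** * Regular sequences, associated primes and Cohen-Macaulay local rings *)

Section Regular.
Variable R : comNzRingType.
Implicit Types (I J K Q : R -> Prop) (s : seq R).

Lemma avoidance n (q : 'I_n -> R -> Prop) I : is_ideal I -> (forall i, is_prime (q i)) ->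
  (forall i, exists x, I x /\ ~ q i x) -> exists x, I x /\ forall i, ~ q i x.
Proof.
move=> hI; elim: n q => [|n IH] q hq h; first by exists 0; split; [exact: id0 | case].
have hj (j : 'I_n.+1) : exists x, I x /\ forall i, ~ q (lift j i) x by apply: IH.
have [f hf] := @choose_fun 'I_n.+1 R 0 (fun _ => True) _ (fun j _ => hj j).
have hfn j i : i != j -> ~ q i (f j).
  by rewrite eq_sym => /unlift_some [k -> _]; have [_ h2] := hf j Logic.I; apply: h2.
case: (lem (exists j, ~ q j (f j))) => [[j hqj]|hall].
  exists (f j); split; first by have [] := hf j Logic.I.
  by move=> i; case: (eqVneq i j) => [->|] //; apply: hfn.
case: n IH q hq h hj f hf hfn hall => [|n] IH q hq h hj f hf hfn hall.
  by have [x [hx hx2]] := h ord0; exists x; split=> // i; rewrite ord1.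
have hin j : q j (f j) by apply: nnpp => hh; apply: hall; exists j.
pose z := \prod_(j | j != ord0) f j.
have hz0 : ~ q ord0 z by apply: prime_prod => // j hj0; apply: hfn; rewrite eq_sym.
exists (f ord0 + z); split.
  apply: idD => //; first by have [] := hf ord0 Logic.I.
  rewrite /z (bigD1 (lift ord0 ord0)) //=; apply: idMr => //.
  by have [] := hf (lift ord0 ord0) Logic.I.
move=> i; case: (eqVneq i ord0) => [->|hi] hc.
  apply: hz0; rewrite -(addKr (f ord0) z) addrC; apply: (idB (prime_ideal (hq _))) => //; exact: hin.
have hzi : q i z by rewrite /z (bigD1 i) //=; apply: (idMr _ (prime_ideal (hq i))).
apply: (hfn ord0 i hi); rewrite -(addrK z (f ord0)); exact: (idB (prime_ideal (hq _))).
Qed.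

Definition zeroI : R -> Prop := fun x => x = 0.
Lemma zeroI_ideal : is_ideal zeroI.
Proof. by split=> //; split=> [x y -> ->|a x ->]; rewrite /zeroI ?addr0 ?mulr0. Qed.

(** K + (a): quotient rings are not formed, but represented by their ideals in R. *)
Definition Kf K (a : R) : R -> Prop := fun x => exists u, K (x - u * a).
Definition Ks K s := foldl Kf K s.

Lemma Kf_ideal K a : is_ideal K -> is_ideal (Kf K a).
Proof.
move=> hK; split; first by exists 0; rewrite mul0r subr0; apply: id0.
split=> [x y [u hu] [v hv]|b x [u hu]].
  by exists (u + v); rewrite mulrDl opprD addrACA; apply: idD.
by exists (b * u); rewrite -mulrA -mulrBr; apply: idM.
Qed.
Lemma Ks_ideal K s : is_ideal K -> is_ideal (Ks K s).
Proof. by elim: s K => [|a s IH] K hK //=; apply/IH/Kf_ideal. Qed.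
Lemma Kf_le K a x : K x -> Kf K a x.
Proof. by exists 0; rewrite mul0r subr0. Qed.
Lemma Kf_mem K a : is_ideal K -> Kf K a a.
Proof. by move=> hK; exists 1; rewrite mul1r subrr; apply: id0. Qed.

Definition nzdI K (a : R) := forall v, K (a * v) -> K v.
(** Weakly regular sequences relative to K: the final ideal may be the unit ideal, as happens with
    minors of size zero. *)
Fixpoint reg K s := if s is a :: s' then nzdI K a /\ reg (Kf K a) s' else True.

Lemma reg_rcons K s a : reg K (rcons s a) <-> reg K s /\ nzdI (Ks K s) a.
Proof. by elim: s K => [|b s IH] K /=; rewrite ?IH; tauto. Qed.
Lemma Ks_rcons K s a : Ks K (rcons s a) = Kf (Ks K s) a.
Proof. by rewrite /Ks -cats1 foldl_cat. Qed.

Lemma Ks_span s x : Ks zeroI s x <-> exists c : nat -> R, x = \sum_(j < size s) c j * s`_j.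
Proof.
elim/last_ind: s x => [|s a IH] x.
  by rewrite /Ks /=; split=> [->|[c ->]]; [exists (fun _ => 0); rewrite big_ord0 | rewrite big_ord0].
rewrite Ks_rcons size_rcons; split=> [[u /IH [c hc]]|[c ->]].
  exists (fun j => if (j < size s)%N then c j else u).
  rewrite big_ord_recr /= ltnn nth_rcons ltnn eqxx -[x](subrK (u * a)) hc; congr (_ + _).
  by apply: eq_bigr => i _; rewrite nth_rcons !ltn_ord.
exists (c (size s)); apply/IH; exists c.
rewrite big_ord_recr /= nth_rcons ltnn eqxx addrK.
by apply: eq_bigr => i _; rewrite nth_rcons ltn_ord.
Qed.

Lemma Ks_mem s a : a \in s -> Ks zeroI s a.
Proof.
move=> ha; apply/Ks_span; exists (fun j => (j == index a s)%:R).
have h : (index a s < size s)%N by rewrite index_mem.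
rewrite (bigD1 (Ordinal h)) //= eqxx mul1r nth_index // big1 ?addr0 // => i hi.
case: eqP => [e|]; last by rewrite mul0r.
by case/eqP: hi; apply: val_inj.
Qed.

Lemma Ks_le s Q : is_ideal Q -> (forall a, a \in s -> Q a) -> forall x, Ks zeroI s x -> Q x.
Proof.
move=> hQ h x /Ks_span [c ->]; apply: id_sum => // i _.
by apply: idM => //; apply/h/mem_nth.
Qed.

Definition iL K : 'rV[R]_1 -> Prop := fun v => K (v 0 0).
Lemma iL_sub K : is_ideal K -> is_submodule (iL K).
Proof.
move=> hK; rewrite /iL; split; [|split].
- by rewrite mxE; apply: id0.
- by move=> u v hu hv; rewrite mxE; apply: idD.
- by move=> a v hv; rewrite mxE; apply: idM.
Qed.
Lemma iL_nzd K a : nzdI K a -> nzd (iL K) a.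
Proof. by move=> h v; rewrite /iL mxE; apply: h. Qed.
Lemma iL_addf K a : addf a (iL K) = iL (Kf K a).
Proof.
apply: predext => v; rewrite /addf /im_add /iL /Kf; split=> [[u]|[u hu]].
  by rewrite mul_mx_scalar !mxE [a * _]mulrC => h; exists (u 0 0).
by exists (const_mx u); rewrite mul_mx_scalar !mxE [a * _]mulrC.
Qed.

Lemma D_of_reg K s w : is_ideal K -> {subset s <= w} -> reg K s -> D (size s) (iL K) w.
Proof.
elim: s K => [|a s IH] K hK hs // [h1 h2].
apply: (@D_reg _ _ _ a); [exact: iL_sub|by apply: hs; rewrite mem_head|exact: iL_nzd|].
by rewrite iL_addf; apply: IH => //; [exact: Kf_ideal | move=> b hb; apply: hs; rewrite inE hb orbT].
Qed.

Lemma D_mod_reg k K s w : is_ideal K -> reg K s -> D (k + size s) (iL K) w -> D k (iL (Ks K s)) w.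
Proof.
elim: s K => [|a s IH] K hK /=; first by rewrite addn0.
move=> [h1 h2]; rewrite addnS => h3; apply: IH => //; first exact: Kf_ideal.
by rewrite -iL_addf; apply: D_quot => //; [exact: iL_sub | exact: iL_nzd].
Qed.

Lemma D1_iL k K w v : D k.+1 (iL K) w -> (forall a, a \in w -> K (a * v)) -> K v.
Proof.
move=> [h _] hv; have := h (const_mx v); rewrite /iL mxE; apply=> a ha.
by rewrite !mxE; apply: hv.
Qed.
End Regular.

Section Noeth.
Variables (R : comNzRingType) (hN : noetherian R).
Implicit Types (I J K Q : R -> Prop) (s : seq R).

(** Among the elements with maximal colon ideal, choose finitely many that generate an ideal as
    large as possible. Any further such g is a combination of them; its colon ideal, being prime,
    contains one of theirs, and maximality makes the two equal. *)
Lemma finite_max_ann K : is_ideal K -> exists s : seq R,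
  (forall g, g \in s -> ~ K g /\ is_prime (ann K g)) /\
  forall v, ~ K v -> exists2 g, g \in s & forall x, ann K v x -> ann K g x.
Proof.
move=> hK.
pose mx g := [/\ ~ K g, is_prime (ann K g) &
   forall h, ~ K h -> (forall x, ann K g x -> ann K h x) -> forall x, ann K h x -> ann K g x].
pose F I := exists s, (forall g, g \in s -> mx g) /\ I = Ks (@zeroI R) s.
have hF1 I : F I -> is_ideal I by move=> [s [_ ->]]; apply/Ks_ideal/zeroI_ideal.
have hF2 : exists I, F I by exists (Ks (@zeroI R) [::]), [::].
have [_ [[s [hs ->]] hmax]] := noeth_max hN hF1 hF2.
exists s; split=> [g /hs [h1 h2 _] //|v hv].
have [g [hg hgp hvg hgm]] := exists_max_ann hN hK hv.
have : Ks (@zeroI R) s g.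
  apply: (hmax (Ks (@zeroI R) (rcons s g))).
  - exists (rcons s g); split=> // h; rewrite mem_rcons inE => /orP [/eqP -> //|]; exact: hs.
  - by move=> x hx; rewrite Ks_rcons; apply: Kf_le.
  - by rewrite Ks_rcons; apply/Kf_mem/Ks_ideal/zeroI_ideal.
case/Ks_span => c ec.
have [i hi] : exists i : 'I_(size s), forall x, ann K s`_i x -> ann K g x.
  apply: nnpp => hno.
  have h (i : 'I_(size s)) : exists t, ann K s`_i t /\ ~ ann K g t.
    have hn : ~ (forall x, ann K s`_i x -> ann K g x) by move=> h; apply: hno; exists i.
    by have [t ht] := not_forall hn; have [h1 h2] := not_imply ht; exists t.
  have [t ht] := choose_fun 0 (fun i (_ : True) => h i).
  have : ~ ann K g (\prod_i t i) by apply: prime_prod => // i _; have [] := ht i I.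
  apply; rewrite /ann ec mulr_sumr; apply: id_sum => // i _.
  rewrite (bigD1 i) //=.
  have -> : t i * \prod_(j | j != i) t j * (c i * s`_i) = (c i * \prod_(j | j != i) t j) * (t i * s`_i) by ring.
  by apply: idM => //; have [] := ht i I.
have hin : s`_i \in s by apply: mem_nth.
exists s`_i => // x hx; have [h1 h2 h3] := hs _ hin.
by apply: (h3 g hg hi); apply: hvg.
Qed.

(** Prime avoidance for the finitely many maximal colon ideals, whose union is the set of zero
    divisors modulo K. *)
Lemma exists_nzd K I : is_ideal K -> is_ideal I ->
  (forall g, ~ K g -> is_prime (ann K g) -> exists x, I x /\ ~ ann K g x) ->
  exists x, I x /\ nzdI K x.
Proof.
move=> hK hI h; have [s [h1 h2]] := finite_max_ann hK.
have hin (i : 'I_(size s)) : s`_i \in s by apply: mem_nth.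
have [||x [hx hx2]] := @avoidance _ (size s) (fun i => ann K s`_i) I hI.
- by move=> i; have [] := h1 _ (hin i).
- by move=> i; have [h3 h4] := h1 _ (hin i); apply: h.
exists x; split=> // v hv; apply: nnpp => hn.
have [g hg hle] := h2 _ hn.
have hi : (index g s < size s)%N by rewrite index_mem.
by apply: (hx2 (Ordinal hi)); rewrite /= nth_index //; apply: hle.
Qed.

Lemma exists_fin_gens I : is_ideal I -> exists s : seq R, forall x, I x <-> Ks (@zeroI R) s x.
Proof.
move=> hI; have [n [g hg]] := hN hI; exists (codom g) => x; rewrite hg Ks_span size_codom card_ord.
have e (i : 'I_n) : (codom g)`_i = g i.
  by rewrite (nth_map i) ?size_enum_ord // nth_ord_enum.
split=> [[c ->]|[c ->]].
  exists (fun j => oapp c 0 (insub j)); apply: eq_bigr => i _.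
  by rewrite e insubT //= => h; congr (c _ * _); apply: val_inj.
by exists (fun i => c i); apply: eq_bigr => i _; rewrite e.
Qed.

Variables (m : R -> Prop) (hm : local_ring m).

Lemma local_ideal : is_ideal m. Proof. by case: hm. Qed.
Lemma local_unit x : ~ m x -> exists y, x * y = 1. Proof. by case: hm => _ [_]; apply. Qed.
Lemma local1 : ~ m 1. Proof. by case: hm => _ []. Qed.
Lemma local_prime : is_prime m.
Proof.
have hmi := local_ideal; apply: mk_prime => //; first exact: local1.
move=> a b hab; case: (lem (m a)); [by left | move=> /local_unit [y hy]; right].
by rewrite -(mul1r b) -hy mulrAC mulrC; apply: idM.
Qed.
Lemma chain_cons k (P : nat -> R -> Prop) Q : chain k P -> is_prime Q -> (forall x, Q x -> P 0%N x) ->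
  (exists x, P 0%N x /\ ~ Q x) -> chain k.+1 (fun i => if i is i'.+1 then P i' else Q).
Proof.
move=> [h1 h2] hQ hle hne; split; first by case=> // i hi; apply: h1.
by case=> // i hi; apply: h2.
Qed.

(** N consists of the classes modulo K killed by the prime. Were it contained in K + (b), regularity
    of b would give N = b N modulo K, and Nakayama would put g into K. An element of N outside K +
    (b) leads to the required associated prime. *)
Lemma ass_nonmax_extends K g b : is_ideal K -> is_prime (ann K g) -> ~ K g -> m b -> nzdI K b ->
  exists h, [/\ ~ Kf K b h, is_prime (ann (Kf K b) h), (forall x, ann K g x -> ann (Kf K b) h x) & ann (Kf K b) h b].
Proof.
move=> hK hp hg hb hn.
pose N l := forall x, ann K g x -> K (x * l).
have hNi : is_ideal N.
  split; first by move=> x _; rewrite mulr0; apply: id0.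
  split=> [x y hx hy z hz|a x hx z hz]; first by rewrite mulrDr; apply: idD; [|apply: hx|apply: hy].
  by rewrite mulrCA; apply: idM => //; apply: hx.
have [l [hl hlK]] : exists l, N l /\ ~ Kf K b l.
  apply: nnpp => hno.
  have hsub l : N l -> exists u, N u /\ K (l - u * b).
    move=> hl; have [u hu] : Kf K b l by apply: nnpp => hh; apply: hno; exists l.
    exists u; split=> // x hx; apply: hn.
    have -> : b * (x * u) = x * l - x * (l - u * b) by ring.
    by apply: idB => //; [apply: hl | apply: idM].
  have [n [f hf]] := hN hNi.
  have hfi i : N (f i).
    apply/hf; exists (fun k => (k == i)%:R); rewrite (bigD1 i) //= eqxx mul1r big1 ?addr0 // => j /negbTE ->.
    by rewrite mul0r.
  have hc i : exists c : 'I_n -> R, K (f i - b * \sum_k c k * f k).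
    have [u [hu hu2]] := hsub _ (hfi i); have [c ec] := (hf u).1 hu.
    by exists c; rewrite -ec mulrC.
  have [c hcc] := choose_fun (fun _ => 0) (fun i (_ : True) => hc i).
  pose A : 'M[R]_n := \matrix_(i, k) ((i == k)%:R - b * c i k).
  have hA i : K (\sum_k A i k * f k).
    have := hcc i I; congr K; under [RHS]eq_bigr do rewrite mxE mulrBl.
    rewrite sumrB; congr (_ - _).
      rewrite (bigD1 i) //= eqxx mul1r big1 ?addr0 // => k /negbTE hk.
      by rewrite eq_sym hk mul0r.
    by rewrite mulr_sumr; apply: eq_bigr => k _; rewrite mulrA.
  have hdet : ~ m (\det A).
    move=> h; apply: local1.
    have h2 : m (\det A - \det (1%:M : 'M[R]_n)).
      apply: det_mod; first exact: local_ideal.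
      move=> i k; rewrite !mxE addrAC subrr add0r.
      by apply: (idN local_ideal); apply: (idMr _ local_ideal).
    rewrite -(det1 R n) -(subKr (\det A) (\det 1%:M)); exact: (idB local_ideal).
  have [y hy] := local_unit hdet.
  have hfK i : K (f i).
    rewrite -(mul1r (f i)) -hy mulrAC mulrC; apply: idM => //.
    exact: (@det_trick R R^o K n A f (id0 hK) (fun u v => idD hK) (fun a v => idM a hK) hA i).
  apply: hg; have /hf [d ->] : N g by [].
  by apply: id_sum => // i _; apply: idM.
have [h [h1 h2 h3 _]] := exists_max_ann hN (Kf_ideal b hK) hlK.
exists h; split=> //.
  by move=> x hx; apply: h3; apply: Kf_le; apply: hl.
by apply: h3; exists l; rewrite mulrC subrr; apply: id0.
Qed.

(** The inequality depth <= dim R / p for an associated prime p: each step divides by a regular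
    element b of m and moves to an associated prime over p which contains b, while p does not. *)
Lemma chain_above j K g w : is_ideal K -> is_prime (ann K g) -> ~ K g -> (forall a, a \in w -> m a) ->
  D j (iL K) w -> exists P, chain j P /\ forall x, P 0%N x <-> ann K g x.
Proof.
move=> + + + hw; elim: j K g => [|j IH] K g hK hp hg hD.
  by exists (fun _ => ann K g); split=> //; split=> // i; rewrite leqn0 => /eqP ->.
have [b [hb hbn]] : exists b, m b /\ nzdI K b.
  apply: exists_nzd => //; first exact: local_ideal.
  move=> v hv hvp; apply: nnpp => hno; apply: hv; apply: (D1_iL hD) => a ha.
  by apply: nnpp => hh; apply: hno; exists a; split=> //; apply: hw.
have [h [h1 h2 h3 h4]] := ass_nonmax_extends hK hp hg hb hbn.
have [|P [hP hP0]] := IH (Kf K b) h (Kf_ideal b hK) h2 h1.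
  by rewrite -iL_addf; apply: D_quot => //; [exact: iL_sub | exact: iL_nzd].
exists (fun i => if i is i'.+1 then P i' else ann K g); split=> //.
apply: chain_cons => //; first by move=> x /h3 /hP0.
exists b; split; first exact/hP0.
by move=> /hbn.
Qed.

Lemma chain_cat i j (P P' : nat -> R -> Prop) : chain i P -> chain j P' -> (forall x, P i x <-> P' 0%N x) ->
  chain (i + j) (fun k => if (k <= i)%N then P k else P' (k - i)%N).
Proof.
move=> [h1 h2] [h1' h2'] e; split=> k hk /=.
  by case: (leqP k i) => h; [exact: h1 | apply: h1'; rewrite leq_subLR].
case: (ltngtP k i) => hki.
- exact: h2.
- rewrite subSn; last exact: ltnW.
  by apply: h2'; rewrite ltn_subLR // ltnW.
- rewrite hki subSnn; rewrite hki -addn1 leq_add2l in hk.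
  have [a1 [x [a2 a3]]] := h2' 0%N hk; split=> [x0 /e /a1 //|]; by exists x; split=> // /e.
Qed.

Lemma prime_chainE k P : prime_chain (@allR R) (@noneR R) k P <-> chain k P.
Proof. by split=> [[h1 h2]|[h1 h2]]; split=> // i hi; [have [] := h1 i hi|split=> //; exact: h1]. Qed.

Lemma krull_dimP : (exists P : nat -> R -> Prop, chain (krull_dim R) P) /\ forall k (P : nat -> R -> Prop), chain k P -> (k <= krull_dim R)%N.
Proof.
have [b hb] := chain_bound hN hm.
have [||[P hP] h2] := @sup_natP (fun n => exists P, prime_chain (@allR R) (@noneR R) n P) b.
- exists 0%N, (fun _ => m); apply/prime_chainE; split=> // i _; exact: local_prime.
- by move=> k [P /prime_chainE hP]; apply: hb hP.
split; first by exists P; apply/prime_chainE.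
by move=> k Q hQ; apply: h2; exists Q; apply/prime_chainE.
Qed.

Lemma height_primeP Q : is_prime Q ->
  (exists P, chain (height_prime Q) P /\ forall x, P (height_prime Q) x <-> Q x) /\
  forall k P, chain k P -> (forall x, P k x <-> Q x) -> (k <= height_prime Q)%N.
Proof.
move=> hQ; have [b hb] := chain_bound hN hm.
have [||[P [hP hPQ]] h2] := @sup_natP (fun n => exists P, prime_chain (@allR R) (@noneR R) n P /\ forall x, P n x <-> Q x) b.
- by exists 0%N, (fun _ => Q); split=> //; apply/prime_chainE; split.
- by move=> k [P [/prime_chainE hP _]]; apply: hb hP.
split; first by exists P; split=> //; apply/prime_chainE.
by move=> k P' hP' e; apply: h2; exists P'; split=> //; apply/prime_chainE.
Qed.

Lemma heightP I : (exists Q, is_prime Q /\ forall x, I x -> Q x) ->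
  (exists Q, [/\ is_prime Q, (forall x, I x -> Q x) & height_prime Q = height I]) /\
  forall Q, is_prime Q -> (forall x, I x -> Q x) -> (height I <= height_prime Q)%N.
Proof.
move=> [Q [hQ hIQ]].
have [|[Q' [h1 [h2 h3]]] h4] := @min_natP (fun n => exists Q, is_prime Q /\ (forall x, I x -> Q x) /\ height_prime Q = n).
  by exists (height_prime Q), Q.
split; first by exists Q'.
by move=> Q2 hQ2 hIQ2; apply: h4; exists Q2.
Qed.

Lemma height_prime_lt Q Q' : is_prime Q -> is_prime Q' -> (forall x, Q x -> Q' x) -> (exists x, Q' x /\ ~ Q x) ->
  (height_prime Q < height_prime Q')%N.
Proof.
move=> hQ hQ' hle [x [hx hxn]]; have [[P [hP hPQ]] _] := height_primeP hQ.
have [_ h2] := height_primeP hQ'.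
apply: h2; first apply: (@chain_rcons _ _ P Q' hP hQ').
- by move=> y /hPQ; apply: hle.
- by exists x; split=> // /hPQ.
by move=> y /=; rewrite ltnn.
Qed.

Lemma minimal_of_height I Q : is_prime Q -> (forall x, I x -> Q x) -> (height_prime Q <= height I)%N ->
  minimal_prime I Q.
Proof.
move=> hQ hIQ hle; split=> //; split=> // Q' hQ' hIQ' hQ'Q x hx; apply: nnpp => hxn.
have h1 : (height_prime Q' < height_prime Q)%N by apply: height_prime_lt => //; exists x.
have [_ h2] := heightP (ex_intro _ Q (conj hQ hIQ)).
have := h2 Q' hQ' hIQ'; rewrite leqNgt => /negP; apply; exact: leq_trans h1 hle.
Qed.

Hypothesis hCM : grade_ge m (krull_dim R).

Lemma CM_D : exists2 w : seq R, (forall a, a \in w -> m a) & D (krull_dim R) (iL (@zeroI R)) w.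
Proof.
case: hCM => [/local1 //|[x [hx [hreg _]]]].
set d := krull_dim R in x hx hreg *.
have e (i : 'I_d) : (codom x)`_i = x i by rewrite (nth_map i) ?size_enum_ord // nth_ord_enum.
have sz : size (codom x) = d by rewrite size_codom card_ord.
exists (codom x); first by move=> a /codomP [i ->].
have hr k : (k <= d)%N -> reg (@zeroI R) (take k (codom x)).
  elim: k => [|k IH] hk; first by rewrite take0.
  rewrite (take_nth 0) ?sz // reg_rcons; split; first by apply: IH; apply: ltnW.
  have hsp y : Ks (@zeroI R) (take k (codom x)) y <->
     ideal_span (fun j : 'I_(Ordinal hk) => x (widen_ord (ltnW (ltn_ord (Ordinal hk))) j)) y.
    rewrite Ks_span size_take sz hk; split=> [[c ->]|[c ->]].
      exists (fun i => c i); apply: eq_bigr => i _.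
      by rewrite nth_take // -e.
    exists (fun j => oapp c 0 (insub j)); apply: eq_bigr => i _.
    rewrite nth_take //= insubT //= => h; rewrite -e; congr (c _ * _); exact: val_inj.
  move=> v /hsp; rewrite (e (Ordinal hk)) => /hreg; by move/hsp.
rewrite -[X in D X]sz; apply: D_of_reg => //; first exact: zeroI_ideal.
by rewrite -(take_size (codom x)) sz; apply: hr.
Qed.

(* Unmixedness: an associated prime of R/(a_1..a_k) has coheight at least dim R - k, hence height at most k. *)
Lemma height_ass s g : reg (@zeroI R) s -> is_prime (ann (Ks (@zeroI R) s) g) -> ~ Ks (@zeroI R) s g ->
  (height_prime (ann (Ks (@zeroI R) s) g) <= size s)%N.
Proof.
move=> hs hp hg; have [w hw hD] := CM_D; have [_ hdim] := krull_dimP.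
have hKi : is_ideal (Ks (@zeroI R) s) by apply/Ks_ideal/zeroI_ideal.
have [[P [hP hPQ]] _] := height_primeP hp.
case: (leqP (size s) (krull_dim R)) => hk; last by apply: leq_trans (hdim _ _ hP) (ltnW hk).
have hD' : D (krull_dim R - size s) (iL (Ks (@zeroI R) s)) w.
  by apply: D_mod_reg => //; [exact: zeroI_ideal | rewrite subnK].
have [P' [hP' hP0]] := chain_above hKi hp hg hw hD'.
have := hdim _ _ (chain_cat hP hP' (fun x => iff_trans (hPQ x) (iff_sym (hP0 x)))).
by rewrite -[X in (_ <= X)%N -> _](subnK hk) addnC leq_add2l.
Qed.

(** Grade equals height here: a shorter regular sequence in I extends, since by [height_ass] its
    associated primes have too small a height to contain I. *)
Lemma exists_reg c I : is_ideal I -> (forall Q, is_prime Q -> (forall x, I x -> Q x) -> (c <= height_prime Q)%N) ->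
  exists s : seq R, [/\ size s = c, reg (@zeroI R) s & forall a, a \in s -> I a].
Proof.
move=> hI; elim: c => [|c IH] h; first by exists [::].
have [|s [hs1 hs2 hs3]] := IH; first by move=> Q hQ hIQ; apply: ltnW; apply: h.
have hKi : is_ideal (Ks (@zeroI R) s) by apply/Ks_ideal/zeroI_ideal.
have [g hg hp|x [hx hxn]] := exists_nzd hKi hI.
  apply: nnpp => hno.
  have hle : forall x, I x -> ann (Ks (@zeroI R) s) g x by move=> x hx; apply: nnpp => hh; apply: hno; exists x.
  by have := h _ hp hle; rewrite leqNgt ltnS -hs1 height_ass.
exists (rcons s x); split; first by rewrite size_rcons hs1.
  by apply/reg_rcons.
by move=> a; rewrite mem_rcons inE => /orP [/eqP ->|/hs3].
Qed.

End Noeth.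

(** Q' is chosen to avoid all products of a power of x and an element outside Q; none of them lies
    in K, because x is regular modulo K and K is inside Q. *)
Lemma prime_below (R : comNzRingType) (K Q : R -> Prop) x : is_ideal K -> is_prime Q -> (forall z, K z -> Q z) -> Q x ->
  nzdI K x -> exists Q', [/\ is_prime Q', (forall z, K z -> Q' z), (forall z, Q' z -> Q z) & ~ Q' x].
Proof.
move=> hK hQ hKQ hx hn.
have hnX i v : K (x ^+ i * v) -> K v.
  by elim: i v => [|i IH] v; rewrite ?expr0 ?mul1r // exprSr -mulrA => /IH /hn.
have [|||Q' [h1 [h2 h3]]] := @exists_prime_avoiding R K (fun z => exists s i, ~ Q s /\ z = s * x ^+ i) hK.
- by exists 1, 0%N; rewrite mul1r; split=> //; exact: prime1.
- move=> _ _ [s [i [hs ->]]] [t [j [ht ->]]]; exists (s * t), (i + j)%N; split; first exact: primeNM.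
  by rewrite exprD; ring.
- by move=> z hz [s [i [hs e]]]; apply/hs/hKQ/(hnX i); rewrite mulrC -e.
exists Q'; split=> //.
  by move=> z hz; apply: nnpp => hzn; apply: (h3 z) => //; exists z, 0%N; rewrite mulr1.
by apply: h3; exists 1, 1%N; rewrite mul1r; split=> //; exact: prime1.
Qed.

(** * Regular sequences of minors of a generic matrix *)

Section ExtIdeal.
Variable R : comNzRingType.
Implicit Types (K : R -> Prop) (s : seq R).

Definition ext K : {poly R} -> Prop := fun p => forall i, K p`_i.

Lemma ext_ideal K : is_ideal K -> is_ideal (ext K).
Proof.
move=> hK; split; first by move=> i; rewrite coef0; apply: id0.
split=> [p q hp hq i|p q hq i]; first by rewrite coefD; apply: idD.
by rewrite coefM; apply: id_sum => // j _; apply: idM.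
Qed.

Lemma extC K a : is_ideal K -> (ext K a%:P <-> K a).
Proof.
move=> hK; split=> [/(_ 0%N)|h i]; rewrite coefC //=.
by case: ifP => // _; apply: id0.
Qed.

Lemma ext_prime K : is_prime K -> is_prime (ext K).
Proof.
move=> hK; have hKi := prime_ideal hK; apply: mk_prime; first exact: ext_ideal.
  by move=> h; apply: (prime1 hK); apply/(extC _ hKi).
move=> p q hpq; apply: nnpp => hno.
have low (f : {poly R}) : ~ ext K f -> exists i, ~ K f`_i /\ forall j, (j < i)%N -> K f`_j.
  move=> h; have [i hi] := not_forall h.
  have [n [h1 h2]] := nat_min (ex_intro (fun i => ~ K f`_i) i hi); exists n; split=> // j hj.
  by apply: nnpp => hh; have := h2 j hh; rewrite leqNgt hj.
have [|i [hi hi2]] := low p; first by move=> h; apply: hno; left.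
have [|j [hj hj2]] := low q; first by move=> h; apply: hno; right.
apply: (primeNM hK hi hj).
have := hpq (i + j)%N; rewrite coefM.
have hij : (i < (i + j).+1)%N by rewrite ltnS leq_addr.
rewrite (bigD1 (Ordinal hij)) //= addKn => h.
rewrite -[X in K X](addrK (\sum_(i0 < (i + j).+1 | i0 != Ordinal hij) p`_i0 * q`_(i + j - i0))).
apply: idB => //; apply: id_sum => // k hk.
case: (ltngtP k i) => hki.
- by apply: idMr => //; apply: hi2.
- by apply: idM => //; apply: hj2; rewrite ltn_subLR ?ltn_add2r // -ltnS.
- by case/eqP: hk; apply: val_inj.
Qed.

Lemma ext_zero : ext (@zeroI R) = @zeroI {poly R}.
Proof.
apply: predext => p; split=> [h|-> i]; last by rewrite coef0.
by apply/polyP => i; rewrite coef0; apply: h.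
Qed.

Lemma Kf_ext K a : is_ideal K -> Kf (ext K) a%:P = ext (Kf K a).
Proof.
move=> hK; apply: predext => p; split=> [[u hu] i|h].
  by exists u`_i; have := hu i; rewrite coefB coefMC.
have [g hg] := choose_fun 0 (fun i (_ : True) => h i).
exists (\poly_(i < size p) g i) => i; rewrite coefB coefMC coef_poly.
case: ltnP => hi; first exact: hg.
by rewrite nth_default // mul0r subrr; apply: id0.
Qed.

Lemma Ks_ext K s : is_ideal K -> Ks (ext K) (map polyC s) = ext (Ks K s).
Proof. by elim: s K => [|a s IH] K hK //=; rewrite Kf_ext // IH //; exact: Kf_ideal. Qed.

Lemma nzdI_ext K a : nzdI K a -> nzdI (ext K) a%:P.
Proof. by move=> h v hv i; apply: h; have := hv i; rewrite coefCM. Qed.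

Lemma reg_ext s : reg (@zeroI R) s -> reg (@zeroI {poly R}) (map polyC s).
Proof.
rewrite -ext_zero; move: (@zeroI_ideal R); elim: s (@zeroI R) => [|a s IH] K hK //= [h1 h2].
by split; [exact: nzdI_ext | rewrite Kf_ext //; apply: IH => //; exact: Kf_ideal].
Qed.

Lemma mccoyI K (f g : {poly R}) : is_ideal K -> ext K (f * g) -> ~ ext K g ->
  exists gam, ~ K gam /\ forall j, K (f`_j * gam).
Proof.
move=> hK h hg.
have e (p : {poly R}) : Lx (iL K) (const_mx p : 'rV_1) <-> ext K p.
  by split=> h' i; have := h' i; rewrite /iL !mxE.
have [f' ->||gam [h1 h2]] := @mccoy R 1 (iL K) (iL_sub hK) (fun x => x = f) (const_mx g).
- have -> : f *: const_mx g = const_mx (f * g) :> 'rV_1 by apply/rowP => j; rewrite !mxE.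
  exact/e.
- by move/e.
exists (gam 0 0); split=> // j; have := h2 f erefl j; by rewrite /iL mxE.
Qed.
End ExtIdeal.

Lemma Ks_perm (R : comNzRingType) (s t : seq R) : perm_eq s t -> Ks (@zeroI R) s = Ks (@zeroI R) t.
Proof.
move=> /perm_mem h; apply: predext => x.
split; apply: Ks_le; (try by apply/Ks_ideal/zeroI_ideal); move=> a ha; apply: Ks_mem; by rewrite ?h // -h.
Qed.

(** Without local hypotheses only this half of the permutability of regular sequences holds; it lets
    the order of the minors be changed below. *)
Lemma nzdI_swap (R : comNzRingType) (K : R -> Prop) g h : is_ideal K ->
  nzdI K g -> nzdI (Kf K g) h -> nzdI (Kf K h) g.
Proof.
move=> hK hg hh v [u hu].
have [|u' hu'] := hh u.
  exists v; have -> : h * u - v * g = - (g * v - u * h) by ring.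
  exact: idN.
exists u'; apply: hg; have -> : g * (v - u' * h) = (g * v - u * h) + h * (u - u' * g) by ring.
by apply: idD => //; apply: idM.
Qed.

(** p is the pair of size and first column; the rows are the first ones and the columns consecutive.
    A matrix with L columns has L - r + 1 such minors of size r, the generic codimension, so that
    they can form a regular sequence. *)
Definition minor (S : comNzRingType) (phi : nat -> nat -> S) (p : nat * nat) : S :=
  \det (\matrix_(i < p.1, j < p.1) phi i (p.2 + j)%N).

Lemma minor0 (S : comNzRingType) (phi : nat -> nat -> S) k : minor phi (0%N, k) = 1.
Proof. by rewrite /minor det_mx00. Qed.

Section FreshEntries.
Variables (c Lw : nat).

(** The minor fits into [Lw] columns and uses only entries that precede position (r0, j0) in
    row-major order. *)
Definition okp (r0 j0 : nat) (p : nat * nat) :=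
  (p.2 + p.1 <= Lw)%N && ((p.1 <= r0)%N || ((p.1 == r0.+1) && (p.2 + r0 < j0)%N)).

(* Minors whose entries in row-major order precede (r0, j0) form regular sequences in any order. *)
Definition minors_reg (S : comNzRingType) (phi : nat -> nat -> S) (r0 j0 : nat) :=
  forall ps p, all (okp r0 j0) (rcons ps p) -> uniq (map snd (rcons ps p)) -> (size ps < c)%N ->
  nzdI (Ks (@zeroI S) (map (minor phi) ps)) (minor phi p).

Lemma minors_reg_start (S : comNzRingType) (phi : nat -> nat -> S) : minors_reg phi 0 0.
Proof.
move=> ps [r k] h _ _.
have : okp 0 0 (r, k) by apply: (allP h); rewrite mem_rcons mem_head.
rewrite /okp /= ltn0 andbF orbF leqn0 => /andP [_ /eqP ->] v; by rewrite minor0 mul1r.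
Qed.

Lemma minors_reg_row (S : comNzRingType) (phi : nat -> nat -> S) r0 : minors_reg phi r0 Lw -> minors_reg phi r0.+1 0.
Proof.
move=> h ps p h1; apply: h; apply: sub_all h1 => -[r k]; rewrite /okp /= ltn0 andbF orbF => /andP [h2 h3].
rewrite h2 /=; move: h3; rewrite leq_eqVlt ltnS => /orP [/eqP e|-> //].
by rewrite e eqxx -addnS -e h2 orbT.
Qed.

Lemma minors_reg_seq (S : comNzRingType) (phi : nat -> nat -> S) r0 j0 ps : minors_reg phi r0 j0 ->
  all (okp r0 j0) ps -> uniq (map snd ps) -> (size ps <= c)%N -> reg (@zeroI S) (map (minor phi) ps).
Proof.
move=> hT; elim/last_ind: ps => [|ps p IH] // h1 h2 h3.
rewrite map_rcons; apply/reg_rcons; split; last by apply: hT => //; rewrite size_rcons in h3.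
apply: IH.
- by move: h1; rewrite all_rcons => /andP [].
- by move: h2; rewrite map_rcons rcons_uniq => /andP [].
- by apply: ltnW; rewrite size_rcons in h3.
Qed.

Variables (S : comNzRingType) (phi : nat -> nat -> S) (r0 j0 : nat) (a : seq S).
Hypotheses (ha : reg (@zeroI S) a) (hc : size a = c).

(** A single variable serves twice: the factor X separates the old entry, the constant coefficient,
    from the elements of a, which are the higher coefficients. *)
Definition fresh : nat -> nat -> {poly S} := fun i j =>
  if (i == r0) && (j == j0) then (phi i j)%:P + Poly a * 'X else (phi i j)%:P.

Lemma minor_fresh_const p : okp r0 j0 p -> minor fresh p = (minor phi p)%:P.
Proof.
case: p => r k; rewrite /okp /= => /andP [h1 h2].
rewrite /minor /= -[RHS](det_map_mx (polyC : {rmorphism S -> {poly S}})).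
congr (\det _); apply/matrixP => i j; rewrite !mxE /fresh.
case: ifP => // /andP [/eqP e1 /eqP e2]; move: (ltn_ord i) (ltn_ord j) => hi hj; exfalso.
case/orP: h2 => [h2|/andP [/eqP e h2]]; first by rewrite e1 ltnNge h2 in hi.
have hj' : (j <= r0)%N by rewrite -ltnS -e.
by move: h2; rewrite -e2 ltn_add2l ltnNge hj'.
Qed.

(** Laplace expansion along the last row: the new entry is the lower right corner, and its cofactor
    is the minor of one size less with the same first column. *)
Lemma minor_fresh_corner k : (k + r0 = j0)%N ->
  minor fresh (r0.+1, k) = (minor phi (r0.+1, k))%:P + Poly a * 'X * (minor phi (r0, k))%:P.
Proof.
move=> hk; rewrite /minor /=.
rewrite -[in X in _ = X + _](det_map_mx (polyC : {rmorphism S -> {poly S}})).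
rewrite -(det_map_mx (polyC : {rmorphism S -> {poly S}})).
set M := \matrix_(_, _) fresh _ _; set M0 := map_mx _ _.
rewrite (expand_det_row M ord_max) (expand_det_row M0 ord_max).
have hcof j : cofactor M ord_max j = cofactor M0 ord_max j.
  rewrite /cofactor; congr (_ * \det _); apply/matrixP => x y; rewrite !mxE /fresh.
  case: ifP => // /andP [/eqP e _]; exfalso; move: (neq_lift ord_max x); rewrite -val_eqE /= => /eqP; apply.
  by rewrite -[LHS]e.
rewrite (eq_bigr (fun j => M0 ord_max j * cofactor M0 ord_max j +
   (if j == ord_max then Poly a * 'X else 0) * cofactor M0 ord_max j)); last first.
  move=> j _; rewrite hcof -mulrDl; congr (_ * _); rewrite !mxE /fresh /= eqxx /=.
  have -> : ((k + j)%N == j0) = (j == ord_max) by rewrite -hk eqn_add2l -val_eqE.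
  by case: ifP; rewrite ?addr0.
rewrite big_split /=; congr (_ + _).
rewrite (bigD1 ord_max) //= eqxx big1 ?addr0; last by move=> j /negbTE ->; rewrite mul0r.
congr (_ * _).
rewrite /cofactor addnn -mul2n exprM sqrrN expr1n expr1n mul1r; congr (\det _).
apply/matrixP => x y; rewrite !mxE /= /bump.
have h (z : 'I_r0) : (r0 <= z)%N = false by apply/negbTE; rewrite -ltnNge.
by rewrite !h !add0n.
Qed.

Lemma okp_next p : okp r0 j0.+1 p -> okp r0 j0 p \/ (p = (r0.+1, p.2) /\ (p.2 + r0 = j0)%N).
Proof.
case: p => r k; rewrite /okp /= => /andP [-> /=]; case/orP => [->|/andP [/eqP ->]]; first by left.
by rewrite ltnS leq_eqVlt => /orP [/eqP h|h]; [right | left; rewrite eqxx h orbT].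
Qed.

(** At most one of the minors contains the new entry, because it must start in column j0 - r0 and
    first columns are distinct. Minors in old entries pass from S to S[X]; the new one is treated by
    McCoy when it comes last and is brought there by [nzdI_swap] otherwise. *)
Lemma minors_reg_fresh : minors_reg phi r0 j0 -> minors_reg fresh r0 j0.+1.
Proof.
move=> hT.
have constE ps : all (okp r0 j0) ps -> map (minor fresh) ps = map polyC (map (minor phi) ps).
  by move=> /allP h; rewrite -map_comp; apply/eq_in_map => p /h; apply: minor_fresh_const.
have case1 ps p : all (okp r0 j0) (rcons ps p) -> uniq (map snd (rcons ps p)) -> (size ps < c)%N ->
    nzdI (Ks (@zeroI {poly S}) (map (minor fresh) ps)) (minor fresh p).
  move=> h1 h2 h3; have := h1; rewrite all_rcons => /andP [hp hps].
  rewrite constE // minor_fresh_const // -ext_zero Ks_ext; last exact: zeroI_ideal.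
  by apply: nzdI_ext; apply: hT.
have case2 ps k : all (okp r0 j0) ps -> (k + r0 = j0)%N -> okp r0 j0.+1 (r0.+1, k) ->
    uniq (map snd (rcons ps (r0.+1, k))) -> (size ps < c)%N ->
    nzdI (Ks (@zeroI {poly S}) (map (minor fresh) ps)) (minor fresh (r0.+1, k)).
  move=> h1 hk hok h2 h3.
  have hKi : is_ideal (Ks (@zeroI S) (map (minor phi) ps)) by apply/Ks_ideal/zeroI_ideal.
  rewrite constE // minor_fresh_corner // -ext_zero Ks_ext; last exact: zeroI_ideal.
  (* gam is killed by all coefficients of the new minor, hence by each a_i times the smaller minor.
     Fewer than c elements have been divided out, so depth one along a is left and removes a_i; the
     smaller minor is regular by hypothesis. *)
  move=> v hv; apply: nnpp => hn; have [gam [hg hj]] := mccoyI hKi hv hn; apply: hg.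
  have hu : uniq (map snd ps) by move: h2; rewrite map_rcons rcons_uniq => /andP [].
  have hreg := minors_reg_seq hT h1 hu (ltnW h3).
  apply: (hT ps (r0, k)) => //.
  - by rewrite all_rcons h1 andbT /okp /= leqnn /=; move: hok; rewrite /okp /= addnS => /andP [/ltnW ->].
  - by move: h2; rewrite !map_rcons.
  have hD : D 1 (iL (Ks (@zeroI S) (map (minor phi) ps))) a.
    apply: D_mod_reg => //; first exact: zeroI_ideal.
    rewrite size_map; apply: (@D_le _ c) => //.
    by rewrite -hc; apply: D_of_reg => //; exact: zeroI_ideal.
  apply: (D1_iL hD) => b /(nthP 0) [i hi <-]; have := hj i.+1.
  by rewrite coefD coefC add0r coefMC coefMX coef_Poly mulrA.
move=> ps p hall huniq hsz.
have := hall; rewrite all_rcons => /andP [hp hps].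
case: (lem (exists2 h, h \in ps & ~~ okp r0 j0 h)) => [[h hin hh]|hno].
  have [|[eh hk]] := okp_next (allP hps _ hin); first by rewrite (negbTE hh).
  have [A [B eps]] : exists A B, ps = A ++ h :: B.
    by case/splitPr: hin => A B; exists A, B.
  have hperm : perm_eq ps (rcons (A ++ B) h).
    by rewrite eps -cats1 -catA perm_cat2l -cat1s perm_catC.
  have hu2 : uniq (map snd (rcons (rcons (A ++ B) h) p)).
    by rewrite (perm_uniq (s2 := map snd (rcons ps p))) //; apply: perm_map; rewrite -!cats1 perm_cat2r perm_sym cats1.
  have hall2 q : q \in A ++ B -> okp r0 j0.+1 q.
    move=> hq; apply: (allP hps); rewrite (perm_mem hperm) mem_rcons inE hq orbT //.
  have uniqk q : q \in rcons (A ++ B) p -> q.2 != h.2.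
    move=> hq; apply/eqP => e.
    have : perm_eq (map snd (rcons (rcons (A ++ B) h) p)) (h.2 :: map snd (rcons (A ++ B) p)).
      rewrite -map_cons; apply: perm_map; rewrite -!cats1 -catA perm_catCA /=; exact: perm_refl.
    by move/perm_uniq; rewrite hu2 /= -e map_f.
  have okAB q : q \in rcons (A ++ B) p -> okp r0 j0 q.
    move=> hq; have [||[eq hkq]] := @okp_next q; last 1 first.
    - by exfalso; move: (uniqk q hq) => /eqP; apply; apply/eqP; rewrite -(eqn_add2r r0) hkq hk.
    - move: hq; rewrite mem_rcons inE => /orP [/eqP -> //|]; exact: hall2.
    - by [].
  have hsz2 : (size (A ++ B)).+1 = size ps by rewrite (perm_size hperm) size_rcons.
  have hu3 : uniq (map snd (rcons (A ++ B) p)).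
    have : perm_eq (map snd (rcons (rcons (A ++ B) h) p)) (h.2 :: map snd (rcons (A ++ B) p)).
      rewrite -map_cons; apply: perm_map; rewrite -!cats1 -catA perm_catCA /=; exact: perm_refl.
    by move/perm_uniq; rewrite hu2 /= => /esym /andP [].
  have hKi : is_ideal (Ks (@zeroI {poly S}) (map (minor fresh) (A ++ B))) by apply/Ks_ideal/zeroI_ideal.
  have -> : Ks (@zeroI {poly S}) (map (minor fresh) ps)
     = Kf (Ks (@zeroI {poly S}) (map (minor fresh) (A ++ B))) (minor fresh h).
    by rewrite -Ks_rcons -map_rcons; apply: Ks_perm; apply: perm_map.
  apply: nzdI_swap => //.
    apply: case1 => //; first by apply/allP.
    by apply: ltnW; rewrite hsz2.
  rewrite -Ks_rcons -map_rcons eh; apply: case2 => //.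
  - by apply/allP.
  - by rewrite -eh; apply: (allP hps).
  - rewrite -eh (perm_uniq (s2 := map snd (rcons (rcons (A ++ B) h) p))) //.
    by apply: perm_map; rewrite -!cats1 -!catA !perm_cat2l perm_catC.
  - by rewrite size_rcons hsz2.
have hps0 : all (okp r0 j0) ps.
  by apply/allP => q hq; apply/negPn/negP => hh; apply: hno; exists q.
have [hp0|[ep hk]] := okp_next hp; first by apply: case1 => //; rewrite all_rcons hp0.
by rewrite ep; apply: case2 => //; rewrite -?ep.
Qed.
End FreshEntries.

(** * Depth of the quotient by generic vectors *)

Section Flag.
Variables (S : comNzRingType) (e : nat) (z : nat -> 'rV[S]_e).

Definition coord (r : nat) (v : 'rV[S]_e) : S := if insub r is Some i then v 0 i else 0.
Definition ent (r j : nat) : S := coord r (z j).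

Lemma coordE (i : 'I_e) v : coord i v = v 0 i.
Proof. by rewrite /coord valK. Qed.
Lemma coordD r u v : coord r (u + v) = coord r u + coord r v.
Proof. by rewrite /coord; case: insub => [i|]; rewrite ?mxE ?addr0. Qed.
Lemma coordZ r a v : coord r (a *: v) = a * coord r v.
Proof. by rewrite /coord; case: insub => [i|]; rewrite ?mxE ?mulr0. Qed.
Lemma coord0 r : coord r 0 = 0.
Proof. by rewrite /coord; case: insub => [i|]; rewrite ?mxE. Qed.
Lemma coord_sum r (I : Type) (s : seq I) (P : pred I) (F : I -> 'rV[S]_e) :
  coord r (\sum_(k <- s | P k) F k) = \sum_(k <- s | P k) coord r (F k).
Proof. by apply: (big_morph (coord r)) => [x y|]; [exact: coordD | exact: coord0]. Qed.

(* LL r i is the span of z_0, ..., z_(i-1) and of the basis vectors of index at least r. *)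
Definition base (r : nat) : 'rV[S]_e -> Prop :=
  fun v => forall i : 'I_e, (i < r)%N -> iL (@zeroI S) (v 0 i)%:M.
Fixpoint LL (r i : nat) : 'rV[S]_e -> Prop :=
  if i is i'.+1 then im_add (z i') (LL r i') else base r.

Lemma baseP r v : base r v <-> forall k, (k < r)%N -> coord k v = 0.
Proof.
split=> h k hk; last by rewrite /iL mxE -coordE; apply: h.
rewrite /coord; case: insubP => [i _ ei|//]; have := h i; rewrite ei => /(_ hk).
by rewrite /iL mxE mulr1n.
Qed.

Lemma base_sub r : is_submodule (base r).
Proof.
split; [|split].
- by apply/baseP => k _; rewrite coord0.
- by move=> u v /baseP hu /baseP hv; apply/baseP => k hk; rewrite coordD hu // hv // addr0.
- by move=> a v /baseP hv; apply/baseP => k hk; rewrite coordZ hv // mulr0.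
Qed.

Lemma LL_sub r i : is_submodule (LL r i).
Proof. by elim: i => [|i IH]; [exact: base_sub | exact: im_sub]. Qed.

Lemma mulrV1 (u : 'rV[S]_1) (v : 'rV[S]_e) : u *m v = u 0 0 *: v.
Proof. by apply/rowP => j; rewrite !mxE big_ord1. Qed.

Lemma LL_span r i v : LL r i v <-> exists c : nat -> S, base r (v - \sum_(j < i) c j *: z j).
Proof.
elim: i v => [|i IH] v /=.
  split=> [h|[c]]; last by rewrite big_ord0 subr0.
  by exists (fun _ => 0); rewrite big_ord0 subr0.
split=> [[u /IH [c hc]]|[c hc]].
  exists (fun j => if (j < i)%N then c j else u 0 0).
  rewrite big_ord_recr /= ltnn; move: hc; rewrite mulrV1; congr (base r).
  rewrite opprD [in RHS]addrA [in RHS]addrAC; congr (_ - _).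
  by apply: eq_bigr => j _; rewrite ltn_ord.
exists (const_mx (c i)); apply/IH; exists c; move: hc.
by rewrite big_ord_recr /= mulrV1 mxE opprD addrA addrAC.
Qed.

Lemma im_add_comm (u v : 'rV[S]_e) L : im_add u (im_add v L) = im_add v (im_add u L).
Proof.
by apply: predext => x; split=> -[a [b h]]; exists b, a; rewrite addrAC.
Qed.

Lemma LL_drop r i (h : (r < e)%N) : im_add (delta_mx (0 : 'I_1) (Ordinal h)) (LL r.+1 i) = LL r i.
Proof.
elim: i => [|i IH] /=; last by rewrite im_add_comm IH.
have cd k : coord k (delta_mx (0 : 'I_1) (Ordinal h)) = (k == r)%:R.
  rewrite /coord; case: insubP => [j _ ej|hk]; first by rewrite mxE eqxx -val_eqE /= ej.
  by case: eqP => // ek; rewrite ek h in hk.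
apply: predext => v; split=> [[u /baseP hu]|/baseP hv].
  apply/baseP => k hk; have := hu k (ltnW hk); rewrite mulrV1 coordD -scaleN1r !coordZ cd.
  by rewrite (ltn_eqF hk) !mulr0 addr0.
exists (const_mx (coord r v)); apply/baseP => k; rewrite ltnS leq_eqVlt mulrV1 mxE coordD -scaleN1r !coordZ cd.
case: eqP => [->|_] /= hk; first by rewrite mulr1 mulN1r subrr.
by rewrite hv // !mulr0 addr0.
Qed.

Lemma LL_base r i v : base r v -> LL r i v.
Proof. by elim: i => [|i IH] //= /IH; apply: im_le. Qed.

Lemma LL_z r i j : (j < i)%N -> LL r i (z j).
Proof.
elim: i => [|i IH] //=; rewrite ltnS leq_eqVlt => /orP [/eqP ->|/IH]; last exact: im_le.
by exists 1; rewrite mul1mx subrr; apply: (sub0 (LL_sub r i)).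
Qed.

(** Cramer's rule: the minor times v agrees in the first r coordinates with a combination of z_k,
    ..., z_(k+r-1); the other coordinates are free in [LL]. *)
Lemma minor_kills r i k v : (k + r <= i)%N -> LL r i (minor ent (r, k) *: v).
Proof.
move=> hk; have hL := LL_sub r i.
pose A : 'M[S]_r := \matrix_(a < r, b < r) ent a (k + b).
pose x : 'cV[S]_r := \adj A *m \col_a coord a v.
have hx (a : 'I_r) : \sum_(b < r) ent a (k + b) * x b 0 = minor ent (r, k) * coord a v.
  have := mulmxA A (\adj A) (\col_a coord a v); rewrite mul_mx_adj => /matrixP /(_ a 0).
  rewrite mul_scalar_mx !mxE => <-; apply: eq_bigr => b _; by rewrite !mxE.
rewrite -(subrK (\sum_(b < r) x b 0 *: z (k + b)%N) (_ *: v)); apply: (subD hL); last first.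
  apply: (sub_sum hL) => b _; apply: (subZ hL); apply: LL_z.
  by apply: leq_trans hk; rewrite -addnS leq_add2l.
apply: LL_base; apply/baseP => a ha; rewrite coordD -scaleN1r !coordZ coord_sum mulN1r -(hx (Ordinal ha)) /=.
by rewrite -sumrB big1 // => b _; rewrite coordZ mulrC subrr.
Qed.

(** A relation between z_0, ..., z_i in the first r coordinates is a vector killed by an r by r
    matrix with regular determinant. *)
Lemma LL_indep r i s : (i < r)%N -> nzdI (@zeroI S) (minor ent (r, 0%N)) -> LL r i (s *: z i) -> s = 0.
Proof.
move=> hi hn /LL_span [c /baseP hc].
pose A : 'M[S]_r := \matrix_(a < r, b < r) ent a (0 + b).
pose x : 'cV[S]_r := \col_b (if (b < i)%N then - c b else if b == i :> nat then s else 0).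
have hAx : A *m x = 0.
  apply/colP => a; rewrite !mxE.
  rewrite -[RHS](hc a (ltn_ord a)) coordD coordZ -scaleN1r coordZ coord_sum mulN1r.
  under eq_bigr do rewrite !mxE add0n.
  rewrite (bigID (fun b : 'I_r => (b < i)%N)) /= addrC; congr (_ + _).
    rewrite (bigD1 (Ordinal hi)) /= ?ltnn // eqxx big1 ?addr0 => [|b /andP [h1 h2]]; first by rewrite mulrC.
    by rewrite (negbTE h1); move: h2; rewrite -val_eqE /= => /negbTE ->; rewrite mulr0.
  rewrite -sumrN (big_ord_widen_cond r xpredT (fun b => - coord a (c b *: z b))) /=; last exact: ltnW.
  by apply: eq_bigr => b ->; rewrite coordZ mulrN mulrC.
have : minor ent (r, 0%N) *: x = 0.
  by rewrite -mul_scalar_mx -[_%:M](mul_adj_mx A) -mulmxA hAx mulmx0.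
by move=> /colP /(_ (Ordinal hi)); rewrite !mxE ltnn eqxx => /hn.
Qed.

Variables (c Lw : nat).
Hypothesis hT : minors_reg c Lw ent e 0.

Lemma minors_D r n : (r <= e)%N -> (n <= c)%N -> (n + r <= Lw.+1)%N ->
  D n (iL (@zeroI S)) [seq minor ent (r, k) | k <- iota 0 n].
Proof.
move=> hr hn hL.
have -> : n = size (map (minor ent) [seq (r, k) | k <- iota 0 n]) by rewrite !size_map size_iota.
rewrite size_map size_map size_iota.
have -> : [seq minor ent (r, k) | k <- iota 0 n] = map (minor ent) [seq (r, k) | k <- iota 0 n].
  by rewrite -map_comp.
rewrite -[X in D X](_ : size (map (minor ent) [seq (r, k) | k <- iota 0 n]) = n); last by rewrite !size_map size_iota.
apply: D_of_reg => //; first exact: zeroI_ideal.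
apply: (minors_reg_seq hT).
- apply/allP => p /mapP [k]; rewrite mem_iota add0n => /andP [_ hk] ->; rewrite /okp /= hr /= andbT.
  by rewrite -ltnS; apply: leq_trans hL; rewrite -addSn leq_add2r.
- by rewrite -map_comp (@eq_map _ _ _ id) // map_id iota_uniq.
- by rewrite size_map size_iota.
Qed.

Lemma minor_nzd r : (r <= e)%N -> (r <= Lw)%N -> (0 < c)%N -> nzdI (@zeroI S) (minor ent (r, 0%N)).
Proof.
move=> hr hL hc; apply: (hT (ps := [::]) (p := (r, 0%N))) => //.
by rewrite /= /okp /= add0n hL hr.
Qed.

Lemma im_rV1 (y : 'rV[S]_e) L : pre_im y L = iL (fun s => L (s *: y)).
Proof. by apply: predext => u; rewrite /pre_im /iL mulrV1. Qed.

Lemma depth_free r g w : D g (iL (@zeroI S)) w -> D g (base r) w.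
Proof. exact: D_coord. Qed.

(** At most r of the z_j are independent modulo the later basis vectors, so a free module is divided
    by a free submodule, which costs one unit of depth. *)
Lemma depth_square r i g w : (r <= e)%N -> (i <= r)%N -> (r <= Lw)%N -> (0 < c)%N ->
  D g.+1 (iL (@zeroI S)) w -> D g (LL r i) w.
Proof.
move=> hr hi hL hc hg; elim: i hi => [|i IH] hi /=; first by apply/depth_free/D_mono.
apply: D_im; [exact: LL_sub | by apply: IH; apply: ltnW |].
rewrite im_rV1 (_ : (fun s => LL r i (s *: z i)) = @zeroI S) //.
apply: predext => s; split=> [h|->]; last by rewrite scale0r; apply: (sub0 (LL_sub r i)).
by apply: (LL_indep hi _ h); apply: minor_nzd.
Qed.

(** As w carries S^e into L + S y, an s with s y in L carries w S^e into L, and depth one along w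
    removes w. So the annihilator of the class of y does not depend on y. *)
Lemma quotient_ann (L : 'rV[S]_e -> Prop) (y : 'rV[S]_e) w : is_submodule L -> D 1 L w ->
  (forall f v, f \in w -> im_add y L (f *: v)) ->
  (fun s => L (s *: y)) = (fun s => forall v, L (s *: v)).
Proof.
move=> hL [hD _] hw; apply: predext => s; split=> // hs v.
apply: hD => f hf; have [u hu] := hw f v hf.
have -> : f *: (s *: v) = s *: (f *: v - u *m y) + u 0 0 *: (s *: y).
  by rewrite mulrV1 scalerBr !scalerA [f * s]mulrC [u 0 0 * s]mulrC subrK.
by apply: (subD hL); apply: (subZ hL).
Qed.

(** Induction on the rank r and the excess n = i - r + 1, in place of a Buchsbaum-Rim resolution.
    Over L = [LL r.+1 i], the vector z_i and the basis vector of index r generate isomorphic cyclic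
    modules S / (L : S^e), by [quotient_ann] for minors of size r + 1 and r. The depth of this
    module is read off from the sequence of the basis vector, whose cokernel is S^e / [LL r i] of
    smaller rank, and then used in the sequence of z_i. *)
Theorem depth_flag r n i g w : (r <= e)%N -> (r + n = i.+1)%N -> (0 < n)%N -> (n <= c)%N -> (i <= Lw)%N ->
  (n <= g)%N -> D g (iL (@zeroI S)) w -> D (g - n) (LL r i) w.
Proof.
elim: r n i g w => [|r IHr] n i g w hr.
  move=> _ _ _ _ _ _; apply: D_full => v; apply: LL_base; by apply/baseP.
elim: n i g w => [|n IHn] i g w // e1 _ hn hi hg hD.
have hc : (0 < c)%N by apply: leq_trans hn.
case: n IHn e1 hn hg => [|n] IHn e1 hn hg.
  have ei : i = r.+1 by move: e1; rewrite addn1 => -[].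
  case: g hg hD => // g _ hD; rewrite subn1 /= ei; apply: depth_square => //; by rewrite -ei.
case: i e1 hi => [|i] e1 hi; first by move: e1; rewrite addnS addSn.
have e2 : (r.+1 + n.+1 = i.+1)%N by apply/eqP; rewrite -eqSS -addnS e1.
have e3 : (r + n.+2 = i.+1)%N by rewrite -e2 !addnS addSn.
have hLs := LL_sub r.+1 i.
have IH1 g' w' : (n.+1 <= g')%N -> D g' (iL (@zeroI S)) w' -> D (g' - n.+1) (LL r.+1 i) w'.
  by move=> h1 h2; apply: IHn => //; apply: ltnW.
have IH2 : D (g - n.+2) (LL r i) w by apply: IHr => //; apply: ltnW.
have eg : (g - n.+1 = (g - n.+2).+1)%N by rewrite -subSn // subSS.
have hD1 : D (g - n.+2).+1 (LL r.+1 i) w by rewrite -eg; apply: IH1 => //; apply: ltnW.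
have D1 w' : D n.+2 (iL (@zeroI S)) w' -> D 1 (LL r.+1 i) w'.
  by move=> h; have := IH1 n.+2 w' (leqnSn _) h; rewrite subSnn.
have eK : (fun s => LL r.+1 i (s *: z i)) = (fun s => LL r.+1 i (s *: delta_mx (0 : 'I_1) (Ordinal hr))).
  rewrite (@quotient_ann _ (z i) [seq minor ent (r.+1, k) | k <- iota 0 n.+2]) //; last first.
  - move=> f v /mapP [k]; rewrite mem_iota add0n => /andP [_ hk] ->.
    apply: (@minor_kills r.+1 i.+1); rewrite addnS ltnS addnC.
    by move: hk; rewrite ltnS => hk; move: e3; rewrite addnS => -[<-]; rewrite leq_add2l.
  - apply: D1; apply: minors_D => //; by rewrite addnC e1.
  rewrite (@quotient_ann _ (delta_mx (0 : 'I_1) (Ordinal hr)) [seq minor ent (r, k) | k <- iota 0 n.+2]) //.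
  - apply: D1; apply: minors_D => //; first exact: ltnW.
    by rewrite addnC e3 (leq_trans hi).
  - move=> f v /mapP [k]; rewrite mem_iota add0n => /andP [_ hk] ->.
    rewrite LL_drop; apply: minor_kills; rewrite -ltnS -addSn -e3 addnC leq_add2l; exact: hk.
have hpre : D (g - n.+2).+1 (pre_im (z i) (LL r.+1 i)) w.
  rewrite im_rV1 eK -im_rV1; apply: D_pre => //.
  by rewrite LL_drop.
by apply: (D_im hLs) => //; exact: D_mono.
Qed.
End Flag.

(** * The Fitting ideal *)

Lemma ideal_gen_le (R : comNzRingType) (S Q : R -> Prop) : is_ideal Q -> (forall x, S x -> Q x) ->
  forall x, ideal_gen S x -> Q x.
Proof.
move=> hQ h x [k [c [g [hg ->]]]]; apply: id_sum => // i _.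
by apply: idM => //; apply: h.
Qed.

Lemma ideal_gen_mem (R : comNzRingType) (S : R -> Prop) x : S x -> ideal_gen S x.
Proof. by move=> h; exists 1%N, (fun _ => 1), (fun _ => x); split=> //; rewrite big_ord1 mul1r. Qed.

(** A weak Cauchy-Binet formula: the sum runs over all maps g, repeated rows included, which is
    enough for membership in an ideal. *)
Lemma detM_in_ideal (R : comNzRingType) (Q : R -> Prop) e n (C : 'M[R]_(e, n)) (X : 'I_n -> 'rV[R]_e) :
  is_ideal Q -> (forall g : 'I_e -> 'I_n, Q (\det (\matrix_(i, k) X (g i) 0 k))) ->
  Q (\det (C *m \matrix_(j, k) X j 0 k)).
Proof.
move=> hQ h.
have -> : \det (C *m \matrix_(j, k) X j 0 k) =
  \sum_(g : {ffun 'I_e -> 'I_n}) (\prod_i C i (g i)) * \det (\matrix_(i, k) X (g i) 0 k).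
  rewrite /determinant.
  transitivity (\sum_(s : 'S_e) \sum_(g : {ffun 'I_e -> 'I_n})
      (-1) ^+ s * \prod_i (C i (g i) * X (g i) 0 (s i))).
    apply: eq_bigr => s _; rewrite -mulr_sumr; congr (_ * _).
    rewrite -(bigA_distr_bigA (fun i j => C i j * X j 0 (s i))) /=.
    by apply: eq_bigr => i _; rewrite mxE; apply: eq_bigr => j _; rewrite mxE.
  rewrite exchange_big; apply: eq_bigr => g _; rewrite mulr_sumr; apply: eq_bigr => s _.
  rewrite big_split /= mulrCA; congr (_ * (_ * _)).
  by apply: eq_bigr => i _; rewrite mxE.
by apply: id_sum => // g _; apply: idM.
Qed.

Section Fitting.
Variables (R : comNzRingType) (e : nat) (E : 'rV[R]_e -> Prop) (n : nat) (X : 'I_n -> 'rV[R]_e).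
Hypotheses (hE : is_submodule E) (hX : generated_by E X).

Lemma gen_mem i : E (X i).
Proof.
apply/hX; exists (fun j => (j == i)%:R); rewrite (bigD1 i) //= eqxx scale1r big1 ?addr0 // => j /negbTE ->.
by rewrite scale0r.
Qed.

Lemma ann_quot_ideal : is_ideal (ann_quot E).
Proof.
split; first by move=> v; rewrite scale0r; apply: sub0.
split=> [x y hx hy v|a x hx v]; first by rewrite scalerDl; apply: subD.
by rewrite -scalerA; apply: subZ.
Qed.

(** For distinct columns f, Cramer's rule expresses d times each [X (f b)] through the remaining
    generators, of which there are at most e. *)
Lemma minor_span (r : 'I_(n - e) -> 'rV[R]_n) (f : 'I_(n - e) -> 'I_n) :
  (forall a, \sum_(j < n) r a 0 j *: X j = 0) ->
  let d := \det (\matrix_(a < n - e, b < n - e) r a 0 (f b)) in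
  exists Y : 'M[R]_e, (forall i, E (row i Y)) /\ forall v, E v -> exists u : 'rV[R]_e, d *: v = u *m Y.
Proof.
move=> hr d.
have [finj|fninj] := boolP (injectiveb f); last first.
  have [a [b [hab eab]]] : exists a b, a != b /\ f a = f b.
    move: fninj => /injectivePn [a [b hab eab]]; by exists a, b.
  have d0 : d = 0.
    rewrite /d -det_tr; apply: (determinant_alternate hab) => k; by rewrite !mxE eab.
  exists 0; split=> [i|v _]; first by rewrite row0; apply: sub0.
  by exists 0; rewrite d0 scale0r mul0mx.
move/injectiveP: finj => finj.
pose T := [set j | j \notin codom f].
have hT : (#|T| <= e)%N.
  have -> : T = ~: (f @: setT).
    by apply/setP => j; rewrite !inE; congr (~~ _); apply/codomP/imsetP => [[x ->]|[x _ ->]]; exists x.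
  have := cardsC (f @: [set: 'I_(n - e)]); rewrite card_imset // cardsT !card_ord => h.
  rewrite -(leq_add2l (n - e)) h; case: (leqP e n) => h1; first by rewrite subnK.
  by rewrite (ltnW (leq_trans h1 (leq_addl _ _))).
(* Fewer than e generators may remain; the missing rows are zero. *)
pose Y : 'M[R]_e := \matrix_i (if insub (nat_of_ord i) is Some k then X (@enum_val _ (mem T) k) else 0).
pose sp v := exists u : 'rV[R]_e, v = u *m Y.
have sp0 : sp 0 by exists 0; rewrite mul0mx.
have spD u v : sp u -> sp v -> sp (u + v) by move=> [a ->] [b ->]; exists (a + b); rewrite mulmxDl.
have spZ a v : sp v -> sp (a *: v) by move=> [u ->]; exists (a *: u); rewrite scalemxAl.
have spT j : j \in T -> sp (X j).
  move=> hj; have hk : (enum_rank_in hj j < e)%N by apply: leq_trans hT; apply: ltn_ord.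
  exists (delta_mx 0 (Ordinal hk)); rewrite -rowE rowK.
  rewrite insubT /=; first exact: ltn_ord.
  by move=> h; congr X; rewrite -[LHS](enum_rankK_in hj hj); congr enum_val; apply: val_inj.
exists Y; split=> [i|v].
  by rewrite rowK; case: insub => [k|]; [exact: gen_mem | exact: sub0].
have hd k : sp (d *: X (f k)).
  apply: (det_trick (r := fun b => X (f b)) sp0 spD spZ) => a.
  under eq_bigr do rewrite mxE.
  have := hr a; rewrite (bigID (mem (codom f))) /= => h.
  have <- : \sum_(j | j \in codom f) r a 0 j *: X j = \sum_b r a 0 (f b) *: X (f b).
    rewrite -big_uniq /=; last by rewrite /codom /image_mem map_inj_uniq ?enum_uniq.
    by rewrite big_map big_enum.
  rewrite (eqP (_ : \sum_(j | j \in codom f) r a 0 j *: X j ==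
     (-1) *: \sum_(j | j \notin codom f) r a 0 j *: X j)); last first.
    by rewrite scaleN1r -addr_eq0 h.
  apply: (spZ); apply: (big_ind sp) => // j hj; apply: (spZ); apply: (spT); by rewrite inE.
move/hX => [c ->]; rewrite scaler_sumr; apply: (big_ind sp) => // j _.
rewrite scalerA mulrC -scalerA; apply: (spZ).
have [/codomP [k ->] //|hj] := boolP (j \in codom f).
by apply: (spZ); apply: (spT); rewrite inE.
Qed.

Lemma regular_seq2 (x : 'I_2 -> R) : regular_seq x ->
  (forall r, x ord0 * r = 0 -> r = 0) /\
  forall r c, x ord_max * r = c * x ord0 -> exists c', r = c' * x ord0.
Proof.
move=> [h _]; split.
  move=> r hr; have [|c ->] := h ord0 r; last by rewrite big_ord0.
  by exists (fun _ => 0); rewrite big_ord0.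
move=> r c hr; have [|d ->] := h ord_max r.
  exists (fun _ => c); rewrite big_ord_recl big_ord0 addr0 hr; congr (_ * x _); exact: val_inj.
exists (d ord0); rewrite big_ord_recl big_ord0 addr0; congr (_ * x _); exact: val_inj.
Qed.

(** The minor d moves E into the span of e vectors Y of E, so a regular pair in the annihilator
    gives d x0 = U Y and d x1 = V Y. Up to a power of d this makes x1 U = x0 V, hence x0 divides U,
    and a power of d carries R^e into E. This is where grade two enters. *)
Lemma Fitting_le_ann Q : grade_ge (ann_quot E) 2 -> is_prime Q -> (forall x, ann_quot E x -> Q x) ->
  forall x, Fitting_of X e x -> Q x.
Proof.
move=> hg hQ hle; apply: ideal_gen_le; first exact: prime_ideal.
move=> d [r [f [hr ed]]].
case: hg => [h1|[x [hx /regular_seq2 [hx1 hx2]]]]; first by case: (prime1 hQ); apply: hle.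
have [Y [hY hspan]] := minor_span f hr; rewrite -ed in hspan.
have matU k : exists U : 'M[R]_e, (d * x k)%:M = U *m Y.
  have h (i : 'I_e) : exists u : 'rV[R]_e, (d * x k) *: delta_mx (0 : 'I_1) i = u *m Y.
    rewrite -scalerA; apply: hspan; exact: (hx k).
  have [u hu] := choose_fun 0 (fun i (_ : True) => h i).
  exists (\matrix_i u i); apply/row_matrixP => i; rewrite row_mul rowK -hu //.
  by rewrite -scalemx1 linearZ /= row1.
have [U hU] := matU ord0; have [V hV] := matU ord_max.
set x0 := x ord0 in hU hx1 hx2; set x1 := x ord_max in hV hx2.
have hx0X i r' : x0 ^+ i * r' = 0 -> r' = 0.
  by elim: i r' => [|i IH] r'; rewrite ?expr0 ?mul1r // exprSr -mulrA => /IH /hx1.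
(* Cancelling Y needs a factor det Y; as (d x0)^e = det U det Y and x0 is regular, this leaves
   d^e. *)
have hz : d ^+ e *: (x1 *: U - x0 *: V) = 0.
  have h0 : (x1 *: U - x0 *: V) *m Y = 0.
    rewrite mulmxBl -!scalemxAl -hU -hV -[(d * x0)%:M]scalemx1 -[(d * x1)%:M]scalemx1 !scalerA -scalerBl.
    have -> : x1 * (d * x0) - x0 * (d * x1) = 0 by ring.
    by rewrite scale0r.
  have h1 : \det Y *: (x1 *: U - x0 *: V) = 0.
    by rewrite -mul_mx_scalar -mul_mx_adj mulmxA h0 mul0mx.
  have h2 : (d * x0) ^+ e = \det U * \det Y by rewrite -det_scalar hU det_mulmx.
  have h3 : (d * x0) ^+ e *: (x1 *: U - x0 *: V) = 0 by rewrite h2 -scalerA h1 scaler0.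
  apply/matrixP => i j; rewrite [RHS]mxE; apply: (hx0X e).
  by move/matrixP: h3 => /(_ i j); rewrite exprMn !mxE => h3; rewrite mulrA [_ * d ^+ e]mulrC.
have hW : exists W : 'M[R]_e, d ^+ e *: U = x0 *: W.
  have h i j : exists c, d ^+ e * U i j = c * x0.
    apply: (hx2 _ (d ^+ e * V i j)).
    move/matrixP: hz => /(_ i j); rewrite !mxE => hz.
    by apply/eqP; rewrite -subr_eq0 -hz; apply/eqP; ring.
  have [w hw] := choose_fun 0 (fun (ij : 'I_e * 'I_e) (_ : True) => h ij.1 ij.2).
  exists (\matrix_(i, j) w (i, j)); apply/matrixP => i j; by rewrite !mxE (hw (i, j)) //= mulrC.
have [W eW] := hW.
have hWY : W *m Y = (d ^+ e.+1)%:M.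
  apply/matrixP => i j; apply/eqP; rewrite -subr_eq0; apply/eqP/hx1.
  have : x0 *: (W *m Y) = x0 *: (d ^+ e.+1)%:M.
    by rewrite scalemxAl -eW -scalemxAl -hU -[(d * x0)%:M]scalemx1 -[(d ^+ e.+1)%:M]scalemx1 !scalerA exprSr; congr (_ *: _); ring.
  by move/matrixP => /(_ i j); rewrite !mxE mulrBr => ->; rewrite subrr.
suff : Q (d ^+ e.+1) by apply: primeX.
apply: hle => v; rewrite -mul_mx_scalar -hWY mulmxA mulmx_sum_row.
by apply: sub_sum => // i _; apply: subZ.
Qed.

(** If a carries R^e into E, then a^e lies in the ideal of maximal minors of the generators, so some
    such minor [de] is outside Q when a is. Cramer's rule gives relations with the scalar matrix
    [de] in the other n - e columns, and its determinant lies in the Fitting ideal. *)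
Lemma ann_le_Fitting Q : is_prime Q -> (forall x, Fitting_of X e x -> Q x) -> forall x, ann_quot E x -> Q x.
Proof.
move=> hQ hF a ha; apply: nnpp => haQ.
have hQi := prime_ideal hQ.
have hc (i : 'I_e) : exists c : 'I_n -> R, a *: delta_mx (0 : 'I_1) i = \sum_j c j *: X j by apply/hX; exact: ha.
have [c hcc] := choose_fun (fun _ => 0) (fun i (_ : True) => hc i).
have hdet : (\matrix_(i, j) c i j) *m (\matrix_(j, k) X j 0 k) = a%:M.
  apply/matrixP => i k; have := hcc i I => /rowP /(_ k); rewrite !mxE summxE => h.
  under eq_bigr do rewrite !mxE.
  rewrite eqxx in h; move: h; under [in X in _ = X -> _]eq_bigr do rewrite mxE.
  by move=> <-; rewrite eq_sym mulr_natr.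
have [g hg] : exists g : 'I_e -> 'I_n, ~ Q (\det (\matrix_(i, k) X (g i) 0 k)).
  apply: nnpp => hno; apply: haQ; apply: (primeX hQ (n := e)).
  rewrite -det_scalar -hdet; apply: detM_in_ideal => // g.
  by apply: nnpp => h; apply: hno; exists g.
set A := (\matrix_(i, k) X (g i) 0 k : 'M[R]_e) in hg; set de := \det A in hg.
have ginj : injective g.
  move=> i j eij; apply/eqP; apply: contraT => hij; case: hg.
  rewrite /de (determinant_alternate hij) => [|k]; first exact: id0.
  by rewrite !mxE eij.
pose T := [set j | j \notin codom g].
have hT : #|T| = (n - e)%N.
  have -> : T = ~: (g @: setT).
    by apply/setP => j; rewrite !inE; congr (~~ _); apply/codomP/imsetP => [[x ->]|[x _ ->]]; exists x.
  have := cardsC (g @: [set: 'I_e]); rewrite card_imset // cardsT !card_ord => h.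
  by apply/eqP; rewrite -(eqn_add2l e) h subnKC // -h leq_addr.
pose f (b : 'I_(n - e)) : 'I_n := enum_val (cast_ord (esym hT) b).
have hfT b : f b \in T by apply: enum_valP.
have finj : injective f by move=> x y /enum_val_inj /cast_ord_inj.
have hfg b i : f b != g i.
  by apply/eqP => eq; have := hfT b; rewrite inE eq codom_f.
pose r (b : 'I_(n - e)) : 'rV[R]_n := \row_j (de *+ (j == f b) - \sum_i ((X (f b) *m \adj A) 0 i *+ (j == g i))).
suff : Q (de ^+ (n - e)) by move/(primeX hQ).
apply: hF; apply: ideal_gen_mem; exists r, f; split.
  move=> b; under eq_bigr do rewrite mxE scalerBl.
  rewrite sumrB; apply/eqP; rewrite subr_eq0; apply/eqP.
  rewrite (bigD1 (f b)) //= eqxx big1 ?addr0; last by move=> j /negbTE ->; rewrite mulr0n scale0r.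
  rewrite mulr1n; under [RHS]eq_bigr do rewrite scaler_suml.
  rewrite exchange_big /=.
  rewrite (eq_bigr (fun i => (X (f b) *m \adj A) 0 i *: X (g i))); last first.
    move=> i _; rewrite (bigD1 (g i)) //= eqxx big1 ?addr0 //; last by move=> j /negbTE ->; rewrite mulr0n scale0r.
  have -> : \sum_i (X (f b) *m \adj A) 0 i *: X (g i) = (X (f b) *m \adj A) *m A.
    rewrite [RHS]mulmx_sum_row; apply: eq_bigr => i _; congr (_ *: _).
    by apply/rowP => k; rewrite !mxE.
  by rewrite -mulmxA mul_adj_mx mul_mx_scalar.
rewrite -det_scalar; congr (\det _); apply/matrixP => b b'; rewrite !mxE.
rewrite [X in _ - X]big1 ?subr0; last by move=> i _; rewrite (negbTE (hfg b' i)) mulr0n.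
by rewrite (inj_eq finj) eq_sym.
Qed.
End Fitting.

Lemma gensP (R : comNzRingType) e (E : 'rV[R]_e -> Prop) : (exists n (X : 'I_n -> 'rV[R]_e), generated_by E X) ->
  generated_by E (projT2 (gens E)).
Proof.
move=> [n [X hX]].
apply: (epsilon_spec (inhabits (existT (fun n => 'I_n -> 'rV[R]_e) 0%N (fun _ => 0)))
   (fun nX => generated_by E (projT2 nX))).
by exists (existT _ n X).
Qed.

(** [Fitting] is formed from generators picked by [epsilon]. Only the primes above it enter the
    argument, and they are the same for every choice. *)
Lemma Fitting_prime (R : comNzRingType) e (E : 'rV[R]_e -> Prop) Q : ideal_module E -> is_prime Q ->
  (forall x, Fitting e E x -> Q x) <-> (forall x, ann_quot E x -> Q x).
Proof.
move=> [_ [hE [hfg hg]]] hQ; have hX := gensP hfg.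
split; first exact: ann_le_Fitting.
by apply: Fitting_le_ann.
Qed.

(** * Algebras generated by linear forms *)

(** Gaussian elimination without division, with a pivot outside P. *)
Lemma elim_ord (B : comNzRingType) (P : B -> Prop) k n (M : 'I_n -> 'I_k -> B) : is_prime P -> (k < n)%N ->
  exists c : 'I_n -> B, (exists i, ~ P (c i)) /\ forall j, P (\sum_i c i * M i j).
Proof.
move=> hP; have hPi := prime_ideal hP.
elim: k n M => [|k IH] n M hkn.
  by case: n M hkn => // n M _; exists (fun _ => 1); split; [exists ord0; exact: prime1 | case].
case: (lem (forall i, P (M i ord0))) => [h0|/not_forall [i0 hi0]].
  have [c [hc1 hc2]] := IH n (fun i j => M i (lift ord0 j)) (ltnW hkn).
  exists c; split=> // j; case: (unliftP ord0 j) => [j' ->|->]; first exact: hc2.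
  by apply: id_sum => // i _; apply: idM.
case: n M hkn i0 hi0 => // n M hkn i0 hi0.
pose a := M i0 ord0.
have [c [[i1 hi1] hc2]] := IH n (fun i j => a * M (lift i0 i) (lift ord0 j) - M (lift i0 i) ord0 * M i0 (lift ord0 j)) hkn.
exists (fun i => if unlift i0 i is Some i' then a * c i' else - \sum_i c i * M (lift i0 i) ord0); split.
  by exists (lift i0 i1); rewrite liftK; apply: primeNM.
move=> j; rewrite (bigD1_ord i0) //= unlift_none.
rewrite [X in _ + X](eq_bigr (fun i => a * c i * M (lift i0 i) j)); last by move=> i _; rewrite liftK.
case: (unliftP ord0 j) => [j' ->|->]; last first.
  rewrite mulNr mulr_suml -sumrN -big_split /=; apply: id_sum => // i _.
  by rewrite -/a [_ + _](_ : _ = 0); [exact: id0 | ring].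
have := hc2 j'; congr P.
rewrite mulNr mulr_suml -sumrN -big_split /=; apply: eq_bigr => i _; by ring.
Qed.

Lemma elim_fin (B : comNzRingType) (P : B -> Prop) (I K : finType) (M : I -> K -> B) : is_prime P -> (#|K| < #|I|)%N ->
  exists c : I -> B, (exists i, ~ P (c i)) /\ forall j, P (\sum_i c i * M i j).
Proof.
move=> hP h; have [c [[i hi] hc]] := @elim_ord B P _ _ (fun i j => M (enum_val i) (enum_val j)) hP h.
exists (fun i => c (enum_rank i)); split; first by exists (enum_val i); rewrite enum_valK.
move=> j; have := hc (enum_rank j); congr P.
rewrite (reindex (@enum_val I predT)) /=; last exact/onW_bij/enum_val_bij.
by apply: eq_bigr => i' _; rewrite enum_rankK enum_valK.
Qed.

Fixpoint boxT (D s : nat) : finType := if s is s'.+1 then (boxT D s' * 'I_D)%type : finType else unit.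

Lemma card_boxT D s : #|boxT D s| = (D ^ s)%N.
Proof. by elim: s => [|s IH] /=; rewrite ?card_unit // card_prod IH card_ord expnSr. Qed.

Section Graded.
Variables (B : comNzRingType) (e n : nat) (x : 'I_n -> {mpoly B[e]}).
Notation C := {mpoly B[e]}.
Definition allB : B -> Prop := fun _ => True.
Lemma allB_ideal : is_ideal allB. Proof. by []. Qed.

(* AI I d and GA I: the degree d part, and the whole, of the ideal generated by I in the algebra of the x_l. *)
Inductive AI (I : B -> Prop) : nat -> C -> Prop :=
| AI0 d : AI I d 0
| AIc c : I c -> AI I 0 c%:MP
| AIx d p l : AI I d p -> AI I d.+1 (p * x l)
| AIadd d p q : AI I d p -> AI I d q -> AI I d (p + q).

Inductive GA (I : B -> Prop) : C -> Prop :=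
| GAc c : I c -> GA I c%:MP
| GAx p l : GA I p -> GA I (p * x l)
| GAadd p q : GA I p -> GA I q -> GA I (p + q).

Variable I : B -> Prop.
Hypothesis hI : is_ideal I.

Lemma AI_scale d c p : AI I d p -> AI I d (c%:MP * p).
Proof.
elim=> [d'|a ha|d' q l _ IH|d' q r _ IH1 _ IH2].
- by rewrite mulr0; constructor.
- by rewrite -mpolyCM; constructor; apply: idM.
- by rewrite mulrA; constructor.
- by rewrite mulrDr; constructor.
Qed.

Lemma AI_mul d d' p q : AI I d p -> AI allB d' q -> AI I (d + d') (p * q).
Proof.
move=> hp; elim=> [d1|a ha|d1 q1 l _ IH|d1 q1 r _ IH1 _ IH2].
- by rewrite mulr0; constructor.
- by rewrite addn0 mulrC; apply: AI_scale.
- by rewrite mulrA addnS; constructor.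
- by rewrite mulrDr; constructor.
Qed.

Lemma AI_all d p : AI I d p -> AI allB d p.
Proof. by elim=> *; constructor. Qed.

Lemma AI_sum (T : Type) (r : seq T) (P : pred T) (F : T -> C) d :
  (forall i, P i -> AI I d (F i)) -> AI I d (\sum_(i <- r | P i) F i).
Proof. by move=> h; apply: big_ind => //; [constructor | move=> *; constructor]. Qed.

Lemma GA_scale c p : GA I p -> GA I (c%:MP * p).
Proof.
elim=> [a ha|q l _ IH|q r _ IH1 _ IH2].
- by rewrite -mpolyCM; constructor; apply: idM.
- by rewrite mulrA; constructor.
- by rewrite mulrDr; constructor.
Qed.

Lemma GA_mul p q : GA I p -> GA allB q -> GA I (p * q).
Proof.
move=> hp; elim=> [a ha|q1 l _ IH|q1 r _ IH1 _ IH2].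
- by rewrite mulrC; apply: GA_scale.
- by rewrite mulrA; constructor.
- by rewrite mulrDr; constructor.
Qed.

Lemma GA_all p : GA I p -> GA allB p.
Proof. by elim=> *; constructor. Qed.

Lemma GA0 : GA I 0.
Proof. by rewrite -mpolyC0; constructor; apply: id0. Qed.

Lemma GA_N p : GA I p -> GA I (- p).
Proof. by rewrite -mulN1r -mpolyC1 -mpolyCN; apply: GA_scale. Qed.

Lemma GA_sum (T : Type) (r : seq T) (P : pred T) (F : T -> C) :
  (forall i, P i -> GA I (F i)) -> GA I (\sum_(i <- r | P i) F i).
Proof. by move=> h; apply: big_ind => //; [exact: GA0 | move=> *; constructor]. Qed.

Lemma GA_decomp p : GA I p -> exists N (q : nat -> C), (forall d, AI I d (q d)) /\ p = \sum_(d < N) q d.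
Proof.
elim=> [a ha|q l _ [N [f [hf ->]]]|q r _ [N [f [hf ->]]] _ [N' [f' [hf' ->]]]].
- exists 1%N, (fun d => if d is 0%N then a%:MP else 0); split; first by case=> [|d]; constructor.
  by rewrite big_ord1.
- exists N.+1, (fun d => if d is d'.+1 then f d' * x l else 0); split; first by case=> [|d]; constructor.
  by rewrite big_ord_recl add0r mulr_suml.
exists (maxn N N'), (fun d => (if (d < N)%N then f d else 0) + (if (d < N')%N then f' d else 0)); split.
  by move=> d; constructor; case: ifP => _ //; constructor.
rewrite big_split /= -!big_mkcond /= -(big_ord_widen _ f (leq_maxl _ _)).
by rewrite -(big_ord_widen _ f' (leq_maxr _ _)).
Qed.

Hypothesis xh : forall l, x l \is 1.-homog.

Lemma AI_homog d p : AI I d p -> p \is d.-homog.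
Proof.
elim=> [d'|a ha|d' q l _ IH|d' q r _ IH1 _ IH2].
- exact: dhomog0.
- by rewrite -[a%:MP]mulr1 mul_mpolyC; apply/dhomogZ/dhomog1.
- by rewrite -addn1; apply: dhomogM.
- exact: dhomogD.
Qed.

Lemma homog_split N (q : nat -> C) : (forall d, q d \is d.-homog) -> \sum_(d < N) q d = 0 ->
  forall d, (d < N)%N -> q d = 0.
Proof.
move=> hq h0 d hd; apply/mpolyP => m0; rewrite mcoeff0.
have [hm|hm] := eqVneq (mdeg m0) d; last by rewrite (dhomog_nemf_coeff (hq d)) //.
have := congr1 (mcoeff m0) h0; rewrite raddf_sum /= mcoeff0 (bigD1 (Ordinal hd)) //= big1 ?addr0 // => i hi.
rewrite (dhomog_nemf_coeff (hq i)) //; apply/eqP => e1; case/eqP: hi; apply: val_inj; rewrite /= -e1; exact: hm.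
Qed.

(** Evaluation at the origin kills the linear forms. *)
Lemma GA_const c : GA I c%:MP -> I c.
Proof.
suff h p : GA I p -> I (p.@[fun _ => 0]) by move/h; rewrite mevalC.
elim=> [a ha|q l _ IH|q r _ IH1 _ IH2].
- by rewrite mevalC.
- rewrite mevalM; suff -> : (x l).@[fun _ => 0] = 0 by rewrite mulr0; apply: id0.
  rewrite mevalE big1_seq // => m0 hm0.
  have : mdeg m0 = 1%N by exact: (dhomog_mf (xh l) hm0).
  case: (lem (exists i, m0 i != 0%N)) => [[i hi] _|hno].
    by rewrite (bigD1 i) //= expr0n (negbTE hi) mul0r mulr0.
  move/eqP; rewrite mdegE big1 // => i _; apply/eqP/negPn/negP => h; by apply: hno; exists i.
- by rewrite mevalD; apply: idD.
Qed.

Variables (y : nat -> C) (K : finType) (b : K -> C).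

(** Polynomials in y_0, ..., y_(s-1) over B of degree below [del] in each variable; their monomials
    are counted by [boxT]. *)
Fixpoint YP (s del : nat) (p : C) : Prop :=
  if s is s'.+1 then exists q : nat -> C, (forall j, YP s' del (q j)) /\ p = \sum_(j < del) q j * y s' ^+ j
  else exists c, p = c%:MP.

Lemma YPD s del p q : YP s del p -> YP s del q -> YP s del (p + q).
Proof.
elim: s p q => [|s IH] p q /=; first by move=> [c ->] [d ->]; exists (c + d); rewrite mpolyCD.
move=> [f [hf ->]] [g [hg ->]]; exists (fun j => f j + g j); split; first by move=> j; apply: IH.
by rewrite -big_split; apply: eq_bigr => j _; rewrite mulrDl.
Qed.

Lemma YP0 s del : YP s del 0.
Proof.
elim: s => [|s IH] /=; first by exists 0; rewrite mpolyC0.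
by exists (fun _ => 0); split=> //; rewrite big1 // => j _; rewrite mul0r.
Qed.

Lemma YP_sum s del (T : Type) (r : seq T) (P : pred T) (F : T -> C) :
  (forall i, P i -> YP s del (F i)) -> YP s del (\sum_(i <- r | P i) F i).
Proof. by move=> h; apply: big_ind => //; [exact: YP0 | move=> *; exact: YPD]. Qed.

Lemma YP_single s del q j : (j < del)%N -> YP s del q -> YP s.+1 del (q * y s ^+ j).
Proof.
move=> hj hq; exists (fun i => if i == j then q else 0); split.
  by move=> i; case: ifP => _ //; apply: YP0.
rewrite (bigD1 (Ordinal hj)) //= eqxx big1 ?addr0 // => i hi.
by case: eqP => e1; [case/eqP: hi; apply: val_inj | rewrite mul0r].
Qed.

Lemma YP_le s del del' p : (del <= del')%N -> YP s del p -> YP s del' p.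
Proof.
move=> hd; elim: s p => [|s IH] p // [q [hq ->]].
apply: YP_sum => j _; apply: (@YP_single s); first exact: leq_trans (ltn_ord j) hd.
exact: IH (hq j).
Qed.

Lemma YPM s del del' p q : YP s del p -> YP s del' q -> YP s (del + del') (p * q).
Proof.
elim: s p q => [|s IH] p q /=; first by move=> [c ->] [d ->]; exists (c * d); rewrite mpolyCM.
move=> [f [hf ->]] [g [hg ->]]; rewrite mulr_suml; apply: (@YP_sum s.+1) => i _.
rewrite mulr_sumr; apply: (@YP_sum s.+1) => j _.
rewrite mulrACA -exprD; apply: (@YP_single s); last exact: IH.
by rewrite -addSn leq_add // ltnW.
Qed.

Lemma YPC s del c : (0 < del)%N -> YP s del c%:MP.
Proof.
move=> hd; elim: s => [|s IH]; first by exists c.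
by rewrite -[c%:MP]mulr1 -(expr0 (y s)); apply: (@YP_single s).
Qed.

Lemma YP_GA s del p : (forall i, (i < s)%N -> GA allB (y i)) -> YP s del p -> GA allB p.
Proof.
elim: s p => [|s IH] p hy /=; first by move=> [c ->]; constructor.
move=> [q [hq ->]]; apply: big_ind.
- by rewrite -mpolyC0; constructor.
- by move=> *; constructor.
have hy' i : (i < s)%N -> GA allB (y i) by move=> hi; apply/hy/ltnW.
move=> j _; move: (IH _ hy' (hq j)); move: (q j) => qj hqj.
elim: (nat_of_ord j) => [|k IHk]; first by rewrite mulr1.
have mulA u v : GA allB u -> GA allB v -> GA allB (u * v).
  move=> hu; elim=> [a _|q1 l _ IH'|q1 r _ IH1 _ IH2].
  - elim: hu => [a' _|q2 l _ IH'|q2 r _ IH1 _ IH2]; [by rewrite -mpolyCM; constructor | by rewrite mulrAC; constructor | by rewrite mulrDl; constructor].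
  - by rewrite mulrA; constructor.
  - by rewrite mulrDr; constructor.
have -> : qj * y s ^+ k.+1 = (qj * y s ^+ k) * y s by rewrite exprSr mulrA.
by apply: mulA => //; apply: hy.
Qed.

Fixpoint monev (D s : nat) (u : nat -> C) : boxT D s -> C :=
  match s return boxT D s -> C with
  | 0%N => fun _ => 1
  | s'.+1 => fun be => monev u be.1 * u s' ^+ be.2
  end.

Lemma YP_box s del p : YP s del p -> exists c : boxT del s -> B, p = \sum_be (c be)%:MP * monev y be.
Proof.
elim: s p => [|s IH] p /=.
  move=> [c ->]; exists (fun _ => c); rewrite (bigD1 tt) //= big1 ?addr0 ?mulr1 //; by case.
move=> [q [hq ->]]; have [f hf] := choose_fun (fun _ => 0) (fun j (_ : True) => IH _ (hq j)).
exists (fun be : (boxT del s * 'I_del) => f be.2 be.1).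
rewrite -(pair_bigA _ (fun (be : boxT del s) (j : 'I_del) => (f j be)%:MP * (monev y be * y s ^+ j))) /=.
rewrite exchange_big /=; apply: eq_bigr => j _.
by rewrite (hf j) // mulr_suml; apply: eq_bigr => be _; rewrite mulrA.
Qed.

Variable s : nat.
(** [VD] below is the finiteness of A / I A over B[y], with an explicit bound for the degrees of the
    coefficients. *)
Definition V (del : nat) (p : C) := exists q : K -> C, (forall k, YP s del (q k)) /\ GA I (p - \sum_k q k * b k).

Definition VD (del0 : nat) := [/\ (forall i, (i < s)%N -> GA allB (y i)), (forall k, GA allB (b k)),
  V del0 1 & forall l k, V del0 (x l * b k)].

Lemma VDadd del p q : V del p -> V del q -> V del (p + q).
Proof.
move=> [f [hf1 hf2]] [g [hg1 hg2]]; exists (fun k => f k + g k); split; first by move=> k; apply: YPD.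
under eq_bigr do rewrite mulrDl.
by rewrite big_split /= opprD addrACA; constructor.
Qed.

Lemma V_le del del' p : (del <= del')%N -> V del p -> V del' p.
Proof. by move=> h [q [h1 h2]]; exists q; split=> // k; apply: YP_le (h1 k). Qed.

Lemma V_mod del p q : V del p -> GA I (q - p) -> V del q.
Proof.
move=> [f [hf1 hf2]] h; exists f; split=> //.
by rewrite -(subrK p q) -addrA; constructor.
Qed.

Lemma V0 del : V del 0.
Proof.
exists (fun _ => 0); split; first by move=> k; apply: YP0.
by rewrite big1 ?subr0 => [|k _]; [exact: GA0 | rewrite mul0r].
Qed.

Lemma V_sum del (T : Type) (r : seq T) (P : pred T) (F : T -> C) :
  (forall i, P i -> V del (F i)) -> V del (\sum_(i <- r | P i) F i).
Proof. by move=> h; apply: big_ind => //; [exact: V0 | move=> *; exact: VDadd]. Qed.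

Lemma V_YP del del' p q : (forall i, (i < s)%N -> GA allB (y i)) -> YP s del' q -> V del p -> V (del' + del) (q * p).
Proof.
move=> hy hq [f [hf1 hf2]]; exists (fun k => q * f k); split; first by move=> k; apply: YPM.
under eq_bigr do rewrite -mulrA.
by rewrite -mulr_sumr -mulrBr mulrC; apply: GA_mul => //; apply: YP_GA hq.
Qed.

Variable del0 : nat.
Hypothesis hVD : VD del0.

Lemma V_x del p l : V del p -> V (del + del0) (p * x l).
Proof.
have [hy hb _ hx] := hVD; move=> [q [hq1 hq2]].
apply: (V_mod (p := (\sum_k q k * b k) * x l)); last by rewrite -mulrBl; apply: GAx.
rewrite mulr_suml; apply: V_sum => k _; rewrite -mulrA [b k * _]mulrC; exact: V_YP.
Qed.

Definition grows (u : C) (d1 : nat) := forall del p, V del p -> V (del + d1) (p * u).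

Lemma grows_le u d1 d2 : (d1 <= d2)%N -> grows u d1 -> grows u d2.
Proof. by move=> h h1 del p /h1; apply: V_le; rewrite leq_add2l. Qed.

Lemma GA_grows u : GA allB u -> exists d1, grows u d1.
Proof.
have [hy _ _ _] := hVD.
elim=> [a _|q l _ [d1 h1]|q r _ [d1 h1] _ [d2 h2]].
- by exists 1%N => del p hp; rewrite mulrC addnC; apply: V_YP => //; apply: YPC.
- by exists (d1 + del0)%N => del p hp; rewrite mulrA addnA; apply/V_x/h1.
- exists (maxn d1 d2) => del p hp; rewrite mulrDr; apply: VDadd.
    by apply: (grows_le (leq_maxl d1 d2) h1).
  by apply: (grows_le (leq_maxr d1 d2) h2).
Qed.

Lemma lin_grows (g : 'I_n -> B) : grows (\sum_l (g l)%:MP * x l) (1 + del0).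
Proof.
have [hy _ _ _] := hVD.
move=> del p hp; rewrite mulr_sumr; apply: V_sum => l _.
rewrite mulrA addnA; apply: V_x; rewrite mulrC addnC; apply: V_YP => //; exact: YPC.
Qed.

Lemma monev_V (u : nat -> C) N d1 D : (forall i, (i < N)%N -> grows (u i) d1) ->
  forall be : boxT D N, V (del0 + N * D * d1) (monev u be).
Proof.
have [_ _ h1 _] := hVD.
elim: N => [|N IH] hu be; first by rewrite /= !mul0n addn0.
case: be => be [j hj] /=.
have := IH (fun i hi => hu i (ltnW hi)) be.
move: (monev u be) => p hp.
apply: (@V_le (del0 + N * D * d1 + j * d1)).
  by rewrite -addnA leq_add2l -mulnDl leq_mul2r mulSn addnC leq_add2r (ltnW hj) orbT.
elim: j hj => [|j IHj] hj; first by rewrite mul0n addn0 mulr1.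
rewrite exprSr mulrA mulSn [(d1 + _)%N]addnC addnA; apply: hu => //; apply: IHj; exact: ltnW.
Qed.

(* A is spanned by K over B[y_0..y_(s-1)] modulo I A, so s+1 elements are algebraically dependent: count monomials. *)
Lemma dependence (u : nat -> C) d1 : is_prime I -> (forall i, (i < s.+1)%N -> grows (u i) d1) ->
  exists D (c : boxT D s.+1 -> B), (exists be, ~ I (c be)) /\ GA I (\sum_be (c be)%:MP * monev u be).
Proof.
move=> hIp hu; have [hy hb _ _] := hVD.
(* Monomials with exponents below D have coefficients of degree below a bound of at most G D, hence
   at most (G D)^s |K| coordinates, against D^(s+1) monomials; the next line makes D large
   enough. *)
pose G := (del0 + s.+1 * d1)%N.
pose D := (G ^ s * #|K|).+1.
exists D.
pose del := (del0 + s.+1 * D * d1)%N.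
have hV := @monev_V u s.+1 d1 D hu.
have hM (be : boxT D s.+1) : exists M : boxT del s * K -> B,
    GA I (monev u be - \sum_k (M k)%:MP * (monev y k.1 * b k.2)).
  have [q [hq1 hq2]] := hV be.
  have [f hf] := choose_fun (fun _ => 0) (fun k (_ : True) => YP_box (hq1 k)).
  exists (fun k => f k.2 k.1); move: hq2; congr (GA I (_ - _)).
  rewrite -(pair_bigA _ (fun (a : boxT del s) (k : K) => (f k a)%:MP * (monev y a * b k))) /=.
  rewrite exchange_big /=; apply: eq_bigr => k _; rewrite (hf k) // mulr_suml.
  by apply: eq_bigr => a _; rewrite mulrA.
have [M hM'] := choose_fun (fun _ => 0) (fun be (_ : True) => hM be).
have hcard : (#|{: boxT del s * K}| < #|boxT D s.+1|)%N.
  rewrite card_prod !card_boxT expnS.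
  have hdel : (del <= G * D)%N by rewrite mulnDl leq_add ?leq_pmulr // mulnAC.
  have hexp : (del ^ s <= (G * D) ^ s)%N by case: (posnP s) => [->|h]; rewrite ?expn0 // leq_exp2r.
  apply: (@leq_ltn_trans ((G * D) ^ s * #|K|)); first by rewrite leq_mul2r hexp orbT.
  by rewrite expnMn mulnAC ltn_pmul2r ?expn_gt0.
have [c [hc1 hc2]] := elim_fin M hIp hcard.
exists c; split=> //.
have -> : \sum_be (c be)%:MP * monev u be =
   \sum_be (c be)%:MP * (monev u be - \sum_k (M be k)%:MP * (monev y k.1 * b k.2))
   + \sum_k (\sum_be c be * M be k)%:MP * (monev y k.1 * b k.2).
  under [in RHS]eq_bigr do rewrite mulrBr.
  rewrite sumrB -addrA; rewrite [X in _ + X](_ : _ = 0) ?addr0 //.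
  apply/eqP; rewrite addrC subr_eq0; apply/eqP.
  under [RHS]eq_bigr do rewrite mulr_sumr.
  rewrite exchange_big /=; apply: eq_bigr => k _.
  by rewrite raddf_sum /= mulr_suml; apply: eq_bigr => be _; rewrite mpolyCM -mulrA.
constructor; [apply: GA_sum => be _; apply: GA_scale; exact: hM' | apply: GA_sum => k _].
have hmon : GA allB (monev y k.1 * b k.2).
  have hm : YP s del (monev y k.1).
    move: k => [be _] /=; clear -be; elim: s be => [|s' IH] be /=; first by exists 1; rewrite mpolyC1.
    by apply: (@YP_single s') => //; exact: IH.
  have hyy := YP_GA hy hm.
  elim: (hb k.2) => [a _|q1 l _ IH'|q1 r _ IH1 _ IH2].
  - rewrite mulrC; elim: hyy => [a' _|q2 l _ IH'|q2 r _ IH1 _ IH2]; [by rewrite -mpolyCM; constructor | by rewrite mulrA; constructor | by rewrite mulrDr; constructor].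
  - by rewrite mulrA; constructor.
  - by rewrite mulrDr; constructor.
by apply: GA_mul => //; constructor; apply: hc2.
Qed.

End Graded.

Lemma det_trick_morph (Q C : comNzRingType) (psi : {rmorphism Q -> C}) (L : C -> Prop) n (A : 'M[Q]_n) (r : 'I_n -> C) :
  L 0 -> (forall u v, L u -> L v -> L (u + v)) -> (forall a v, L v -> L (psi a * v)) ->
  (forall i, L (\sum_j psi (A i j) * r j)) -> forall k, L (psi (\det A) * r k).
Proof.
move=> L0 LD LZ h k.
have -> : psi (\det A) * r k = \sum_i psi ((\adj A) k i) * \sum_j psi (A i j) * r j.
  under eq_bigr do rewrite mulr_sumr.
  rewrite exchange_big /= (bigD1 k) //= [X in _ + X]big1 ?addr0 => [|j hj].
    under eq_bigr do rewrite mulrA -rmorphM.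
    rewrite -mulr_suml -rmorph_sum; congr (psi _ * _).
    by have := mul_adj_mx A => /matrixP /(_ k k); rewrite !mxE eqxx mulr1n => <-.
  under eq_bigr do rewrite mulrA -rmorphM.
  rewrite -mulr_suml -rmorph_sum.
  have := mul_adj_mx A => /matrixP /(_ k j); rewrite !mxE eq_sym (negbTE hj) mulr0n => ->.
  by rewrite rmorph0 mul0r.
by apply: big_ind => // i _; apply: (LZ).
Qed.

(** * Polynomial towers and Noether normalization of the special fiber *)

Fixpoint tower (R : comNzRingType) (s : nat) : comNzRingType :=
  if s is s'.+1 then {poly tower R s'} : comNzRingType else R.

Fixpoint exts (R : comNzRingType) (m : R -> Prop) (s : nat) : tower R s -> Prop :=
  match s return tower R s -> Prop with
  | 0%N => m
  | s'.+1 => ext (exts m (s := s'))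
  end.

Lemma exts_prime (R : comNzRingType) (m : R -> Prop) s : is_prime m -> is_prime (@exts R m s).
Proof. by move=> hm; elim: s => [|s IH] //=; exact: ext_prime. Qed.

Section Fiber.
Variables (R : comNzRingType) (m : R -> Prop) (e n : nat) (x : 'I_n -> {mpoly R[e]}).
Hypothesis hloc : local_ring m.
Hypothesis xh : forall l, x l \is 1.-homog.
Notation C := {mpoly R[e]}.
Notation A := (GA x (@allB R)).
Notation J := (GA x m).
Let hm := local_ideal hloc.
Let hmp := local_prime hloc.

Lemma A_mul p q : A p -> A q -> A (p * q). Proof. exact: GA_mul. Qed.
Lemma A_add p q : A p -> A q -> A (p + q). Proof. by constructor. Qed.
Lemma A_const c : A c%:MP. Proof. by constructor. Qed.
Lemma A_1 : A 1. Proof. by rewrite -mpolyC1; exact: A_const. Qed.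
Lemma A_0 : A 0. Proof. exact: GA0. Qed.
Lemma A_opp p : A p -> A (- p). Proof. exact: GA_N. Qed.
Lemma A_exp p k : A p -> A (p ^+ k).
Proof. by move=> hp; elim: k => [|k IH]; rewrite ?expr0 ?exprS; [exact: A_1 | exact: A_mul]. Qed.
Lemma J_A p : J p -> A p. Proof. exact: GA_all. Qed.
Lemma J_0 : J 0. Proof. exact: GA0. Qed.
Lemma J_add p q : J p -> J q -> J (p + q). Proof. by constructor. Qed.
Lemma J_mulr p q : J p -> A q -> J (p * q). Proof. exact: GA_mul. Qed.
Lemma J_mull p q : A p -> J q -> J (p * q). Proof. by rewrite mulrC => h1 h2; exact: J_mulr. Qed.
Lemma J_sum (T : Type) (r : seq T) (P : pred T) (F : T -> C) :
  (forall i, P i -> J (F i)) -> J (\sum_(i <- r | P i) F i).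
Proof. exact: GA_sum. Qed.
Fixpoint tev (y : nat -> C) (s : nat) : {rmorphism tower R s -> C} :=
  match s return {rmorphism tower R s -> C} with
  | 0%N => mpolyC e (R := R)
  | s'.+1 => horner_eval (y s') \o map_poly (tev y s')
  end.

Lemma tevE y s (P : tower R s.+1) : tev y s.+1 P = \sum_(j < size P) tev y s P`_j * y s ^+ j.
Proof. by rewrite /= /horner_eval /= /map_poly horner_poly. Qed.

Lemma tevC y s (P : tower R s) : tev y s.+1 (P%:P : tower R s.+1) = tev y s P.
Proof. by rewrite /= /horner_eval /= map_polyC hornerC. Qed.
Lemma tevX y s : tev y s.+1 ('X : tower R s.+1) = y s.
Proof. by rewrite /= /horner_eval /= map_polyX hornerX. Qed.

Lemma tev_A y s P : (forall i, (i < s)%N -> A (y i)) -> A (tev y s P).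
Proof.
elim: s P => [|s IH] P hy; first exact: A_const.
rewrite tevE; apply: big_ind; [exact: A_0 | exact: A_add | move=> j _].
by apply: A_mul; [apply: IH => i hi; apply/hy/ltnW | apply/A_exp/hy].
Qed.

Lemma tev_J y s (P : tower R s) : (forall i, (i < s)%N -> A (y i)) -> exts m P -> J (tev y s P).
Proof.
elim: s P => [|s IH] P hy hP; first exact: GAc.
rewrite tevE; apply: J_sum => j _; apply: J_mulr; last by apply/A_exp/hy.
by apply: IH => // i hi; apply/hy/ltnW.
Qed.

Lemma tev_YP y s (P : tower R s) : exists del, forall del', (del <= del')%N -> YP y s del' (tev y s P).
Proof.
elim: s P => [|s IH] P; first by exists 0%N => d _; exists P.
have [f hf] := choose_fun 0%N (fun j (_ : True) => IH (P`_j)).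
exists (maxn (size P) (\max_(j < size P) f j)) => d; rewrite geq_max => /andP [h1 h2].
rewrite tevE; apply: YP_sum => j _; apply: (@YP_single _ _ y s); first exact: leq_trans (ltn_ord j) h1.
apply: hf => //; apply: leq_trans h2; exact: (leq_bigmax j).
Qed.

Definition By y s (p : C) := exists P, p = tev y s P.

Definition SpB y s (K : finType) (b : K -> C) (p : C) := exists q : K -> C, (forall k, By y s (q k)) /\ J (p - \sum_k q k * b k).

(** A / m A is a finite module over the image of R[y_0, ..., y_(s-1)], generated by b; unlike in
    [VD] no degree is recorded. *)
Definition Fin y s (K : finType) (b : K -> C) := [/\ (forall i, (i < s)%N -> A (y i)), (forall k, A (b k)),
  SpB y s b 1 & forall l k, SpB y s b (x l * b k)].

Lemma Fin_VD y s (K : finType) (b : K -> C) : Fin y s b -> exists del, VD x m y b s del.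
Proof.
move=> [hy hb h1 hx].
have sp p : SpB y s b p -> exists del, forall del', (del <= del')%N -> V x m y b s del' p.
  move=> [q [hq1 hq2]].
  have h k : exists del, forall del', (del <= del')%N -> YP y s del' (q k).
    by have [P ->] := hq1 k; apply: tev_YP.
  have [f hf] := choose_fun 0%N (fun k (_ : True) => h k).
  exists (\max_k f k) => d hd; exists q; split=> // k; apply: hf => //.
  by apply: leq_trans hd; apply: (leq_bigmax k).
have [d1 hd1] := sp _ h1.
have [f hf] := choose_fun 0%N (fun lk (_ : True) => sp _ (hx lk.1 lk.2)).
exists (maxn d1 (\max_lk f lk)); split=> //; first by apply: hd1; exact: leq_maxl.
by move=> l k; apply: (hf (l, k)) => //; apply: leq_trans (leq_maxr _ _); apply: (leq_bigmax (l, k)).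
Qed.

Section Low.
Variables (B' : C -> Prop) (T : C).
Hypotheses (B'c : forall c, B' c%:MP) (B'D : forall p q, B' p -> B' q -> B' (p + q))
  (B'M : forall p q, B' p -> B' q -> B' (p * q)) (B'A : forall p, B' p -> A p) (hT : A T).

Definition Low d (p : C) := exists be : nat -> C, (forall j, B' (be j)) /\ J (p - \sum_(j < d) be j * T ^+ j).

Lemma B'0 : B' 0. Proof. by rewrite -mpolyC0. Qed.

Lemma LowJ d p : J p -> Low d p.
Proof.
exists (fun _ => 0); split=> [_|]; first exact: B'0.
by rewrite big1 ?subr0 // => j _; rewrite mul0r.
Qed.
Lemma LowD d p q : Low d p -> Low d q -> Low d (p + q).
Proof.
move=> [f [hf1 hf2]] [g [hg1 hg2]]; exists (fun j => f j + g j); split; first by move=> j; apply: B'D.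
under eq_bigr do rewrite mulrDl.
by rewrite big_split /= opprD addrACA; apply: J_add.
Qed.
Lemma LowB d b p : B' b -> Low d p -> Low d (b * p).
Proof.
move=> hb [f [hf1 hf2]]; exists (fun j => b * f j); split; first by move=> j; apply: B'M.
under eq_bigr do rewrite -mulrA.
by rewrite -mulr_sumr -mulrBr; apply: J_mull => //; apply: B'A.
Qed.
Lemma Low0 d : Low d 0. Proof. exact/LowJ/J_0. Qed.
Lemma Low_sum d (I : Type) (r : seq I) (P : pred I) (F : I -> C) :
  (forall i, P i -> Low d (F i)) -> Low d (\sum_(i <- r | P i) F i).
Proof. by move=> h; apply: big_ind => //; [exact: Low0 | exact: LowD]. Qed.
Lemma Low_single d b j : B' b -> (j < d)%N -> Low d (b * T ^+ j).
Proof.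
move=> hb hj; exists (fun i => if i == j then b else 0); split.
  by move=> i; case: ifP => _ //; exact: B'0.
rewrite (bigD1 (Ordinal hj)) //= eqxx big1 ?addr0 ?subrr; first exact: J_0.
by move=> i hi; case: eqP => e1; [case/eqP: hi; apply: val_inj | rewrite mul0r].
Qed.
Lemma Low_mod d p q : Low d p -> J (q - p) -> Low d q.
Proof. by move=> hp hq; rewrite -(subrK p q); apply: LowD => //; exact: LowJ. Qed.
Lemma LowT d k p : Low d p -> Low (d + k) (p * T ^+ k).
Proof.
move=> [f [hf1 hf2]]; apply: (Low_mod (p := (\sum_(j < d) f j * T ^+ j) * T ^+ k)).
  rewrite mulr_suml; apply: Low_sum => j _; rewrite -mulrA -exprD; apply: Low_single => //.
  by rewrite ltn_add2r.
by rewrite -mulrBl; apply: J_mulr => //; exact: A_exp.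
Qed.
Lemma Low_le d d' p : (d <= d')%N -> Low d p -> Low d' p.
Proof.
move=> hd [f [hf1 hf2]]; apply: Low_mod hf2; apply: Low_sum => j _; apply: Low_single => //.
exact: leq_trans hd.
Qed.

Lemma Lead_mul d c p N b : (0 < N)%N -> B' b -> Low d (p - c%:MP * T ^+ d) ->
  Low (d + N) (p * (b + T ^+ N) - c%:MP * T ^+ (d + N)).
Proof.
move=> hN hb h.
have -> : p * (b + T ^+ N) - c%:MP * T ^+ (d + N) =
   (p - c%:MP * T ^+ d) * T ^+ N + b * (p - c%:MP * T ^+ d) + (b * c%:MP) * T ^+ d.
  by rewrite exprD; ring.
apply: LowD; first apply: LowD.
- exact: LowT.
- by apply: LowB => //; apply: Low_le h; exact: leq_addr.
- by apply: Low_single; [exact: B'M | rewrite -addn1 leq_add2l].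
Qed.

Lemma Lead_exp d c p N Y j : (0 < N)%N -> B' (Y - T ^+ N) -> Low d (p - c%:MP * T ^+ d) ->
  Low (d + j * N) (p * Y ^+ j - c%:MP * T ^+ (d + j * N)).
Proof.
move=> hN hb h; elim: j => [|j IH]; first by rewrite mul0n addn0 mulr1.
have := Lead_mul hN hb IH; rewrite subrK.
by rewrite -mulrA -exprSr -addnA -[(j * N + N)%N]addnC -mulSn.
Qed.
End Low.

(* Nagata's trick: after y_i := y'_i + T^(M^i) the weights of the monomials of P become distinct. *)
Lemma nagata s (P : tower R s.+1) : ~ exts m P -> exists M0, forall M, (M0 <= M)%N -> (0 < M)%N ->
  exists d c0, [/\ ~ m c0, (d < M ^ s.+1)%N &
    forall (B' : C -> Prop) (T : C) (y : nat -> C), (forall c, B' c%:MP) ->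
      (forall p q, B' p -> B' q -> B' (p + q)) -> (forall p q, B' p -> B' q -> B' (p * q)) ->
      (forall p, B' p -> A p) -> A T -> (forall i, A (y i)) -> y 0%N = T ->
      (forall i, (i < s)%N -> B' (y i.+1 - T ^+ (M ^ i.+1))) ->
      Low B' T d (tev y s.+1 P - c0%:MP * T ^+ d)].
Proof.
elim: s P => [|s IH] P hP.
  have [j0 hj0] := not_forall hP.
  have hb k : ~ m (P : {poly R})`_k -> (k <= size (P : {poly R}))%N.
    by move=> h; rewrite leqNgt; apply/negP => h2; apply: h; rewrite nth_default ?(ltnW h2) //; exact: id0.
  have [d [hd1 hd2]] := nat_max (ex_intro (fun k => ~ m (P : {poly R})`_k) j0 hj0) hb.
  exists (size (P : {poly R})).+1 => M hM _; exists d, (P : {poly R})`_d; split=> //.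
    by rewrite expn1; apply: leq_trans hM; rewrite ltnS; apply: hb.
  move=> B' T y Bc BD BM BA hT hyA hy0 _; rewrite tevE hy0.
  have hds : (d < size (P : {poly R}))%N.
    by rewrite ltnNge; apply/negP => h; apply: hd1; rewrite nth_default //; exact: id0.
  rewrite (bigD1 (Ordinal hds)) //= addrAC subrr add0r; apply: Low_sum => // j hj.
  case: (ltngtP j d) => hjd.
  - exact: Low_single.
  - apply: LowJ => //; apply: J_mulr; last exact: A_exp.
    by constructor; apply: nnpp => h; move: (hd2 _ h); rewrite leqNgt hjd.
  - by case/eqP: hj; apply: val_inj.
have [j0 hj0] := not_forall hP.
have hmz : is_ideal (@exts R m s.+1) by apply/prime_ideal/exts_prime.
have hb k : ~ exts m (s := s.+1) (P : {poly tower R s.+1})`_k -> (k <= size (P : {poly tower R s.+1}))%N.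
  by move=> h; rewrite leqNgt; apply/negP => h2; apply: h; rewrite nth_default ?(ltnW h2) //; exact: id0.
have [d [hd1 hd2]] := nat_max (ex_intro (fun k => ~ exts m (s := s.+1) (P : {poly tower R s.+1})`_k) j0 hj0) hb.
have [f hf] := choose_fun 0%N (Q := fun j => ~ exts m (s := s.+1) (P : {poly tower R s.+1})`_j) (fun j h => IH _ h).
set sz := size (P : {poly tower R s.+1}) in hb.
exists (maxn sz.+1 (\max_(j < sz.+1) f j)) => M; rewrite geq_max => /andP [hM1 hM2] hM.
have hfM (j : 'I_sz.+1) : (f j <= M)%N by apply: leq_trans hM2; apply: (leq_bigmax j).
have hdsz : (d < sz.+1)%N by rewrite ltnS; apply: hb.
have hQ (j : 'I_sz.+1) := fun h => hf j h M (hfM j) hM.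
have [dd [c0 [hc0 hdd hlead]]] := hQ (Ordinal hdsz) hd1.
exists (dd + d * M ^ s.+1)%N, c0; split=> //.
  rewrite [X in (_ < X)%N]expnS; apply: (@leq_trans (d.+1 * M ^ s.+1)); first by rewrite mulSn ltn_add2r.
  by rewrite leq_mul2r (leq_trans hdsz) ?orbT.
move=> B' T y Bc BD BM BA hT hyA hy0 hyB; rewrite tevE.
have hMs : (0 < M ^ s.+1)%N by rewrite expn_gt0 hM.
have hYB : B' (y s.+1 - T ^+ (M ^ s.+1)) by apply: hyB.
have hyB' i : (i < s)%N -> B' (y i.+1 - T ^+ (M ^ i.+1)) by move=> hi; apply/hyB/ltnW.
have hds : (d < sz)%N.
  rewrite ltnNge; apply/negP => h; apply: hd1; rewrite nth_default //; exact: id0.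
rewrite -/sz (bigD1 (Ordinal hds)) //= addrAC; apply: LowD => //.
  by apply: Lead_exp => //; apply: hlead.
apply: Low_sum => // j hj.
case: (lem (exts m (s := s.+1) (P : {poly tower R s.+1})`_j)) => hPj.
  by apply: LowJ => //; apply: J_mulr; [apply: (@tev_J y s.+1) | exact: A_exp].
have hjd : (j < d)%N by rewrite ltn_neqAle hd2 // andbT -val_eqE /= in hj *.
have [dj [cj [hcj hdj hlj]]] := hQ (widen_ord (leqnSn _) j) hPj.
have h2 := Lead_exp Bc BD BM BA hT j hMs hYB (hlj B' T y Bc BD BM BA hT hyA hy0 hyB').
(* Weights behave like numbers in base M ^ s.+1: a smaller exponent of the outermost variable cannot
   be made up for by dj, which is below M ^ s.+1. *)
have hlt : (dj + j * M ^ s.+1 < dd + d * M ^ s.+1)%N.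
  apply: (@leq_trans (d * M ^ s.+1)); last exact: leq_addl.
  apply: (@leq_trans (j.+1 * M ^ s.+1)); first by rewrite mulSn ltn_add2r.
  by rewrite leq_mul2r hjd orbT.
rewrite -(subrK (cj%:MP * T ^+ (dj + j * M ^ s.+1)) (_ * y s.+1 ^+ j)); apply: LowD => //.
  by apply: Low_le h2 => //; exact: ltnW.
exact: Low_single.
Qed.

Lemma By_closed y s : (forall i, (i < s)%N -> A (y i)) -> [/\ (forall c, By y s c%:MP),
  (forall p q, By y s p -> By y s q -> By y s (p + q)),
  (forall p q, By y s p -> By y s q -> By y s (p * q)) & forall p, By y s p -> A p].
Proof.
move=> hy; split.
- move=> c; elim: s {hy} => [|s [P IH]]; first by exists c.
  by exists (P%:P : tower R s.+1); rewrite tevC.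
- by move=> _ _ [P ->] [Q ->]; exists (P + Q); rewrite rmorphD.
- by move=> _ _ [P ->] [Q ->]; exists (P * Q); rewrite rmorphM.
- by move=> _ [P ->]; apply: tev_A.
Qed.

Lemma By_var y s i : (i < s)%N -> By y s (y i).
Proof.
elim: s => // s IH; rewrite ltnS leq_eqVlt => /orP [/eqP ->|/IH [P ->]].
  by exists ('X : tower R s.+1); rewrite tevX.
by exists (P%:P : tower R s.+1); rewrite tevC.
Qed.

(** After the substitution the relation is monic in T up to a unit of R, so T is integral over R[y']
    modulo m A; the powers of T below the degree, times the old generators, span. *)
Lemma nagata_step y s (K : finType) (b : K -> C) (P : tower R s.+1) : Fin y s.+1 b -> ~ exts m P ->
  J (tev y s.+1 P) -> exists y' (K' : finType) (b' : K' -> C), Fin y' s b'.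
Proof.
move=> [hy0 hb h1 hx] hP hJ.
(* Out of range the value is zero, so that all values lie in A as [nagata] requires. *)
pose yy i := if (i < s.+1)%N then y i else 0.
have etev t (Q : tower R t) : (t <= s.+1)%N -> tev yy t Q = tev y t Q.
  elim: t Q => [|t IH] Q ht //; rewrite !tevE; apply: eq_bigr => j _.
  by rewrite IH ?(ltnW ht) // /yy ht.
have hyy i : A (yy i) by rewrite /yy; case: ifP => // [/hy0|_] //; exact: A_0.
have [M0 hM0] := nagata hP.
pose M := M0.+1.
have [d [c0 [hc0 _ hlead]]] := hM0 M (leqnSn _) (ltn0Sn _).
pose T := yy 0%N; pose y' i := yy i.+1 - T ^+ (M ^ i.+1).
have hT : A T by exact: hyy.
have hy' i : A (y' i) by apply: A_add; [exact: hyy | apply/A_opp/A_exp].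
have [Bc BD BM BA] := @By_closed y' s (fun i _ => hy' i).
have hl := hlead (By y' s) T yy Bc BD BM BA hT hyy erefl (fun i hi => By_var y' hi).
have hJ' : J (tev yy s.+1 P) by rewrite etev.
have [c1 hc1] := local_unit hloc hc0.
have LTd : Low (By y' s) T d (T ^+ d).
  have -> : T ^+ d = c1%:MP * (tev yy s.+1 P + (-1)%:MP * (tev yy s.+1 P - c0%:MP * T ^+ d)).
    rewrite mpolyCN mpolyC1 mulN1r opprB addrCA subrr addr0 mulrA -mpolyCM [c1 * c0]mulrC hc1.
    by rewrite mpolyC1 mul1r.
  apply: LowB => //; apply: LowD => //; first exact: LowJ.
  exact: LowB.
have Lmul p : Low (By y' s) T d p -> Low (By y' s) T d (p * T).
  move=> [f [hf1 hf2]].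
  apply: (Low_mod Bc BD (p := (\sum_(j < d) f j * T ^+ j) * T)); last first.
    by rewrite -mulrBl; apply: J_mulr.
  rewrite mulr_suml; apply: Low_sum => // j _; rewrite -mulrA -exprSr.
  have := ltn_ord j; rewrite leq_eqVlt => /orP [/eqP ->|h]; last exact: Low_single.
  exact: LowB.
have LmulX p k : Low (By y' s) T d p -> Low (By y' s) T d (p * T ^+ k).
  move=> hp; elim: k => [|k IH]; first by rewrite mulr1.
  by rewrite exprSr mulrA; apply: Lmul.
have Lone : Low (By y' s) T d 1.
  case: d {hlead hl LmulX Lmul} LTd => [|d] LTd; first by move: LTd; rewrite expr0.
  rewrite -mpolyC1 -[_%:MP]mulr1 -(expr0 T); exact: Low_single.
have Lyy i p : (i < s.+1)%N -> Low (By y' s) T d p -> Low (By y' s) T d (p * yy i).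
  case: i => [|i] hi hp; first exact: Lmul.
  have -> : yy i.+1 = y' i + T ^+ (M ^ i.+1) by rewrite subrK.
  rewrite mulrDr; apply: LowD => //; last exact: LmulX.
  by rewrite mulrC; apply: LowB => //; apply: By_var.
have Ltev t (Q : tower R t) p : (t <= s.+1)%N -> Low (By y' s) T d p -> Low (By y' s) T d (tev yy t Q * p).
  elim: t Q p => [|t IH] Q p ht hp; first by apply: LowB => //; exact: (Bc Q).
  rewrite tevE mulr_suml; apply: Low_sum => // j _.
  rewrite -mulrA; apply: IH; first exact: ltnW.
  elim: (nat_of_ord j) => [|k IHk]; first by rewrite mul1r.
  by rewrite exprSr mulrAC; apply: Lyy.
have LBy q : By y s.+1 q -> Low (By y' s) T d q.
  by move=> [Q ->]; rewrite -etev // -[tev _ _ _]mulr1; apply: Ltev.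
have key p : SpB y s.+1 b p -> forall i, SpB y' s (fun jk : 'I_d * K => T ^+ jk.1 * b jk.2) (T ^+ i * p).
  move=> [q [hq1 hq2]] i.
  have h k : exists be : nat -> C, (forall j, By y' s (be j)) /\ J (q k * T ^+ i - \sum_(j < d) be j * T ^+ j).
    by apply/LmulX/LBy.
  have [f hf] := choose_fun (fun _ => 0) (fun k (_ : True) => h k).
  exists (fun jk : 'I_d * K => f jk.2 jk.1); split; first by move=> [j k]; have [h3 _] := hf k I; exact: h3.
  rewrite -(pair_bigA _ (fun (j : 'I_d) (k : K) => f k j * (T ^+ j * b k))) /= exchange_big /=.
  have -> : T ^+ i * p - \sum_k \sum_(j < d) f k j * (T ^+ j * b k) =
     T ^+ i * (p - \sum_k q k * b k) + \sum_k (q k * T ^+ i - \sum_(j < d) f k j * T ^+ j) * b k.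
    rewrite mulrBr mulr_sumr -addrA; congr (_ + _).
    rewrite -!sumrN -big_split /=; apply: eq_bigr => k _.
    rewrite mulrBl mulr_suml [T ^+ i * (q k * b k)]mulrCA mulrA addKr.
    by congr (- _); apply: eq_bigr => j _; rewrite mulrA.
  apply: J_add; first by apply: J_mull => //; exact: A_exp.
  by apply: J_sum => k _; apply: J_mulr => //; have [_] := hf k I.
exists y', (('I_d * K)%type : finType), (fun jk : 'I_d * K => T ^+ jk.1 * b jk.2); split.
- by move=> i _; exact: hy'.
- by move=> jk; apply: A_mul => //; exact: A_exp.
- by have := key _ h1 0%N; rewrite mul1r.
- by move=> l [j k] /=; rewrite mulrCA; apply: key.
Qed.

End Fiber.

(** * Dimension of the special fiber *)

Section GoingUp.
Variables (R : comNzRingType) (m : R -> Prop) (e n : nat) (x : 'I_n -> {mpoly R[e]}).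
Hypothesis hloc : local_ring m.
Hypothesis xh : forall l, x l \is 1.-homog.
Notation C := {mpoly R[e]}.
Notation A := (GA x (@allB R)).
Notation J := (GA x m).
Let hm := local_ideal hloc.
Let hmp := local_prime hloc.

(** The prime generated by m and the i outermost variables. For i up to s these form a strict chain,
    to be lifted to A; [vr i s] separates two consecutive members. *)
Fixpoint qq (i s : nat) {struct i} : tower R s -> Prop :=
  match i with
  | 0%N => @exts R m s
  | i'.+1 => match s return tower R s -> Prop with
             | 0%N => m
             | s'.+1 => fun P => @qq i' s' (P : {poly tower R s'})`_0
             end
  end.

Fixpoint vr (i s : nat) {struct s} : tower R s :=
  match s return tower R s with
  | 0%N => 0
  | s'.+1 => if i is i'.+1 then ((vr i' s')%:P : {poly tower R s'}) else ('X : {poly tower R s'})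
  end.

Lemma qq_prime i s : is_prime (@qq i s).
Proof.
elim: i s => [|i IH] s /=; first exact: exts_prime.
case: s => [|s] //; have hp := IH s; have hpi := prime_ideal hp; apply: mk_prime.
- split; first by rewrite coef0; apply: id0.
  split=> [p q hp1 hq1|p q hq1]; first by rewrite coefD; apply: idD.
  by rewrite coef0M; apply: idM.
- by rewrite coef1; apply: prime1.
- by move=> p q; rewrite coef0M; apply: primeM.
Qed.

Lemma qq_mono i s P : @qq i s P -> @qq i.+1 s P.
Proof.
elim: i s P => [|i IH] s; case: s => [|s] P.
- by [].
- by move=> h; exact: (h 0%N).
- by [].
- exact: (IH s (P : {poly tower R s})`_0).
Qed.

Lemma qq_vr i s : (i < s)%N -> @qq i.+1 s (vr i s).
Proof.
elim: i s => [|i IH] [|s] //= hi.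
  by rewrite coefX; exact: (id0 (prime_ideal (@qq_prime 0 s))).
by rewrite coefC; exact: IH.
Qed.

Lemma qq_vr_not i s : (i < s)%N -> ~ @qq i s (vr i s).
Proof.
elim: i s => [|i IH] [|s] // hi h.
  by apply: (prime1 (@exts_prime R m s hmp)); have := h 1%N; rewrite coefX.
by apply: (IH s hi); move: h; rewrite /= coefC.
Qed.

Variables (y : nat -> C) (s : nat) (K : finType) (b : K -> C).
Hypothesis hF : Fin m x y s b.
Hypothesis hind : forall P : tower R s, J (tev y s P) -> exts m P.
Let hy : forall i, (i < s)%N -> A (y i). Proof. by case: hF. Qed.
Let hb : forall k, A (b k). Proof. by case: hF. Qed.

Lemma SpB_A a k : A a -> SpB m x y s b (a * b k).
Proof.
have [_ _ _ hx] := hF; have [Bc BD BM BA] := By_closed (x := x) hy.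
have spD p q : SpB m x y s b p -> SpB m x y s b q -> SpB m x y s b (p + q).
  move=> [f [hf1 hf2]] [g [hg1 hg2]]; exists (fun k => f k + g k); split; first by move=> j; apply: (BD).
  under eq_bigr do rewrite mulrDl.
  by rewrite big_split /= opprD addrACA; apply: J_add.
have spB c p : By y s c -> SpB m x y s b p -> SpB m x y s b (c * p).
  move=> hc [f [hf1 hf2]]; exists (fun k => c * f k); split; first by move=> j; apply: (BM).
  under eq_bigr do rewrite -mulrA.
  by rewrite -mulr_sumr -mulrBr; apply: (J_mull hloc) => //; apply: (BA).
have sp0 : SpB m x y s b 0.
  exists (fun _ => 0); split; first by move=> j; rewrite -mpolyC0.
  by rewrite big1 ?subr0; [exact: J_0 | move=> j _; rewrite mul0r].
have sp1 j : SpB m x y s b (b j).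
  exists (fun i => (i == j)%:R); split.
    by move=> i; case: (i == j); [have := Bc 1; rewrite mpolyC1 | have := Bc 0; rewrite mpolyC0].
  rewrite (bigD1 j) //= eqxx mul1r big1 ?addr0 ?subrr; first exact: J_0.
  by move=> i /negbTE ->; rewrite mul0r.
have spJ p q : SpB m x y s b p -> J (q - p) -> SpB m x y s b q.
  move=> [f [hf1 hf2]] h; exists f; split=> //.
  by rewrite -(subrK p q) -addrA; apply: J_add.
move=> ha; elim: ha k => [c _|p l hp IH|p q _ IH1 _ IH2] k.
- exact: (spB).
- have [f [hf1 hf2]] := hx l k.
  apply: (spJ (\sum_j f j * (p * b j))).
    by apply: (big_ind (SpB m x y s b)) => // j _; apply: (spB); [exact: hf1 | exact: IH].
  have -> : p * x l * b k - \sum_j f j * (p * b j) = p * (x l * b k - \sum_j f j * b j).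
    rewrite mulrBr mulrA mulr_sumr; congr (_ - _); apply: eq_bigr => j _; by rewrite mulrCA.
  exact: (J_mull hloc).
- by rewrite mulrDl; apply: (spD).
Qed.

(** The characteristic polynomial of multiplication by a on the generators b, modulo m A,
    annihilates the generators and therefore 1. *)
Lemma cayley a : A a -> exists chi : {poly tower R s}, chi \is monic /\ J (map_poly (tev y s) chi).[a].
Proof.
move=> ha; have [_ _ [q1 [hq1 hq2]] _] := hF.
pose t := #|K|; pose b' (j : 'I_t) := b (enum_val j).
have h (j : 'I_t) : exists N : 'I_t -> tower R s, J (a * b' j - \sum_k tev y s (N k) * b' k).
  have [q [hqa hqb]] := SpB_A (enum_val j) ha.
  have [N hN] := choose_fun 0 (fun k (_ : True) => hqa k).
  exists (fun k => N (enum_val k)); move: hqb; congr (GA x m (_ - _)).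
  rewrite (reindex (@enum_val K predT)) /=; last exact/onW_bij/enum_val_bij.
  by apply: eq_bigr => k _; rewrite -hN.
have [N hN] := choose_fun (fun _ => 0) (fun j (_ : True) => h j).
pose M : 'M[tower R s]_t := \matrix_(j, k) N j k.
exists (char_poly M); split; first exact: char_poly_monic.
pose psi : {rmorphism {poly tower R s} -> C} := horner_eval a \o map_poly (tev y s).
have psiA f : A (psi f).
  rewrite /= /horner_eval horner_coef; apply: big_ind; [exact: A_0|exact: A_add|move=> i _].
  by rewrite coef_map; apply: A_mul; [exact: tev_A | exact: A_exp].
have hk k : J (psi (char_poly M) * b' k).
  apply: det_trick_morph; [exact: J_0|exact: J_add| |].
    by move=> f v hv; apply: (J_mull hloc).
  move=> i; have := hN i I; congr J.
  transitivity (\sum_k (a *+ (i == k) - tev y s (N i k)) * b' k); last first.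
    apply: eq_bigr => k0 _; congr (_ * _).
    by rewrite !mxE /= rmorphB /= rmorphMn /= map_polyX map_polyC /horner_eval hornerD hornerN hornerMn hornerX hornerC.
  under [RHS]eq_bigr do rewrite mulrBl.
  rewrite sumrB; congr (_ - _); rewrite (bigD1 i) //= eqxx big1 ?addr0 // => k0.
  by rewrite eq_sym => /negbTE ->; rewrite mul0r.
have -> : (map_poly (tev y s) (char_poly M)).[a] =
   psi (char_poly M) * (1 - \sum_k q1 k * b k) + \sum_k q1 k * (psi (char_poly M) * b k).
  rewrite mulrBr mulr1 mulr_sumr -[LHS](subrK (\sum_k psi (char_poly M) * (q1 k * b k))); congr (_ - _ + _).
  by apply: eq_bigr => k _; rewrite mulrCA.
apply: J_add; first exact: (J_mull hloc).
have [_ _ _ BA] := By_closed (x := x) hy.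
apply: J_sum => // k _; apply: (J_mull hloc); first exact: BA.
by have := hk (enum_rank k); rewrite /b' enum_rankK.
Qed.

(** The new prime must contain P0 and u and avoid the image of the complement of [qq i.+1]. If the
    image of Q were p0 + u a, the integral equation of a, homogenized with powers of [vr i s], would
    put a power of Q into [qq i.+1]. *)
Lemma going_up_step i (P0 : C -> Prop) : (i < s)%N -> sub_prime A P0 -> (forall p, J p -> P0 p) ->
  (forall Q : tower R s, P0 (tev y s Q) -> qq i Q) ->
  exists P1, [/\ sub_prime A P1, (forall p, P0 p -> P1 p), P1 (tev y s (vr i s)) &
     forall Q : tower R s, P1 (tev y s Q) -> qq i.+1 Q].
Proof.
move=> hi [PA [PZ [PD [PM [P1n PP]]]]] hJP hq.
have [Bc BD BM BA] := By_closed (x := x) hy.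
pose u := tev y s (vr i s).
have hu : A u by exact: tev_A.
have PN p : P0 p -> P0 (- p) by move=> hp; rewrite -mulN1r; apply: (PM) => //; apply/A_opp/A_1.
have qp := @qq_prime i.+1 s; have qi := prime_ideal qp.
have [|||||||||||P1 [h1 [h2 h3]]] := @prime_avoiding C A (fun p => exists p0 a, [/\ P0 p0, A a & p = p0 + u * a])
   (fun p => exists Q, ~ qq i.+1 Q /\ p = tev y s Q).
- exact: A_0.
- exact: A_1.
- exact: A_add.
- exact: A_mul.
- by move=> _ [p0 [a [h1 h2 ->]]]; apply: A_add; [exact: PA | exact: A_mul].
- by exists 0, 0; rewrite mulr0 addr0; split=> //; exact: A_0.
- move=> _ _ [p0 [a [h1 h2 ->]]] [p1 [a' [h1' h2' ->]]]; exists (p0 + p1), (a + a').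
  by rewrite mulrDr addrACA; split; [exact: (PD)|exact: A_add|].
- move=> c _ hc [p0 [a [h1 h2 ->]]]; exists (c * p0), (c * a).
  by rewrite mulrDr mulrCA; split; [exact: (PM)|exact: A_mul|].
- by exists 1; split; [exact: (prime1 qp) | rewrite rmorph1].
- by move=> _ _ [Q [hQ ->]] [Q' [hQ' ->]]; exists (Q * Q'); rewrite rmorphM; split=> //; exact: primeNM.
- move=> _ [p0 [a [hp0 ha ->]]] [Q [hQ eQ]]; apply: hQ.
  have [chi [hmon hchi]] := cayley ha.
  pose t := (size chi).-1.
  have esz : size chi = t.+1.
    by rewrite prednK // size_poly_gt0 monic_neq0.
  have eua k : P0 ((u * a) ^+ k - tev y s Q ^+ k).
    elim: k => [|k IH]; first by rewrite subrr.
    have -> : (u * a) ^+ k.+1 - tev y s Q ^+ k.+1 =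
       (u * a) * ((u * a) ^+ k - tev y s Q ^+ k) + tev y s Q ^+ k * (- p0).
      by rewrite !exprS -eQ; ring.
    by apply: (PD); apply: (PM) => //; [exact: A_mul|apply/A_exp/tev_A|exact: PN].
  have hsum : P0 (tev y s (\sum_(j < t.+1) chi`_j * vr i s ^+ (t - j) * Q ^+ j)).
    rewrite rmorph_sum.
    have -> : \sum_(j < t.+1) tev y s (chi`_j * vr i s ^+ (t - j) * Q ^+ j) =
       u ^+ t * (map_poly (tev y s) chi).[a] +
       \sum_(j < t.+1) (tev y s chi`_j * u ^+ (t - j)) * (- ((u * a) ^+ j - tev y s Q ^+ j)).
      rewrite (horner_coef_wide _ (n := t.+1)); last by rewrite -esz; exact: size_poly.
      rewrite mulr_sumr -big_split /=; apply: eq_bigr => j _.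
      rewrite coef_map !rmorphM !rmorphXn -/u.
      have -> : u ^+ t = u ^+ (t - j) * u ^+ j by rewrite -exprD subnK // -ltnS.
      have key (S : comNzRingType) (c w q v d : S) : c * w * q = w * v * (c * d) + c * w * (- (v * d - q)) by ring.
      by rewrite exprMn; exact: key.
    apply: (PD); first by apply/hJP/(J_mull hloc) => //; exact: A_exp.
    apply: (big_ind P0) => // j _; apply: (PM); last exact: PN.
    by apply: A_mul; [exact: tev_A | exact: A_exp].
  have := qq_mono (hq _ hsum); rewrite big_ord_recr /= subnn mulr1.
  have -> : chi`_t = 1 by have := monicP hmon; rewrite lead_coefE.
  rewrite mul1r => h; apply: (primeX qp (n := t)).
  rewrite -[X in qq i.+1 X](addKr (\sum_(j < t) chi`_j * vr i s ^+ (t - j) * Q ^+ j)) addrC.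
  apply: (idB qi) => //; apply: id_sum => // j _.
  apply: idMr => //; apply: idM => //.
  have -> : (t - j = (t - j).-1.+1)%N by rewrite prednK // subn_gt0.
  by rewrite exprS; apply: idMr => //; exact: qq_vr.
exists P1; split=> //.
- by move=> p hp; apply: h2; exists p, 0; rewrite mulr0 addr0; split=> //; exact: A_0.
- by apply: h2; exists 0, 1; rewrite mulr1 add0r; split=> //; exact: A_1.
- by move=> Q hQ; apply: nnpp => hn; apply: (h3 (tev y s Q)) => //; exists Q.
Qed.

Lemma fiber_chain : exists P, prime_chain A (fun p => exists c, m c /\ p = c%:MP) s P.
Proof.
suff h i : (i <= s)%N -> exists P, prime_chain A J i P /\ forall Q : tower R s, P i (tev y s Q) -> qq i Q.
  have [P [[h1 h2] _]] := h s (leqnn s); exists P; split=> // i hi; have [h3 h4] := h1 i hi.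
  by split=> // p [c [hc ->]]; apply: h4; constructor.
elim: i => [|i IH] hi.
  have [|||||||||||P1 [h1 [h2 h3]]] := @prime_avoiding C A J (fun p => exists Q, ~ exts m Q /\ p = tev y s Q).
  - exact: A_0.
  - exact: A_1.
  - exact: A_add.
  - exact: A_mul.
  - exact: J_A.
  - exact: J_0.
  - exact: J_add.
  - move=> a p; exact: (J_mull hloc).
  - by exists 1; split; [exact: (prime1 (exts_prime s hmp)) | rewrite rmorph1].
  - move=> _ _ [Q [hQ ->]] [Q' [hQ' ->]]; exists (Q * Q'); rewrite rmorphM; split=> //.
    exact: (primeNM (exts_prime s hmp)).
  - by move=> p hp [Q [hQ eQ]]; apply: hQ; apply: hind; rewrite -eQ.
  exists (fun _ => P1); split; first by split.
  by move=> Q hQ /=; apply: nnpp => hn; apply: (h3 (tev y s Q)) => //; exists Q.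
have [P [[h1 h2] hq]] := IH (ltnW hi).
have [hp hJP] := h1 i (leqnn i).
have [P1 [g1 g2 g3 g4]] := going_up_step hi hp hJP hq.
exists (fun k => if (k <= i)%N then P k else P1); split; last by rewrite ltnn.
split=> k hk.
  case: ifP => hki; first exact: h1.
  by split=> // p /hJP; exact: g2.
have : (k == i) || (k < i)%N by rewrite -leq_eqVlt -ltnS.
case/orP => [/eqP ->|hki]; last by rewrite (ltnW hki) hki; exact: h2.
rewrite leqnn ltnn; split=> //; exists (tev y s (vr i s)); split=> //.
by move=> /hq; exact: qq_vr_not.
Qed.

End GoingUp.

Section Spread.
Variables (R : comNzRingType) (m : R -> Prop) (e n : nat) (x : 'I_n -> {mpoly R[e]}).
Hypothesis hloc : local_ring m.
Hypothesis xh : forall l, x l \is 1.-homog.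
Notation C := {mpoly R[e]}.
Notation A := (GA x (@allB R)).
Notation J := (GA x m).
Let hm := local_ideal hloc.
Let hmp := local_prime hloc.

Lemma Fin_start : Fin m x (fun i => oapp x 0 (insub i)) n (fun _ : unit => 1).
Proof.
have hA i : (i < n)%N -> A (oapp x 0 (insub i)).
  move=> hi; rewrite insubT /= -[x _]mul1r; constructor; exact: A_1.
have [Bc BD BM BA] := By_closed (x := x) hA.
split=> //; first by move=> _; exact: A_1.
  exists (fun _ => 1); split; first by move=> _; rewrite -mpolyC1.
  by rewrite (big_pred1 tt) ?mulr1 ?subrr; [exact: J_0 | case].
move=> l _; exists (fun _ => x l); split.
  by move=> _; have := By_var (fun i => oapp x 0 (insub i)) (ltn_ord l); rewrite valK.
by rewrite (big_pred1 tt) ?subrr; [exact: J_0 | case].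
Qed.

(** Elements from the successive differences of a chain of primes are algebraically independent
    modulo m. The last one lies in [P 1] but not in [P 0]: its lowest power with a coefficient not
    in m can be divided out, which leaves a relation modulo [P 1] in one element less. *)
Lemma lowest N (P : nat -> C -> Prop) (u : nat -> C) D (c : boxT D N -> R) :
  (forall j, (j <= N)%N -> sub_prime A (P j)) -> (forall j p, (j < N)%N -> P j p -> P j.+1 p) ->
  (forall p, J p -> P 0%N p) -> (forall i, (i < N)%N -> A (u i)) ->
  (forall i, (i < N)%N -> P (N - i)%N (u i)) -> (forall i, (i < N)%N -> ~ P (N - i.+1)%N (u i)) ->
  P 0%N (\sum_be (c be)%:MP * monev u be) -> forall be, m (c be).
Proof.
elim: N P c => [|N IH] P c hp hle hJ hA hu hun hs.
  case; apply: nnpp => hn; have [c' hc'] := local_unit hloc hn.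
  have [_ [_ [_ [PM [P1n _]]]]] := hp 0%N (leqnn _); apply: P1n.
  rewrite -mpolyC1 -hc' mulrC mpolyCM; apply: (PM); first exact: A_const.
  by move: hs; rewrite (big_pred1 tt) ?mulr1 //; case.
apply: nnpp => hno; have [[be1 j1] hbe] := not_forall hno.
pose bad j := exists h : (j < D)%N, exists be, ~ m (c (be, Ordinal h)).
have [j0 [[hj0 [be0 hb0]] hmin]] : exists j, bad j /\ forall k, bad k -> (j <= k)%N.
  apply: nat_min; exists j1, (ltn_ord j1), be1; move: hbe; congr (~ m (c (_, _))); exact: val_inj.
pose S (j : 'I_D) := \sum_be (c (be, j))%:MP * monev u be.
have hAm D' N' (be : boxT D' N') : (N' <= N)%N -> A (monev u be).
  elim: N' be => [|N' IHN'] be hN'; first exact: A_1.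
  apply: A_mul; first by apply: IHN'; exact: ltnW.
  apply: A_exp; apply: hA; exact: ltnW.
have hSA j : A (S j).
  apply: big_ind; [exact: A_0|exact: A_add|move=> be _]; apply: A_mul; [exact: A_const | exact: hAm].
have hSJ (j : 'I_D) : (j < j0)%N -> J (S j).
  move=> hj; apply: (J_sum hloc) => // be _; apply: (J_mulr hloc); last exact: hAm.
  constructor; apply: nnpp => hn; have : bad j.
    by exists (ltn_ord j), be; move: hn; congr (~ m (c (_, _))); exact: val_inj.
  by move/hmin; rewrite leqNgt hj.
have hs2 : P 0%N (\sum_j S j * u N ^+ j).
  move: hs; congr (P 0%N _).
  rewrite [LHS](eq_bigr (fun p : boxT D N * 'I_D => (c (p.1, p.2))%:MP * (monev u p.1 * u N ^+ p.2))); last by case.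
  rewrite -(pair_bigA _ (fun (be : boxT D N) (j : 'I_D) => (c (be, j))%:MP * (monev u be * u N ^+ j))) /=.
  rewrite exchange_big /=; apply: eq_bigr => j _; rewrite mulr_suml; apply: eq_bigr => be _.
  by rewrite mulrA.
have [PA [PZ [PD [PM [P1n PP]]]]] := hp 0%N (leq0n _).
have hAuN : A (u N) by exact: hA.
have PB p q : P 0%N p -> P 0%N q -> P 0%N (p - q).
  by move=> h1 h2; apply: (PD) => //; rewrite -mulN1r; apply: (PM) => //; apply/A_opp/A_1.
pose W := \sum_(j < D | (j0 < j)%N) S j * u N ^+ (j - j0.+1).
have hWA : A W.
  by apply: big_ind; [exact: A_0|exact: A_add|move=> j _]; apply: A_mul => //; exact: A_exp.
have hs3 : P 0%N (u N ^+ j0 * (S (Ordinal hj0) + u N * W)).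
  have -> : u N ^+ j0 * (S (Ordinal hj0) + u N * W) =
     \sum_j S j * u N ^+ j - \sum_(j < D | (j < j0)%N) S j * u N ^+ j.
    rewrite [X in _ = X - _](bigID (fun j : 'I_D => (j < j0)%N)) /= addrAC subrr add0r.
    rewrite [RHS](bigD1 (Ordinal hj0)) /=; last by rewrite ltnn.
    rewrite mulrDr mulrC; congr (_ + _); rewrite mulrA -exprSr mulr_sumr.
    apply: eq_big => [j|j hj].
      by rewrite -leqNgt -val_eqE /= ltn_neqAle andbC eq_sym.
    by rewrite mulrCA -exprD subnKC.
  apply: PB => //; apply: (big_ind (P 0%N)) => // j hj.
  by rewrite mulrC; apply: (PM); [exact: A_exp | exact/hJ/hSJ].
have huN0 : ~ P 0%N (u N) by have := hun N (ltnSn _); rewrite subnn.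
have hPX k p : A p -> P 0%N (u N ^+ k * p) -> P 0%N p.
  move=> hpA; elim: k => [|k IHk]; first by rewrite mul1r.
  rewrite exprS -mulrA => /PP [//||//|]; by [apply: A_mul => //; exact: A_exp | exact: IHk].
have hs4 : P 1%N (S (Ordinal hj0)).
  have [PA' [PZ' [PD' [PM' _]]]] := hp 1%N (ltn0Sn _).
  have h1 : P 1%N (S (Ordinal hj0) + u N * W).
    by apply: hle => //; apply: (hPX j0) => //; apply: A_add => //; exact: A_mul.
  have -> : S (Ordinal hj0) = (S (Ordinal hj0) + u N * W) + (- W) * u N by ring.
  apply: (PD') => //; apply: (PM'); first exact: A_opp.
  by have := hu N (ltnSn _); rewrite subSnn.
apply: hb0; apply: (IH (fun j => P j.+1) (fun be => c (be, Ordinal hj0))) => //.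
- by move=> j hj; apply: hp.
- by move=> j p hj; apply: hle.
- by move=> p hpJ; apply: hle => //; exact: hJ.
- by move=> i hi; apply: hA; exact: ltnW.
- by move=> i hi; rewrite -subSn; [apply: hu; exact: ltnW | exact: ltnW].
- by move=> i hi; rewrite -subSn // subSS; have := hun i (ltnW hi); rewrite subSS.
Qed.

(** A chain of length n + 1 would give n + 1 independent elements in an algebra with n generators,
    against [dependence]. The bound also makes [analytic_spread] a genuine supremum. *)
Lemma fiber_chain_bound k P : prime_chain A (fun p => exists c, m c /\ p = c%:MP) k P -> (k <= n)%N.
Proof.
move=> [h1 h2]; rewrite leqNgt; apply/negP => hk.
have [del hVD] := Fin_VD Fin_start.
have hex i : (i < n.+1)%N -> exists u, P (n.+1 - i)%N u /\ ~ P (n.+1 - i.+1)%N u.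
  move=> hi; rewrite subSS; have hlt : (n - i < k)%N by apply: leq_ltn_trans (leq_subr _ _) hk.
  have [_ [p [hp1 hp2]]] := h2 _ hlt; exists p; by rewrite subSn // -ltnS.
have [u hu] := choose_fun 0 hex.
have hsp j : (j <= n.+1)%N -> sub_prime A (P j).
  by move=> hj; have [] := h1 j (leq_trans hj hk).
have huA i : (i < n.+1)%N -> A (u i).
  move=> hi; have [h3 _] := hu i hi; have [hA _] := hsp _ (leq_subr i n.+1); exact: hA.
have [d hd] := choose_fun 0%N (fun i hi => GA_grows hm hVD (huA i hi)).
have hgr i : (i < n.+1)%N -> grows x m (fun i => oapp x 0 (insub i)) (fun _ : unit => 1) n (u i) (\max_(j < n.+1) d j).
  move=> hi; apply: grows_le (hd i hi); exact: (leq_bigmax (Ordinal hi)).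
have [D [c [[be hbe] hJ]]] := dependence hm hVD hmp hgr.
apply: hbe; have hPJ : forall p, J p -> P 0%N p.
  have [hs0 hc0] := h1 0%N (leq0n _); have [PA [PZ [PD [PM _]]]] := hs0.
  move=> p; elim=> [a ha|q l hq IH|q r _ IH1 _ IH2].
  - by apply: hc0; exists a.
  - rewrite mulrC; apply: (PM) => //; rewrite -[x l]mul1r; constructor; exact: A_1.
  - exact: (PD).
apply: (lowest (P := P) (u := u)) => //.
- move=> j p hj; have [h3 _] := h2 j (leq_trans hj hk); exact: h3.
- by move=> i /hu [].
- by move=> i /hu [].
- exact: hPJ.
Qed.

(** Noether normalization: with s minimal, a relation not in the extension of m would let
    [nagata_step] lower s. So the y are independent and going up gives a chain of length s. *)
Lemma fiber_Fin : exists s y (K : finType) (b : K -> C), Fin m x y s b /\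
  exists P, prime_chain A (fun p => exists c, m c /\ p = c%:MP) s P.
Proof.
have [s [[y [K [b hF]]] hmin]] := nat_min (ex_intro (fun s => exists y (K : finType) (b : K -> C), Fin m x y s b) n
  (ex_intro _ _ (ex_intro _ _ (ex_intro _ _ Fin_start)))).
exists s, y, K, b; split=> //; apply: (fiber_chain hloc hF) => P.
case: s y b hF hmin P => [|s] y b hF hmin P hP; first exact: (GA_const hm xh hP).
apply: nnpp => hn; have := hmin s (nagata_step hloc hF hn hP); by rewrite ltnn.
Qed.

End Spread.

(** * Reductions *)

Section Words.
Variables (B : comNzRingType) (e n : nat) (x : 'I_n -> {mpoly B[e]}).
Notation C := {mpoly B[e]}.

Definition xw d (w : d.-tuple 'I_n) : C := \prod_(l <- w) x l.

Lemma xw_AI d (w : d.-tuple 'I_n) : AI x (@allB B) d (xw w).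
Proof.
rewrite /xw; case: w => w /= /eqP <-; elim: w => [|l w IH] /=.
  by rewrite big_nil -mpolyC1; constructor.
by rewrite big_cons mulrC; constructor.
Qed.

Lemma AI_words (I : B -> Prop) d p : is_ideal I -> AI x I d p ->
  exists c : d.-tuple 'I_n -> B, (forall w, I (c w)) /\ p = \sum_w (c w)%:MP * xw w.
Proof.
move=> hI.
have single d' c (w : d'.-tuple 'I_n) : I c ->
   exists f : d'.-tuple 'I_n -> B, (forall w, I (f w)) /\ c%:MP * xw w = \sum_w (f w)%:MP * xw w.
  move=> hc; exists (fun w' => if w' == w then c else 0); split.
    by move=> w'; case: ifP => _ //; exact: (id0 hI).
  rewrite (bigD1 w) //= eqxx big1 ?addr0 // => w' /negbTE ->; by rewrite mpolyC0 mul0r.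
have zero d' : exists f : d'.-tuple 'I_n -> B, (forall w, I (f w)) /\ 0 = \sum_w (f w)%:MP * xw w.
  exists (fun _ => 0); split; first by move=> _; exact: (id0 hI).
  by rewrite big1 // => w _; rewrite mpolyC0 mul0r.
have add d' p1 p2 : (exists f : d'.-tuple 'I_n -> B, (forall w, I (f w)) /\ p1 = \sum_w (f w)%:MP * xw w) ->
   (exists f : d'.-tuple 'I_n -> B, (forall w, I (f w)) /\ p2 = \sum_w (f w)%:MP * xw w) ->
   exists f : d'.-tuple 'I_n -> B, (forall w, I (f w)) /\ p1 + p2 = \sum_w (f w)%:MP * xw w.
  move=> [f [hf ->]] [g [hg ->]]; exists (fun w => f w + g w); split; first by move=> w; exact: (idD hI).
  by rewrite -big_split; apply: eq_bigr => w _; rewrite mpolyCD mulrDl.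
elim=> [d'|c hc|d' q l _ [f [hf ->]]|d' q1 q2 _ IH1 _ IH2]; first exact: zero.
- have [f [hf1 hf2]] := single 0%N c [tuple] hc; exists f; split=> //.
  by rewrite -hf2 /xw big_nil mulr1.
- rewrite mulr_suml; apply: (big_ind (fun p => exists c : d'.+1.-tuple 'I_n -> B, (forall w, I (c w)) /\ p = \sum_w (c w)%:MP * xw w)); [exact: zero | exact: add | move=> w _].
  have [g [hg1 hg2]] := single d'.+1 (f w) [tuple of l :: w] (hf w).
  by exists g; split=> //; rewrite -hg2 /xw big_cons mulrAC -mulrA.
- exact: add.
Qed.

Lemma perm_nseq (l : 'I_n) D (w : seq 'I_n) : (D <= count_mem l w)%N -> exists w', perm_eq w (nseq D l ++ w').
Proof.
elim: D w => [|D IH] w h; first by exists w.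
have hin : l \in w by rewrite -has_pred1 has_count (leq_trans _ h).
have hp := perm_to_rem hin.
have [|w' hw'] := IH (rem l w).
  by move: h; rewrite (seq.permP hp) /= eqxx add1n ltnS.
by exists w'; apply: perm_trans hp _; rewrite /= perm_cons.
Qed.

Lemma pigeon D (w : seq 'I_n) : (n * D < size w)%N -> exists l, (D <= count_mem l w)%N.
Proof.
move=> h; apply: nnpp => hno.
have hs : size w = \sum_l count_mem l w.
  elim: w {h hno} => [|a w IH] /=; first by rewrite big1.
  by rewrite big_split /= -IH (bigD1 a) //= eqxx big1 // => i; rewrite eq_sym => /negbTE ->.
move: h; rewrite hs ltnNge => /negP; apply.
apply: (@leq_trans (\sum_(l : 'I_n) D)); last by rewrite sum_nat_const card_ord.
by apply: leq_sum => l _; rewrite leqNgt; apply/negP => hl; apply: hno; exists l; apply: ltnW.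
Qed.
End Words.

Section Reduction.
Variables (B : comNzRingType) (e n r : nat) (x : 'I_n -> {mpoly B[e]}) (Z : nat -> 'I_n -> B).
Notation C := {mpoly B[e]}.
Notation AA := (AI x (@allB B)).

Definition zf (j : nat) : C := \sum_l (Z j l)%:MP * x l.
(** The degree d part of (z_0, ..., z_(r-1)) A + I A. Because of [d.-1] it is meant for positive d,
    whence the conditions [0 < d] below. *)
Definition ZI (I : B -> Prop) (d : nat) (q : C) := exists g : nat -> C, (forall j, AA d.-1 (g j)) /\
  AI x I d (q - \sum_(j < r) g j * zf j).
(** For I zero: the z_j generate a reduction wherever f is invertible. *)
Definition Red (I : B -> Prop) d (f : B) := forall p, AA d p -> ZI I d (f%:MP * p).

Lemma x_AI l : AA 1 (x l).
Proof. by rewrite -[x l]mul1r -mpolyC1; apply: AIx; apply: AIc. Qed.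

Lemma zf_AI j : AA 1 (zf j).
Proof. by apply: AI_sum => l _; apply: AI_scale; [exact: allB_ideal | exact: x_AI]. Qed.

Lemma AAM d d' p q : AA d p -> AA d' q -> AA (d + d') (p * q).
Proof. by apply: AI_mul; exact: allB_ideal. Qed.

Lemma AAX d p k : AA d p -> AA (d * k) (p ^+ k).
Proof.
move=> hp; elim: k => [|k IH]; first by rewrite muln0 expr0 -mpolyC1; apply: AIc.
by rewrite exprS mulnS; apply: AAM.
Qed.

Variable I : B -> Prop.
Hypothesis hI : is_ideal I.

Lemma ZI_AI d q : AI x I d q -> ZI I d q.
Proof.
move=> h; exists (fun _ => 0); split; first by move=> _; constructor.
by rewrite big1 ?subr0 // => j _; rewrite mul0r.
Qed.
Lemma ZI_add d p q : ZI I d p -> ZI I d q -> ZI I d (p + q).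
Proof.
move=> [f [hf1 hf2]] [g [hg1 hg2]]; exists (fun j => f j + g j); split; first by move=> j; constructor.
under eq_bigr do rewrite mulrDl.
by rewrite big_split /= opprD addrACA; constructor.
Qed.
Lemma ZI0 d : ZI I d 0. Proof. by apply: ZI_AI; constructor. Qed.
Lemma ZI_sum d (T : Type) (s : seq T) (P : pred T) (F : T -> C) :
  (forall i, P i -> ZI I d (F i)) -> ZI I d (\sum_(i <- s | P i) F i).
Proof. by move=> h; apply: big_ind => //; [exact: ZI0 | exact: ZI_add]. Qed.
Lemma ZI_mul k d p q : (0 < d)%N -> AA k p -> ZI I d q -> ZI I (k + d) (p * q).
Proof.
move=> hd hp [g [hg1 hg2]]; exists (fun j => p * g j); split.
  by move=> j; case: d hd hg1 {hg2} => // d _ hg1; rewrite addnS /=; apply: AAM.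
under eq_bigr do rewrite -mulrA.
by rewrite -mulr_sumr -mulrBr mulrC addnC; apply: AI_mul.
Qed.
Lemma ZI_scale d c q : ZI I d q -> ZI I d (c%:MP * q).
Proof.
move=> [g [hg1 hg2]]; exists (fun j => c%:MP * g j); split.
  by move=> j; apply: AI_scale => //; exact: allB_ideal.
under eq_bigr do rewrite -mulrA.
by rewrite -mulr_sumr -mulrBr; apply: AI_scale.
Qed.
Lemma ZI_z d g j : (j < r)%N -> AA d g -> ZI I d.+1 (g * zf j).
Proof.
move=> hj hg; exists (fun i => if i == j then g else 0); split.
  by move=> i; case: ifP => _ //=; constructor.
rewrite (bigD1 (Ordinal hj)) //= eqxx big1 ?addr0 ?subrr; first by constructor.
by move=> i hi; case: eqP => h; [case/eqP: hi; apply: val_inj | rewrite mul0r].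
Qed.
Lemma ZI_all d q : (0 < d)%N -> ZI I d q -> AA d q.
Proof.
case: d => // d _ [g [hg1 hg2]]; rewrite -(subrK (\sum_(j < r) g j * zf j) q); constructor.
  exact: AI_all hg2.
by apply: AI_sum => j _; rewrite -addn1; apply: AAM => //; exact: zf_AI.
Qed.
Lemma ZI_pow d p q k : (0 < d)%N -> AA d p -> ZI I d q -> ZI I (d * k.+1) ((p + q) ^+ k.+1 - p ^+ k.+1).
Proof.
move=> hd hp hq; elim: k => [|k IH]; first by rewrite muln1 !expr1 addrC addKr.
have -> : (p + q) ^+ k.+2 - p ^+ k.+2 = (p + q) * ((p + q) ^+ k.+1 - p ^+ k.+1) + p ^+ k.+1 * q.
  by rewrite ![_ ^+ k.+2]exprS; ring.
rewrite mulnS; apply: ZI_add.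
  apply: ZI_mul => //; first by rewrite muln_gt0 hd.
  by constructor => //; exact: ZI_all.
by rewrite addnC; apply: ZI_mul => //; exact: AAX.
Qed.

Lemma Red_words d f : (forall w : d.-tuple 'I_n, ZI I d (f%:MP * xw x w)) -> Red I d f.
Proof.
move=> h p /(AI_words (@allB_ideal B)) [c [_ ->]]; rewrite mulr_sumr; apply: ZI_sum => w _.
by rewrite mulrCA; apply: ZI_scale.
Qed.

(** A word of length greater than n D contains some letter D times. *)
Lemma Red_of_powers f D : (0 < D)%N -> (forall l, ZI I D (f%:MP * x l ^+ D)) -> Red I (n * D).+1 f.
Proof.
move=> hD h; apply: Red_words => w.
have [|l hl] := @pigeon n D w; first by rewrite size_tuple.
have [w' hw'] := perm_nseq hl.
have hsz : (D + size w' = (n * D).+1)%N by rewrite -(size_tuple w) (perm_size hw') size_cat size_nseq.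
rewrite /xw (perm_big _ hw') /= big_cat /= big_nseq.
have -> : iter D ( *%R (x l)) 1 = x l ^+ D by elim: (D) => //= k ->; rewrite exprS.
rewrite mulrA mulrC -hsz addnC; apply: ZI_mul => //.
exact: (xw_AI x (in_tuple w')).
Qed.
End Reduction.

(** Nakayama for the finitely many words of length d. The determinant f' is congruent to a power of
    f, so it stays outside a prime containing I but not f, while the reduction becomes exact. *)
Lemma Red_nakayama (B : comNzRingType) e n r (x : 'I_n -> {mpoly B[e]}) (Z : nat -> 'I_n -> B) I d f :
  is_ideal I -> Red r x Z I d f -> exists f' k, Red r x Z (@zeroI B) d f' /\ I (f' - f ^+ k).
Proof.
move=> hI h; pose N := #|{: d.-tuple 'I_n}|.
pose wi (i : 'I_N) : d.-tuple 'I_n := enum_val i.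
have hi i : exists mu : 'I_N -> B, (forall k, I (mu k)) /\ ZI r x Z (@zeroI B) d (f%:MP * xw x (wi i) - \sum_k (mu k)%:MP * xw x (wi k)).
  have [g [hg1 /(AI_words hI) [c [hc1 hc2]]]] := h _ (xw_AI x (wi i)).
  exists (fun k => c (wi k)); split=> //.
  exists g; split=> //; rewrite addrAC hc2 (reindex (@enum_val {: d.-tuple 'I_n} predT)) /=; last exact/onW_bij/enum_val_bij.
  by rewrite subrr; constructor.
have [mu hmu] := choose_fun (fun _ => 0) (fun i (_ : True) => hi i).
pose A : 'M[B]_N := \matrix_(i, k) (f *+ (i == k) - mu i k).
exists (\det A), N; split.
  apply: Red_words => [|w]; first exact: zeroI_ideal.
  have := @det_trick B {mpoly B[e]} (ZI r x Z (@zeroI B) d) N A (fun i => xw x (wi i)) (ZI0 _ _ _ _ _).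
  move=> /(_ (fun u v => @ZI_add _ _ _ _ _ _ _ _ u v)) hh.
  have := hh _ _ (enum_rank w); rewrite /wi enum_rankK mul_mpolyC; apply.
    by move=> a v hv; rewrite -mul_mpolyC; apply: ZI_scale => //; exact: zeroI_ideal.
  move=> i; have [_] := hmu i Logic.I; congr (ZI _ _ _ _ _ _).
  under [RHS]eq_bigr do rewrite mxE scalerBl.
  rewrite sumrB; congr (_ - _); last by apply: eq_bigr => k _; rewrite mul_mpolyC.
  rewrite (bigD1 i) //= eqxx mulr1n big1 ?addr0 ?mul_mpolyC // => k.
  by rewrite eq_sym => /negbTE ->; rewrite mulr0n scale0r.
rewrite -det_scalar; apply: det_mod => // i k; rewrite !mxE addrAC subrr add0r.
by apply: idN => //; have [] := hmu i Logic.I.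
Qed.

Section BaseChange.
Variables (B : comNzRingType) (e n r : nat) (x : 'I_n -> {mpoly B[e]}).
Notation h := (map_mpoly (polyC : {rmorphism B -> {poly B}})).
Definition xC : 'I_n -> {mpoly {poly B}[e]} := fun l => map_mpoly (polyC : {rmorphism B -> {poly B}}) (x l).

Lemma AI_C (I : B -> Prop) (I' : {poly B} -> Prop) d p : (forall c, I c -> I' c%:P) -> AI x I d p -> AI xC I' d (h p).
Proof.
move=> hI; elim=> [d'|c hc|d' q l _ IH|d' q1 q2 _ IH1 _ IH2].
- by rewrite rmorph0; constructor.
- by rewrite map_mpolyC; apply: AIc; apply: hI.
- by rewrite rmorphM; apply: (@AIx _ _ _ xC).
- by rewrite rmorphD; apply: AIadd.
Qed.

Lemma GA_C (I : B -> Prop) (I' : {poly B} -> Prop) p : (forall c, I c -> I' c%:P) -> GA x I p -> GA xC I' (h p).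
Proof.
move=> hI; elim=> [c hc|q l _ IH|q1 q2 _ IH1 _ IH2].
- by rewrite map_mpolyC; apply: GAc; apply: hI.
- by rewrite rmorphM; apply: (@GAx _ _ _ xC).
- by rewrite rmorphD; apply: GAadd.
Qed.

Lemma VD_C (I : B -> Prop) y (K : finType) (b : K -> {mpoly B[e]}) s del : is_ideal I ->
  VD x I y b s del -> VD xC (ext I) (fun i => h (y i)) (fun k => h (b k)) s del.
Proof.
move=> hI [hy hb h1 hx].
have hYP t p : YP y t del p -> YP (fun i => h (y i)) t del (h p).
  elim: t p => [|t IH] p /=; first by move=> [c ->]; exists c%:P; rewrite map_mpolyC.
  move=> [q [hq ->]]; exists (fun j => h (q j)); split; first by move=> j; apply: IH.
  by rewrite rmorph_sum; apply: eq_bigr => j _; rewrite rmorphM rmorphXn.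
have hV p : V x I y b s del p -> V xC (ext I) (fun i => h (y i)) (fun k => h (b k)) s del (h p).
  move=> [q [hq1 hq2]]; exists (fun k => h (q k)); split; first by move=> k; apply: hYP.
  have := @GA_C I (ext I) _ (fun c hc => (extC c hI).2 hc) hq2.
  by rewrite rmorphB rmorph_sum; under eq_bigr do rewrite rmorphM.
split.
- by move=> i hi; apply: GA_C (hy i hi).
- by move=> k; apply: GA_C (hb k).
- by rewrite -(rmorph1 (map_mpoly (polyC : {rmorphism B -> {poly B}}))); apply: hV.
- by move=> l k; rewrite -rmorphM; apply: hV.
Qed.

Lemma zf_C (Z : nat -> 'I_n -> B) j : h (zf x Z j) = zf xC (fun j l => (Z j l)%:P) j.
Proof. by rewrite /zf rmorph_sum; apply: eq_bigr => l _; rewrite rmorphM /= map_mpolyC. Qed.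

(* Specializing the new variable to a turns Z' into Z, where the reduction relation is known: a determinant does the rest. *)
Lemma Red_deform (Z : nat -> 'I_n -> B) (T : nat -> 'I_n -> {poly B}) (a : B) I d f : is_ideal I -> (0 < d)%N ->
  Red r x Z I d f -> exists f' k, Red r xC (fun j l => (Z j l)%:P + ('X - a%:P) * T j l) (ext I) d f' /\ f'.[a] = f ^+ k.
Proof.
move=> hI hd hR; set Z' := (fun (j : nat) (l : 'I_n) => (Z j l)%:P + ('X - a%:P) * T j l); pose N := #|{: d.-tuple 'I_n}|.
pose wi (i : 'I_N) : d.-tuple 'I_n := enum_val i.
have hIe := ext_ideal hI.
have hxw (w : d.-tuple 'I_n) : h (xw x w) = xw xC w by rewrite /xw rmorph_prod.
have hi i : exists th : 'I_N -> {poly B}, ZI r xC Z' (ext I) d ((f%:P)%:MP * xw xC (wi i) + \sum_k (('X - a%:P) * th k)%:MP * xw xC (wi k)).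
  have [g [hg1 hg2]] := hR _ (xw_AI x (wi i)).
  pose tau j := \sum_l (T j l)%:MP * xC l.
  have htau j : AI xC (@allB {poly B}) 1 (tau j) by exact: zf_AI.
  have hgh j : AI xC (@allB {poly B}) d.-1 (h (g j)) by apply: AI_C (hg1 j).
  have : AI xC (@allB {poly B}) d (\sum_(j < r) h (g j) * tau j).
    apply: AI_sum => j _; have := AAM (hgh j) (htau j); by rewrite addn1 prednK.
  case/(AI_words (@allB_ideal {poly B})) => c [_ hc].
  exists (fun k => c (wi k)); exists (fun j => h (g j)); split=> //.
  have := @AI_C I (ext I) _ _ (fun c hc => (extC c hI).2 hc) hg2; congr (AI _ _ _ _).
  rewrite rmorphB rmorphM /= map_mpolyC hxw -addrA; congr (_ + _).
  have -> : \sum_k (('X - a%:P) * c (wi k))%:MP * xw xC (wi k) = ('X - a%:P)%:MP * \sum_(j < r) h (g j) * tau j.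
    rewrite hc mulr_sumr [RHS](reindex (@enum_val {: d.-tuple 'I_n} predT)) /=; last exact/onW_bij/enum_val_bij.
    by apply: eq_bigr => k _; rewrite mpolyCM mulrA.
  rewrite rmorph_sum mulr_sumr -sumrB -sumrN; apply: eq_bigr => j _.
  rewrite rmorphM /= zf_C mulrCA -mulrBr -mulrN; congr (_ * _).
  rewrite /tau mulr_sumr -sumrB -sumrN; apply: eq_bigr => l _.
  by rewrite /Z' [((Z j l)%:P + _)%:MP]mpolyCD mpolyCM; ring.
have [th hth] := choose_fun (fun _ => 0) (fun i (_ : True) => hi i).
pose A : 'M[{poly B}]_N := \matrix_(i, k) ((f *+ (i == k))%:P + ('X - a%:P) * th i k).
exists (\det A), N; split.
  apply: Red_words => // w.
  have hh := @det_trick {poly B} {mpoly {poly B}[e]} (ZI r xC Z' (ext I) d) N A (fun i => xw xC (wi i)) (ZI0 _ _ _ _ _)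
    (fun u v => @ZI_add _ _ _ _ _ _ _ _ u v).
  have := hh _ _ (enum_rank w); rewrite /wi enum_rankK mul_mpolyC; apply.
    by move=> c v hv; rewrite -mul_mpolyC; apply: ZI_scale.
  move=> i; have := hth i Logic.I; congr (ZI _ _ _ _ _ _).
  under [RHS]eq_bigr do rewrite mxE scalerDl.
  rewrite big_split /=; congr (_ + _); last by apply: eq_bigr => k _; rewrite mul_mpolyC.
  rewrite (bigD1 i) //= eqxx mulr1n big1 ?addr0 ?mul_mpolyC // => k.
  by rewrite eq_sym => /negbTE ->; rewrite mulr0n polyC0 scale0r.
rewrite -[LHS]/(horner_eval a (\det A)) -det_map_mx -det_scalar; congr (\det _).
apply/matrixP => i k; by rewrite !mxE /= /horner_eval !hornerE subrr mul0r ?addr0.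
Qed.

End BaseChange.

(** * Transfer between a ring and its polynomial towers; linear forms of vectors *)

Section TowerMap.
Variable R : comNzRingType.
Implicit Type K : R -> Prop.

Fixpoint cmap (k : nat) : {rmorphism R -> tower R k} :=
  match k return {rmorphism R -> tower R k} with
  | 0%N => idfun
  | k'.+1 => (polyC : {rmorphism tower R k' -> {poly tower R k'}}) \o cmap k'
  end.

Lemma exts_ideal K k : is_ideal K -> is_ideal (@exts R K k).
Proof. by move=> hK; elim: k => [|k IH] //=; exact: ext_ideal. Qed.

Lemma exts_cmap K k a : is_ideal K -> exts K (cmap k a) <-> K a.
Proof. by move=> hK; elim: k => [|k IH] //=; rewrite extC //; exact: exts_ideal. Qed.

Lemma exts_Ks k (s : seq R) : Ks (@zeroI (tower R k)) (map (cmap k) s) = @exts R (Ks (@zeroI R) s) k.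
Proof.
elim: k => [|k IH] /=; first by rewrite map_id.
by rewrite -ext_zero map_comp Ks_ext ?IH //; exact: zeroI_ideal.
Qed.

Lemma reg_cmap k (s : seq R) : reg (@zeroI R) s -> reg (@zeroI (tower R k)) (map (cmap k) s).
Proof. by move=> h; elim: k => [|k IH] /=; [rewrite map_id | rewrite map_comp; exact: reg_ext]. Qed.

(** McCoy one variable at a time: W is replaced by the set of all coefficients of its members, which
    is why [mccoy] treats a family of polynomials. *)
Lemma mccoy_tower K k (W : tower R k -> Prop) g : is_ideal K -> ~ exts K g ->
  (forall p, W p -> exts K (p * g)) -> exists gam, ~ K gam /\ forall p, W p -> exts (ann K gam) p.
Proof.
move=> hK; elim: k W g => [|k IH] W g hg hW; first by exists g.
have hKi := @exts_ideal K k hK.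
have e (p : {poly tower R k}) : Lx (iL (exts K (s := k))) (const_mx p : 'rV_1) <-> ext (exts K (s := k)) p.
  by split=> h' i; have := h' i; rewrite /iL !mxE.
have [p hp|/e //|gam [h1 h2]] := @mccoy _ 1 (iL (exts K (s := k))) (iL_sub hKi) W (const_mx g).
  have -> : p *: const_mx g = const_mx (p * g) :> 'rV[{poly tower R k}]_1 by apply/rowP => j; rewrite !mxE.
  exact/e/(hW p hp).
have [q [p [i [hp ->]]]|gam' [h3 h4]] := IH (fun q => exists p i, W p /\ q = p`_i) (gam 0 0) h1.
  by have := h2 p hp i; rewrite /iL mxE.
by exists gam'; split=> // p hp i; apply: h4; exists p, i.
Qed.
End TowerMap.

(** Over the residue field of Q the vectors span or are annihilated by a nonzero functional; in the
    first case elimination with pivots outside Q gives spanning over S itself, up to s. *)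
Lemma elim_or_span (S : comNzRingType) (Q : S -> Prop) e r (M : 'I_r -> 'rV[S]_e) : is_prime Q ->
  (exists s, ~ Q s /\ forall v, exists c : 'I_r -> S, s *: v = \sum_j c j *: M j) \/
  (exists lam : 'I_e -> S, (exists i, ~ Q (lam i)) /\ forall j, Q (\sum_i M j 0 i * lam i)).
Proof.
move=> hQ; have hQi := prime_ideal hQ.
elim: e M => [|e IH] M.
  by left; exists 1; split; [exact: prime1 | move=> v; exists (fun _ => 0); apply/rowP; case].
case: (lem (forall j, Q (M j 0 ord0))) => [h0|/not_forall [j0 hj0]].
  right; exists (fun i => (i == ord0)%:R); split; first by exists ord0; rewrite eqxx; exact: prime1.
  move=> j; rewrite (bigD1 ord0) //= ?eqxx mulr1 big1 ?addr0 // => i /negbTE ->; by rewrite mulr0.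
pose a := M j0 0 ord0.
have := IH (fun j => \row_i (a * M j 0 (lift ord0 i) - M j 0 ord0 * M j0 0 (lift ord0 i))).
case=> [[s [hs h]]|[lam [[i0 hi0] hlam]]]; [left|right].
  exists (s * a); split; first exact: primeNM.
  move=> v; have [c hc] := h (\row_i (a * v 0 (lift ord0 i) - v 0 ord0 * M j0 0 (lift ord0 i))).
  exists (fun j => a * c j + (j == j0)%:R * (s * v 0 ord0 - \sum_k c k * M k 0 ord0)).
  under eq_bigr do rewrite scalerDl -!scalerA.
  rewrite big_split /= [X in _ + X](bigD1 j0) //= eqxx scale1r [X in _ + (_ + X)]big1 ?addr0; last first.
    by move=> j /negbTE ->; rewrite scale0r.
  apply/rowP => i; rewrite !mxE summxE.
  under [X in _ = X + _]eq_bigr do rewrite !mxE.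
  case: (unliftP ord0 i) => [i' ->|->].
    have := congr1 (fun w : 'rV_e => w 0 i') hc; rewrite !mxE summxE.
    under [X in _ = X -> _]eq_bigr do rewrite !mxE mulrBr.
    rewrite sumrB => /(congr1 (fun t => t + s * v 0 ord0 * M j0 0 (lift ord0 i'))).
    have -> : s * (a * v 0 (lift ord0 i') - v 0 ord0 * M j0 0 (lift ord0 i')) + s * v 0 ord0 * M j0 0 (lift ord0 i')
       = s * a * v 0 (lift ord0 i') by ring.
    move=> ->; rewrite mulrBl mulr_suml.
    under [X in _ = X + _]eq_bigr do rewrite mulrCA.
    by under [X in _ = _ + (_ - X)]eq_bigr do rewrite -mulrA; rewrite -addrA [- _ + _]addrC.
  rewrite -/a mulrBl mulr_suml.
  under [X in _ = _ + (_ - X)]eq_bigr do rewrite -mulrA mulrC -mulrA.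
  have -> : \sum_(j < r) a * (c j * M j 0 ord0) = \sum_(j < r) M j 0 ord0 * (a * c j).
    by apply: eq_bigr => j _; ring.
  by rewrite addrC subrK; ring.
exists (fun i => if unlift ord0 i is Some i' then a * lam i' else - \sum_k lam k * M j0 0 (lift ord0 k)); split.
  by exists (lift ord0 i0); rewrite liftK; exact: primeNM.
move=> j; have := hlam j; congr Q.
rewrite big_ord_recl unlift_none [X in _ = _ + X](eq_bigr (fun i => M j 0 (lift ord0 i) * (a * lam i))); last first.
  by move=> i _; rewrite liftK.
rewrite mulrN mulr_sumr -sumrN -big_split /=; apply: eq_bigr => i _.
by rewrite mxE; ring.
Qed.

Section Lin.
Variables (S : comNzRingType) (e : nat).

Definition lin (v : 'rV[S]_e) : {mpoly S[e]} := \sum_i v 0 i *: 'X_i.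

Lemma linD u v : lin (u + v) = lin u + lin v.
Proof. by rewrite /lin -big_split; apply: eq_bigr => i _; rewrite mxE scalerDl. Qed.
Lemma linZ a v : lin (a *: v) = a%:MP * lin v.
Proof. by rewrite /lin mulr_sumr; apply: eq_bigr => i _; rewrite mxE -scalerA mul_mpolyC. Qed.
Lemma lin0 : lin 0 = 0.
Proof. by rewrite /lin big1 // => i _; rewrite mxE scale0r. Qed.
Lemma lin_sum (I : Type) (s : seq I) (P : pred I) (F : I -> 'rV[S]_e) :
  lin (\sum_(k <- s | P k) F k) = \sum_(k <- s | P k) lin (F k).
Proof. by apply: (big_morph lin) => [x y|]; [exact: linD | exact: lin0]. Qed.
Lemma lin_homog v : lin v \is 1.-homog.
Proof. by apply: rpred_sum => i _; apply: dhomogZ; rewrite dhomogX; apply/eqP; exact: mdeg1. Qed.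
Lemma lin_eval v (lam : 'I_e -> S) : (lin v).@[lam] = \sum_i v 0 i * lam i.
Proof. by rewrite /lin raddf_sum; apply: eq_bigr => i _; rewrite /= mevalZ mevalXU. Qed.
End Lin.

Lemma map_lin (S S' : comNzRingType) e (f : {rmorphism S -> S'}) (v : 'rV[S]_e) :
  map_mpoly f (lin v) = lin (map_mx f v).
Proof.
rewrite /lin rmorph_sum; apply: eq_bigr => i _.
by rewrite -!mul_mpolyC rmorphM /= map_mpolyC map_mpolyX mxE.
Qed.

Section Conductor.
Variables (S : comNzRingType) (e n r : nat) (W : 'I_n -> 'rV[S]_e) (Z : nat -> 'I_n -> S).

Definition zv (j : nat) : 'rV[S]_e := \sum_l Z j l *: W l.
Definition spanz (v : 'rV[S]_e) := exists c : 'I_r -> S, v = \sum_(j < r) c j *: zv j.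

Lemma zf_lin j : zf (fun l => lin (W l)) Z j = lin (zv j).
Proof. by rewrite /zf /zv lin_sum; apply: eq_bigr => l _; rewrite linZ. Qed.

Lemma spanz_sub : is_submodule spanz.
Proof.
split; [|split].
- by exists (fun _ => 0); rewrite big1 // => j _; rewrite scale0r.
- move=> _ _ [c ->] [c' ->]; exists (fun j => c j + c' j); rewrite -big_split; apply: eq_bigr => j _.
  by rewrite scalerDl.
- by move=> a _ [c ->]; exists (fun j => a * c j); rewrite scaler_sumr; apply: eq_bigr => j _; rewrite scalerA.
Qed.

(* At a prime not containing f b, a vector killing the z_j would kill the W_l by the reduction relation, hence the b e_i. *)
Lemma conductor d f b : Red r (fun l => lin (W l)) Z (@zeroI S) d f ->
  (forall v, exists c : 'I_n -> S, b *: v = \sum_l c l *: W l) ->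
  exists N, forall v, spanz ((f * b) ^+ N *: v).
Proof.
move=> hR hb; apply: nnpp => hno; have hU := spanz_sub.
pose J s := forall v, spanz (s *: v).
have [||||Q [hQ [hJQ hM]]] := @exists_prime_avoiding S J (fun s => exists N, s = (f * b) ^+ N).
- split; first by move=> v; rewrite scale0r; exact: (sub0 hU).
  split=> [s t hs ht v|a s hs v]; first by rewrite scalerDl; exact: (subD hU).
  by rewrite -scalerA; apply: (subZ hU).
- by exists 0%N.
- by move=> _ _ [N ->] [N' ->]; exists (N + N')%N; rewrite exprD.
- by move=> s hs [N hN]; apply: hno; exists N; rewrite -hN.
have hQi := prime_ideal hQ.
have hfb : ~ Q (f * b) by apply: hM; exists 1%N.
have hf : ~ Q f by move=> h; apply: hfb; exact: (idMr _ hQi).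
have hbQ : ~ Q b by move=> h; apply: hfb; exact: (idM _ hQi).
case: (elim_or_span (fun j : 'I_r => zv j) hQ) => [[s [hs h]]|[lam [[i0 hi0] hlam]]].
  by apply: hs; apply: hJQ => v; exact: h.
have hW l : Q (\sum_i W l 0 i * lam i).
  have hw := AAX d (x_AI (fun l => lin (W l)) l); rewrite mul1n in hw.
  have [g [_ hg]] := hR _ hw.
  have : f%:MP * lin (W l) ^+ d - \sum_(j < r) g j * zf (fun l => lin (W l)) Z j = 0.
    have z0 d' p : AI (fun l => lin (W l)) (@zeroI S) d' p -> p = 0.
      elim=> [//|c ->|d1 p1 l1 _ ->|d1 p1 p2 _ -> _ ->] //; by rewrite ?mpolyC0 ?mul0r ?addr0.
    exact: z0 hg.
  move/subr0_eq => /(congr1 (fun p => p.@[lam])).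
  rewrite mevalM mevalC rmorphXn /= lin_eval => heq.
  have : Q (f * (\sum_i W l 0 i * lam i) ^+ d).
    rewrite heq raddf_sum; apply: id_sum => // j _; rewrite /= mevalM; apply: (idM _ hQi).
    by rewrite zf_lin lin_eval; exact: hlam.
  by move/(primeM hQ) => [//|]; exact: primeX.
apply: hi0; have [c hc] := hb (delta_mx 0 i0).
have : Q (b * lam i0).
  have -> : b * lam i0 = \sum_l c l * \sum_i W l 0 i * lam i.
    transitivity (\sum_i (b *: delta_mx 0 i0 : 'rV_e) 0 i * lam i).
      rewrite (bigD1 i0) //= big1 ?addr0 ?mxE ?eqxx ?mulr1 // => i /negbTE hi.
      by rewrite !mxE hi andbF mulr0 mul0r.
    rewrite hc; under [RHS]eq_bigr do rewrite mulr_sumr.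
    rewrite exchange_big /=; apply: eq_bigr => i _; rewrite summxE mulr_suml.
    by apply: eq_bigr => l _; rewrite mxE mulrA.
  by apply: id_sum => // l _; apply: idM.
by case/(primeM hQ).
Qed.
End Conductor.

(** * Generic reductions *)

Section Codes.
Variable D : nat.

Fixpoint bdeg s : boxT D s -> nat :=
  match s return boxT D s -> nat with
  | 0%N => fun _ => 0%N
  | s'.+1 => fun be => (bdeg be.1 + be.2)%N
  end.
(** Kronecker's substitution: the exponents are digits in base D, so distinct exponent vectors give
    distinct powers of one variable. *)
Fixpoint code s : boxT D s -> nat :=
  match s return boxT D s -> nat with
  | 0%N => fun _ => 0%N
  | s'.+1 => fun be => (code be.1 + D ^ s'.+1 * be.2)%N
  end.
Fixpoint bprod (T : comNzRingType) (t : nat -> T) s : boxT D s -> T :=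
  match s return boxT D s -> T with
  | 0%N => fun _ => 1
  | s'.+1 => fun be => bprod t be.1 * t s' ^+ be.2
  end.

Lemma code_lt s (be : boxT D s) : (0 < D)%N -> (code be < D ^ s.+1)%N.
Proof.
move=> hD; elim: s be => [|s IH] be; first by rewrite expn1.
case: be => be j /=; apply: (@leq_trans (D ^ s.+1 + D ^ s.+1 * j)).
  by rewrite ltn_add2r.
by rewrite -mulnS [X in (_ <= X)%N]expnSr leq_mul2l ltn_ord orbT.
Qed.

Lemma code_inj s : injective (@code s).
Proof.
elim: s => [|s IH]; first by case; case.
move=> [be j] [be' j'] /= h.
have hD : (0 < D)%N by exact: leq_ltn_trans (leq0n _) (ltn_ord j).
have hX : (0 < D ^ s.+1)%N by rewrite expn_gt0 hD.
have q (t : boxT D s) (k : nat) : ((code t + D ^ s.+1 * k) %/ D ^ s.+1 = k)%N.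
  by rewrite addnC mulnC divnMDl // divn_small ?addn0 // code_lt.
have hj : j = j' by apply: val_inj => /=; rewrite -(q be j) h q.
congr (_, _) => //; apply: IH; move: h; rewrite hj; exact: addIn.
Qed.

Lemma bprod_ext (T : comNzRingType) (t t' : nat -> T) s (be : boxT D s) :
  (forall i, (i < s)%N -> t i = t' i) -> bprod t be = bprod t' be.
Proof.
elim: s be => [|s IH] be h //=; rewrite h // IH // => i hi; apply: h; exact: ltnW.
Qed.

Lemma bprod_code (T : comNzRingType) s (be : boxT D s) :
  bprod (fun i => - 'X^(D ^ i.+1) : {poly T}) be = (-1) ^+ bdeg be *: 'X^(code be).
Proof.
elim: s be => [|s IH] be /=; first by rewrite expr0 scale1r.
rewrite IH [(- _ ^+ (D ^ s.+1)) ^+ _]exprNn -exprM !exprD -scalerAl -scalerA; congr (_ *: _).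
by rewrite mulrCA -mul_polyC rmorphXn rmorphN1.
Qed.
End Codes.

Section ReduceStep.
Variables (B : comNzRingType) (e n r : nat) (x : 'I_n -> {mpoly B[e]}) (Z : nat -> 'I_n -> B).
Variables (M : B -> Prop) (y : nat -> {mpoly B[e]}) (K : finType) (b : K -> {mpoly B[e]}) (s del : nat).
Hypotheses (xh : forall l, x l \is 1.-homog) (hM : is_prime M) (hVD : VD x M y b s del) (hs : (s <= r)%N).
Notation C := {mpoly B[e]}.
Let hMi := prime_ideal hM.

Lemma AI_of_GA (N : nat) (q : nat -> C) : (forall d, AI x (@allB B) d (q d)) -> GA x M (\sum_(d < N) q d) ->
  forall d, (d < N)%N -> AI x M d (q d).
Proof.
move=> hq /GA_decomp [N' [p [hp e1]]] d hd.
have hh k : q k - p k \is k.-homog.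
  by apply: rpredB; [exact: AI_homog (hq k) | exact: AI_homog (hp k)].
pose f k := (if (k < N)%N then q k else 0) - (if (k < N')%N then p k else 0).
have hf k : f k \is k.-homog.
  apply: rpredB; case: ifP => _; rewrite ?dhomog0 //; [exact: AI_homog (hq k) | exact: AI_homog (hp k)].
have h0 : \sum_(k < maxn N N') f k = 0.
  rewrite sumrB /= -!big_mkcond /= -(big_ord_widen _ q (leq_maxl _ _)).
  by rewrite -(big_ord_widen _ p (leq_maxr _ _)) e1 subrr.
have := homog_split hf h0 (leq_trans hd (leq_maxl _ _)); rewrite /f hd.
case: ifP => _; first by move/subr0_eq => ->.
by rewrite subr0 => ->; constructor.
Qed.

Variable l0 : 'I_n.
Local Notation uu := (fun i => if (i < s)%N then zf x Z i else x l0).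

Lemma monev_AI D N (be : boxT D N) : (N <= s.+1)%N -> AI x (@allB B) (bdeg be) (monev uu be).
Proof.
elim: N be => [|N IH] be hN /=; first by rewrite -mpolyC1; apply: AIc.
apply: AAM; first by apply: IH; exact: ltnW.
rewrite -[X in AI _ _ X _]mul1n; apply: AAX; case: ifP => _; [exact: zf_AI | exact: x_AI].
Qed.

(** [dependence] for the s + 1 linear forms z_0, ..., z_(s-1), x_l0; one homogeneous component with
    a coefficient outside M is kept. *)
Lemma relation : exists D d (c : boxT D s.+1 -> B), (exists2 be, bdeg be = d & ~ M (c be)) /\
  AI x M d (\sum_(be | bdeg be == d) (c be)%:MP * monev uu be).
Proof.
pose g (i : nat) (l : 'I_n) := if (i < s)%N then Z i l else (l == l0)%:R.
have euu i : uu i = \sum_l (g i l)%:MP * x l.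
  rewrite /g; case: ifP => _ //; rewrite (bigD1 l0) //= eqxx mpolyC1 mul1r big1 ?addr0 // => l /negbTE ->.
  by rewrite mpolyC0 mul0r.
have hgr i : (i < s.+1)%N -> grows x M y b s (uu i) (1 + del).
  by move=> _; rewrite euu; exact: lin_grows.
have [D [c [[be0 hbe0] hrel]]] := dependence hMi hVD hM hgr.
exists D, (bdeg be0), c; split; first by exists be0.
pose N := (\max_(be : boxT D s.+1) bdeg be).+1.
have hN (be : boxT D s.+1) : (bdeg be < N)%N by rewrite ltnS; exact: (leq_bigmax be).
pose q d := \sum_(be | bdeg be == d) (c be)%:MP * monev uu be.
apply: (AI_of_GA (N := N) (q := q)) => //.
  move=> d; apply: AI_sum => be /eqP <-; apply: AI_scale; first exact: allB_ideal.
  exact: monev_AI.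
move: hrel; congr (GA _ _ _).
rewrite (partition_big (fun be => inord (bdeg be) : 'I_N) xpredT) //=; apply: eq_bigr => d _.
by apply: eq_bigl => be; rewrite -val_eqE /= inordK ?hN.
Qed.

(** z_j is replaced by z_j + X^(D^(j+1)) x_l0. Modulo the new elements the old z_j, for j < s,
    becomes - X^(D^(j+1)) x_l0, and the relation turns into F times a power of x_l0, where distinct
    monomials contribute distinct powers of X to F. *)
Lemma reduce_step : exists (T : nat -> {poly B}) d F, [/\ (0 < d)%N, ~ ext M F &
  ZI r (xC x) (fun j l => (Z j l)%:P + 'X * ((l == l0)%:R * T j)) (ext M) d (F%:MP * xC x l0 ^+ d)].
Proof.
have [D [d [c [[be0 hd0 hbe0] hrel]]]] := relation.
have hD : (0 < D)%N by case: be0 {hd0 hbe0} => be j; exact: leq_ltn_trans (leq0n _) (ltn_ord j).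
have hMe := ext_ideal hMi.
(* The predecessor leaves room for the factor X, which makes the specialization at zero return the
   old z_j. *)
pose T (j : nat) : {poly B} := 'X^((D ^ j.+1).-1).
have hT j : 'X * T j = 'X^(D ^ j.+1) by rewrite -exprS prednK // expn_gt0 hD.
set Z' := (fun (j : nat) (l : 'I_n) => (Z j l)%:P + 'X * ((l == l0)%:R * T j)).
pose h := map_mpoly (n := e) (polyC : {rmorphism B -> {poly B}}).
pose wt (i : nat) : {poly B} := if (i < s)%N then - 'X^(D ^ i.+1) else 1.
pose zp i := if (i < s)%N then zf (xC x) Z' i else 0.
have huu i : h (uu i) = zp i + (wt i)%:MP * xC x l0.
  rewrite /wt /zp; case: ifP => _; last by rewrite add0r mpolyC1 mul1r.
  rewrite /h zf_C /zf /Z'.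
  under [X in _ = X + _]eq_bigr do rewrite mpolyCD mulrDl.
  rewrite big_split /= (bigD1 l0 (F := fun l => ('X * ((l == l0)%:R * T i))%:MP * _)) //= [X in _ = _ + (_ + X) + _]big1.
    by rewrite eqxx mul1r hT addr0 mpolyCN mulNr addrK.
  by move=> l /negbTE ->; rewrite mul0r mulr0 mpolyC0 mul0r.
have hzp i : ZI r (xC x) Z' (ext M) 1 (zp i).
  rewrite /zp; case: ifP => hi; last exact: ZI0.
  rewrite -[zf _ _ _]mul1r -mpolyC1; apply: ZI_z => //; [exact: leq_trans hi hs | exact: AIc].
have hx0 : AI (xC x) (@allB {poly B}) 1 (xC x l0) by exact: x_AI.
have claim N (be : boxT D N) : ZI r (xC x) Z' (ext M) (bdeg be).+1
    (xC x l0 * monev (fun i => h (uu i)) be - (bprod wt be)%:MP * xC x l0 ^+ (bdeg be).+1).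
  elim: N be => [|N IH] be /=; first by rewrite mpolyC1 mulr1 mul1r expr1 subrr; exact: ZI0.
  case: be => be [k hk] /=.
  set p := monev _ be; set w := bprod wt be; set u := h _.
  have -> : xC x l0 * (p * u ^+ k) - (w * wt N ^+ k)%:MP * xC x l0 ^+ (bdeg be + k).+1 =
      xC x l0 * p * (u ^+ k - ((wt N)%:MP * xC x l0) ^+ k) +
      ((wt N)%:MP * xC x l0) ^+ k * (xC x l0 * p - w%:MP * xC x l0 ^+ (bdeg be).+1).
    have key (S : comNzRingType) (a q v t z g w' : S) :
      a * (q * v) - (g * t) * (w' * z) = a * q * (v - t * z) + (t * z) * (a * q - g * w') by ring.
    by rewrite mpolyCM rmorphXn /= -addSn exprD exprMn; exact: key.
  have hwx : AI (xC x) (@allB {poly B}) 1 ((wt N)%:MP * xC x l0) by apply: AI_scale; [exact: allB_ideal|].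
  have hxp : AI (xC x) (@allB {poly B}) (bdeg be).+1 (xC x l0 * p).
    rewrite -add1n; apply: AAM => //; rewrite /p; elim: (N) be {IH p w} => [|N' IH'] be /=.
      by rewrite -mpolyC1; apply: AIc.
    apply: AAM; first exact: IH'.
    rewrite -[X in AI _ _ X _]mul1n; apply: AAX; rewrite huu; apply: AIadd; last by apply: AI_scale; [exact: allB_ideal|].
    exact: ZI_all (hzp _).
  apply: ZI_add => //; last first.
    rewrite -addSn addnC; apply: ZI_mul => //.
    by rewrite -[X in AI _ _ X _]mul1n; apply: AAX.
  case: k hk => [|k] hk; first by rewrite !expr0 subrr mulr0; exact: ZI0.
  rewrite -addSn; apply: ZI_mul => //.
  rewrite /u huu [zp N + _]addrC.
  by have := @ZI_pow _ _ _ r (xC x) Z' (ext M) hMe 1 _ (zp N) k isT hwx (hzp N); rewrite mul1n.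
pose F := \sum_(be : boxT D s.+1 | bdeg be == d) (c be)%:P * bprod wt be.
(* One extra factor x_l0 keeps the degree positive. *)
exists T, d.+1, F; split=> //.
  (* At this power of X only be0 contributes: equal codes give equal exponents of the z_j, and the
     common degree d then fixes the exponent of x_l0. *)
  move/(_ (code be0.1)); rewrite /F coef_sum (bigD1 be0) ?hd0 //= big1 ?addr0.
    rewrite coefCM [wt s]/wt ltnn expr1n mulr1 (bprod_ext (t' := fun i => - 'X^(D ^ i.+1))); last first.
      by move=> i hi; rewrite /wt hi.
    rewrite bprod_code coefZ coefXn eqxx mulr1 => hc; apply: hbe0.
    rewrite -[c be0]mulr1 -(expr1n _ (bdeg be0.1)) -[1]opprK -mulN1r -[-1 * -1]expr2.
    by rewrite -exprM mulnC exprM expr2 mulrA; apply: (idMr _ hMi).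
  move=> be /andP [/eqP hbd hne].
  rewrite coefCM [wt s]/wt ltnn expr1n mulr1 (bprod_ext (t' := fun i => - 'X^(D ^ i.+1))); last first.
    by move=> i hi; rewrite /wt hi.
  rewrite bprod_code coefZ coefXn; case: eqP => [/code_inj ec|_]; last by rewrite !mulr0.
  case/eqP: hne; move: be be0 hbd hd0 ec {hbe0} => [be j] [be' j'] /= hbd hd0 ec.
  rewrite ec in hd0 *; congr (_, _); apply: val_inj; apply: (@addnI (bdeg be)); by rewrite hbd -hd0.
have hrel' := AI_C (I' := ext M) (fun t ht => (extC t hMi).2 ht) hrel.
have hmon N (be : boxT D N) : h (monev uu be) = monev (fun i => h (uu i)) be.
  by rewrite /h; elim: N be => [|N IH] be /=; rewrite ?rmorph1 // rmorphM rmorphXn /= IH.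
have e1 (be : boxT D s.+1) : h ((c be)%:MP * monev uu be) = (c be)%:P%:MP * monev (fun i => h (uu i)) be.
  by rewrite -hmon /h rmorphM /= map_mpolyC.
have e2 : h (\sum_(be | bdeg be == d) (c be)%:MP * monev uu be) =
    \sum_(be | bdeg be == d) (c be)%:P%:MP * monev (fun i => h (uu i)) be.
  by rewrite {1}/h rmorph_sum; apply: eq_bigr => be _; rewrite -e1.
have -> : F%:MP * xC x l0 ^+ d.+1 = h (\sum_(be | bdeg be == d) (c be)%:MP * monev uu be) * xC x l0 -
   \sum_(be : boxT D s.+1 | bdeg be == d) (c be)%:P%:MP * (xC x l0 * monev (fun i => h (uu i)) be - (bprod wt be)%:MP * xC x l0 ^+ d.+1).
  rewrite e2 /F rmorph_sum /= !mulr_suml -sumrB; apply: eq_bigr => be _.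
  by rewrite mpolyCM; ring.
apply: ZI_add => //; first by apply: ZI_AI => //; apply: AIx.
rewrite -mulN1r -mpolyC1 -mpolyCN; apply: ZI_scale => //.
by apply: ZI_sum => // be /eqP <-; apply: ZI_scale => //; exact: claim.
Qed.
End ReduceStep.

(** * Successive generic choices of the coefficients *)

Section Stages.
Variables (R : comNzRingType) (e n r : nat) (X : 'I_n -> 'rV[R]_e).
Implicit Types (q : R -> Prop).

Definition Wk k (l : 'I_n) : 'rV[tower R k]_e := map_mx (cmap R k) (X l).
Definition xk k (l : 'I_n) : {mpoly (tower R k)[e]} := lin (Wk k l).

Lemma Wk_S k l : Wk k.+1 l = map_mx (polyC : {rmorphism tower R k -> {poly tower R k}}) (Wk k l).
Proof. by rewrite /Wk -map_mx_comp. Qed.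

Lemma xC_xk k : xC (xk k) = xk k.+1.
Proof. by apply: functional_extensionality => l; rewrite /xC /xk map_lin Wk_S. Qed.

Lemma xk0 : xk 0 = fun l => lin (X l).
Proof.
by apply: functional_extensionality => l; rewrite /xk; congr lin; apply/rowP => i; rewrite !mxE.
Qed.

Lemma xk_homog k l : xk k l \is 1.-homog. Proof. exact: lin_homog. Qed.

(* Near the prime q, the products of d of the x_l lie in (z_0, ..., z_(r-1)). *)
Definition Good k (Z : nat -> 'I_n -> tower R k) q d :=
  exists f, ~ @exts R q k f /\ Red r (xk k) Z (@zeroI _) d f.

(** All primes q and all positive d are covered at once, so that requirements at different primes
    can be met one after another. *)
Definition refines k Z k' Z' := forall q d, is_prime q -> (0 < d)%N -> @Good k Z q d -> @Good k' Z' q d.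

Lemma refines_trans k1 Z1 k2 Z2 k3 Z3 : @refines k1 Z1 k2 Z2 -> @refines k2 Z2 k3 Z3 -> @refines k1 Z1 k3 Z3.
Proof. by move=> h1 h2 q d hq hd h; apply: h2 => //; exact: h1. Qed.

(** The f' of the deformed relation specializes to a power of f, which is outside the extension of
    q; hence so is f'. *)
Lemma deform_Good k (Z : nat -> 'I_n -> tower R k) (T : nat -> 'I_n -> {poly tower R k}) (a : tower R k) q d :
  is_prime q -> (0 < d)%N -> Good Z q d ->
  @Good k.+1 (fun j l => (Z j l)%:P + ('X - a%:P) * T j l) q d.
Proof.
move=> hq hd [f [hf1 hf2]]; have hqk := exts_prime k hq; have hqi := prime_ideal hqk.
have [f' [N [h1 h2]]] := Red_deform T a (@zeroI_ideal _) hd hf2.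
exists f'; split; last by rewrite ext_zero xC_xk in h1.
move=> hf'; apply: hf1; apply: (primeX hqk (n := N)); rewrite -h2 horner_coef.
by apply: id_sum => // i _; apply: idMr => //; exact: hf'.
Qed.

Lemma step_refines k (Z : nat -> 'I_n -> tower R k) (T : nat -> 'I_n -> {poly tower R k}) :
  @refines k Z k.+1 (fun j l => (Z j l)%:P + 'X * T j l).
Proof.
move=> q d hq hd h; have := deform_Good T 0 hq hd h; congr Good.
by apply: functional_extensionality => j; apply: functional_extensionality => l; rewrite polyC0 subr0.
Qed.

Lemma generators_Good k q (gam : nat -> 'I_n -> R) s : is_prime q -> ~ q s ->
  (forall l, exists c : 'I_r -> R, s *: X l = \sum_j c j *: \sum_l' gam j l' *: X l') ->
  @Good k (fun j l => cmap R k (gam j l)) q 1.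
Proof.
move=> hq hs hgen; exists (cmap R k s); split; first by rewrite exts_cmap //; exact: prime_ideal.
apply: Red_words => [|w]; first exact: zeroI_ideal.
case: w => -[|l [|l' w]] // hw; rewrite /xw /= big_cons big_nil mulr1.
have [c hc] := hgen l.
exists (fun j => (cmap R k (oapp c 0 (insub j)))%:MP); split; first by move=> j; apply: AIc.
rewrite [_ - _](_ : _ = 0); first by constructor.
apply/eqP; rewrite subr_eq0; apply/eqP.
under eq_bigr => j _ do rewrite valK /= zf_lin -linZ.
rewrite -linZ -lin_sum; congr lin.
rewrite /Wk -map_mxZ hc map_mx_sum; apply: eq_bigr => j _.
rewrite map_mxZ map_mx_sum; congr (_ *: _); apply: eq_bigr => l' _; by rewrite map_mxZ.
Qed.

Lemma stage_generators (p : nat -> R -> Prop) N : (forall i, (i < N)%N -> is_prime (p i) /\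
   exists (gam : nat -> 'I_n -> R) s, ~ p i s /\ forall l, exists c : 'I_r -> R, s *: X l = \sum_j c j *: \sum_l' gam (nat_of_ord j) l' *: X l') ->
  exists k Z, forall i, (i < N)%N -> @Good k Z (p i) 1.
Proof.
elim: N => [|N IH] h; first by exists 0%N, (fun _ _ => 0).
have [k [Z hZ]] := IH (fun i hi => h i (ltnW hi)).
have [hp [gam [s [hs hgen]]]] := h N (ltnSn N).
(* At X = 0 the old coefficients return, at X = 1 those adapted to [p N]; one new variable serves
   all these primes. *)
pose T j (l : 'I_n) : {poly tower R k} := (cmap R k (gam j l))%:P - (Z j l)%:P.
exists k.+1, (fun j l => (Z j l)%:P + 'X * T j l) => i; rewrite ltnS leq_eqVlt => /orP [/eqP ->|hi].
  have := deform_Good T 1 hp (ltn0Sn 0) (@generators_Good k (p N) gam s hp hs hgen); congr Good.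
  apply: functional_extensionality => j; apply: functional_extensionality => l.
  by rewrite /T polyC1; ring.
by apply: step_refines => //; [have [] := h i (ltnW hi) | exact: hZ].
Qed.

Section Reduce.
Variables (m : R -> Prop) (y : nat -> {mpoly R[e]}) (K : finType) (b : K -> {mpoly R[e]}) (s del : nat).
Hypotheses (hm : is_prime m) (hVD : VD (fun l => lin (X l)) m y b s del) (hs : (s <= r)%N).

Lemma VD_k k : exists y' (b' : K -> {mpoly (tower R k)[e]}), VD (xk k) (@exts R m k) y' b' s del.
Proof.
elim: k => [|k [y' [b' IH]]]; first by exists y, b; rewrite xk0.
have := VD_C (prime_ideal (exts_prime k hm)) IH; rewrite xC_xk => h.
by eexists; eexists; exact: h.
Qed.

(** The forms x_l are treated one at a time. The change made for the next form w alters an earlier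
    relation for f x_l^D by a multiple w G; raised to the power D' and multiplied by F, this term
    falls into the ideal again, so the relation is repaired at the cost of larger exponents. *)
Lemma stage_powers k (Z : nat -> 'I_n -> tower R k) N : exists k' Z' f D,
  [/\ @refines k Z k' Z', (0 < D)%N, ~ @exts R m k' f &
   forall l : 'I_n, (l < N)%N -> ZI r (xk k') Z' (@exts R m k') D (f%:MP * xk k' l ^+ D)].
Proof.
elim: N => [|N [k' [Z' [f [D [h1 h2 h3 h4]]]]]].
  by exists k, Z, 1, 1%N; split=> //; exact: (prime1 (exts_prime k hm)).
case: (ltnP N n) => hN; last first.
  by exists k', Z', f, D; split=> // l hl; apply: h4; exact: leq_trans (ltn_ord l) hN.
have hmk := exts_prime k' hm; have hmS := exts_prime k'.+1 hm; have hmSi := prime_ideal hmS.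
have [y' [b' hVDk]] := VD_k k'.
have [T [D' [F [hD' hF hZ]]]] := reduce_step Z' (@xk_homog k') hmk hVDk hs (Ordinal hN).
pose Z2 (j : nat) (l : 'I_n) := (Z' j l)%:P + 'X * ((l == Ordinal hN)%:R * T j).
rewrite xC_xk -/Z2 in hZ.
exists k'.+1, Z2, (f%:P ^+ D' * F), (D * D')%N; split.
- by apply: refines_trans h1 _; exact: step_refines.
- by rewrite muln_gt0 h2.
- apply: primeNM => //; move/(primeX hmS); rewrite /= extC //; exact: prime_ideal.
move=> l; rewrite ltnS leq_eqVlt => /orP [/eqP el|hl].
  have -> : l = Ordinal hN by exact: val_inj.
  set w := xk _ _ in hZ *.
  have -> : (f%:P ^+ D' * F)%:MP * w ^+ (D * D') = ((f%:P ^+ D')%:MP * w ^+ (D * D' - D')) * (F%:MP * w ^+ D').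
    have -> : w ^+ (D * D') = w ^+ (D * D' - D') * w ^+ D' by rewrite -exprD subnK // leq_pmull.
    by rewrite mpolyCM; ring.
  rewrite -[X in ZI _ _ _ _ X _](subnK (leq_pmull D' h2)); apply: ZI_mul => //.
  apply: AI_scale; first exact: allB_ideal.
  by have := AAX (D * D' - D') (x_AI (xk k'.+1) (Ordinal hN)); rewrite mul1n.
have [g [hg1 hg2]] := h4 l hl.
pose h := map_mpoly (n := e) (polyC : {rmorphism tower R k' -> {poly tower R k'}}).
pose G := \sum_(j < r) ('X * T j)%:MP * h (g j).
have hhg j : AI (xk k'.+1) (@allB _) D.-1 (h (g j)).
  by rewrite -xC_xk; apply: AI_C (hg1 j).
have hG : AI (xk k'.+1) (@allB _) D.-1 G by apply: AI_sum => j _; apply: AI_scale; first exact: allB_ideal.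
set w := xk k'.+1 (Ordinal hN).
have hq : ZI r (xk k'.+1) Z2 (@exts R m k'.+1) D (f%:P%:MP * xk k'.+1 l ^+ D + w * G).
  exists (fun j => h (g j)); split=> //.
  have := @AI_C _ _ _ (xk k') (@exts R m k') (@exts R m k'.+1) _ _ (fun t ht => (extC t (prime_ideal hmk)).2 ht) hg2.
  rewrite xC_xk; congr (AI _ _ _ _); rewrite rmorphB rmorphM rmorphXn /= map_mpolyC.
  rewrite -[map_mpoly _ _]/(xC (xk k') l) xC_xk -addrA; congr (_ + _).
  rewrite rmorph_sum /G mulr_sumr -sumrB -sumrN; apply: eq_bigr => j _.
  rewrite rmorphM /= zf_C xC_xk mulrCA -mulrN -[w * _ in RHS]mulrC.
  have -> : zf (xk k'.+1) Z2 j = zf (xk k'.+1) (fun j l => (Z' j l)%:P) j + ('X * T j)%:MP * w.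
    rewrite /zf /Z2; under eq_bigr do rewrite mpolyCD mulrDl.
    rewrite big_split /=; congr (_ + _); rewrite (bigD1 (Ordinal hN)) //= big1 ?addr0.
      by rewrite eqxx mul1r.
    by move=> i /negbTE ->; rewrite mul0r mulr0 mpolyC0 mul0r.
  by rewrite /h; ring.
have hwG : AI (xk k'.+1) (@allB _) D (- (w * G)).
  rewrite -mulN1r -mpolyC1 -mpolyCN; apply: AI_scale; first exact: allB_ideal.
  by have := AAM (x_AI (xk k'.+1) (Ordinal hN)) hG; rewrite add1n prednK.
have := ZI_pow hmSi D'.-1 h2 hwG hq; rewrite prednK // => hpow.
have -> : (f%:P ^+ D' * F)%:MP * xk k'.+1 l ^+ (D * D') =
   F%:MP * ((- (w * G) + (f%:P%:MP * xk k'.+1 l ^+ D + w * G)) ^+ D' - (- (w * G)) ^+ D') +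
   ((-1) ^+ D' * G ^+ D') * (F%:MP * w ^+ D').
  rewrite mpolyCM rmorphXn /= exprM; have -> : - (w * G) = (-1) * (w * G) by rewrite mulN1r.
  rewrite [((-1) * _) ^+ _]exprMn; set t := (-1) ^+ D'.
  have -> : -1 * (w * G) + (f%:P%:MP * xk k'.+1 l ^+ D + w * G) = f%:P%:MP * xk k'.+1 l ^+ D by ring.
  rewrite !exprMn; ring.
apply: ZI_add => //; first by apply: ZI_scale.
have eD : (D * D' = D.-1 * D' + D')%N by rewrite -[in LHS](prednK h2) mulSn addnC.
rewrite eD; apply: ZI_mul => //.
have -> : (-1) ^+ D' = ((-1) ^+ D')%:MP :> {mpoly (tower R k'.+1)[e]} by rewrite rmorphXn rmorphN1.
by apply: AI_scale; [exact: allB_ideal | exact: AAX].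
Qed.

Lemma stage_reduction k (Z : nat -> 'I_n -> tower R k) : exists k' Z' d,
  [/\ @refines k Z k' Z', (0 < d)%N & @Good k' Z' m d].
Proof.
have [k' [Z' [f [D [h1 h2 h3 h4]]]]] := stage_powers Z n.
have hmk := exts_prime k' hm; have hmki := prime_ideal hmk.
have hR := Red_of_powers hmki h2 (fun l => h4 l (ltn_ord l)).
have [f' [N [h5 h6]]] := Red_nakayama hmki hR.
exists k', Z', (n * D).+1; split=> //; exists f'; split=> // hf'.
apply: h3; apply: (primeX hmk (n := N)).
by rewrite -[X in @exts _ _ _ X](subKr f'); apply: idB.
Qed.
End Reduce.

Section Minors.
Variables (c : nat) (a : seq R) (kap : nat -> 'I_e -> 'I_n -> R).
Hypotheses (ha : reg (@zeroI R) a) (hc : size a = c)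
  (hkap : forall i t, (i < size a)%N -> a`_i *: delta_mx 0 t = \sum_l kap i t l *: X l).

Lemma coord_map (S S' : comNzRingType) (f : {rmorphism S -> S'}) i (v : 'rV[S]_e) : coord i (map_mx f v) = f (coord i v).
Proof. by rewrite /coord; case: insub => [j|]; rewrite ?mxE ?rmorph0. Qed.

(** As a annihilates R^e / E, each a_i times a basis vector is a combination [kap] of the
    generators. So adding X [Poly a] to one coordinate of z_j0 is a change of coefficients. *)
Lemma fresh_step k (Z : nat -> 'I_n -> tower R k) r0 j0 : (r0 < e)%N ->
  minors_reg c r (ent (zv (Wk k) Z)) r0 j0 -> exists Z', @refines k Z k.+1 Z' /\
  minors_reg c r (ent (zv (Wk k.+1) Z')) r0 j0.+1.
Proof.
move=> hr0 hT; pose i0 := Ordinal hr0.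
pose T j l : {poly tower R k} := (j == j0)%:R * \sum_(i < size a) (cmap R k (kap i i0 l))%:P * 'X^i.
exists (fun j l => (Z j l)%:P + 'X * T j l); split; first exact: step_refines.
have := minors_reg_fresh (reg_cmap k ha) _ hT; rewrite size_map => /(_ hc); congr minors_reg.
apply: functional_extensionality => i; apply: functional_extensionality => j; symmetry.
have hz : zv (Wk k.+1) (fun j l => (Z j l)%:P + 'X * T j l) j =
   map_mx (polyC : {rmorphism tower R k -> {poly tower R k}}) (zv (Wk k) Z j) +
   ((j == j0)%:R * (Poly (map (cmap R k) a) * 'X)) *: delta_mx 0 i0.
  rewrite /zv; under eq_bigr do rewrite scalerDl.
  rewrite big_split /= map_mx_sum; congr (_ + _).
    by apply: eq_bigr => l _; rewrite map_mxZ Wk_S.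
  under eq_bigr do rewrite /T mulrCA -scalerA.
  rewrite -scaler_sumr -scalerA; congr (_ *: _).
  under eq_bigr do rewrite -scalerA.
  rewrite -scaler_sumr mulrC -scalerA; congr (_ *: _).
  have -> : Poly (map (cmap R k) a) = \sum_(i < size a) (cmap R k a`_i)%:P * 'X^i.
    apply/polyP => t; rewrite coef_Poly coef_sum.
    under eq_bigr do rewrite coefCM coefXn.
    case: (ltnP t (size a)) => ht.
      rewrite (nth_map 0) // (bigD1 (Ordinal ht)) //= eqxx mulr1 big1 ?addr0 // => i1 hi1.
      by case: eqP => h; [case/eqP: hi1; apply: val_inj | rewrite mulr0].
    rewrite nth_default ?size_map // big1 // => i1 _.
    by case: eqP => h; [move: ht; rewrite h leqNgt ltn_ord | rewrite mulr0].
  rewrite scaler_suml; under eq_bigr do rewrite scaler_suml.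
  rewrite exchange_big /=; apply: eq_bigr => i1 _.
  under eq_bigr do rewrite mulrC -scalerA.
  rewrite -scaler_sumr [in RHS]mulrC -scalerA; congr (_ *: _).
  transitivity (map_mx (cmap R k.+1) (\sum_l kap i1 i0 l *: X l)).
    by rewrite map_mx_sum; apply: eq_bigr => l _; rewrite map_mxZ.
  rewrite -hkap ?ltn_ord // map_mxZ; congr (_ *: _); by rewrite map_delta_mx.
rewrite /ent hz coordD coordZ coord_map /fresh.
have -> : coord i (delta_mx 0 i0 : 'rV[{poly tower R k}]_e) = (i == r0)%:R.
  rewrite /coord; case: insubP => [t _ <-|hi]; first by rewrite mxE eqxx /= -val_eqE.
  by case: eqP => // ei; rewrite ei hr0 in hi.
case: eqP => _; case: eqP => _; rewrite /= ?mulr1 ?mul1r ?mul0r ?mulr0 ?addr0 //.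
Qed.

Lemma stage_minors k (Z : nat -> 'I_n -> tower R k) : exists k' Z', @refines k Z k' Z' /\
  minors_reg c r (ent (zv (Wk k') Z')) e 0.
Proof.
suff h r0 : (r0 <= e)%N -> exists k' Z', @refines k Z k' Z' /\ minors_reg c r (ent (zv (Wk k') Z')) r0 0.
  exact: h.
elim: r0 => [|r0 IH] hr0; first by exists k, Z; split=> //; exact: minors_reg_start.
suff h j0 : exists k' Z', @refines k Z k' Z' /\ minors_reg c r (ent (zv (Wk k') Z')) r0 j0.
  by have [k' [Z' [h1 h2]]] := h r; exists k', Z'; split=> //; exact: minors_reg_row.
elim: j0 => [|j0 [k' [Z' [h1 h2]]]]; first by apply: IH; exact: ltnW.
have [Z'' [h3 h4]] := fresh_step hr0 h2.
by exists k'.+1, Z''; split=> //; exact: refines_trans h1 h3.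
Qed.
End Minors.
End Stages.

(** * Complete intersection and equimultiplicity *)

(** Noetherian induction: a maximal counterexample J contains some a b with a and b outside, and the
    primes found over J + (a) and J + (b) together serve J. *)
Lemma finite_primes (R : comNzRingType) (I : R -> Prop) : noetherian R -> is_ideal I ->
  exists N (p : nat -> R -> Prop), (forall i, (i < N)%N -> is_prime (p i) /\ forall x, I x -> p i x) /\
  forall Q, is_prime Q -> (forall x, I x -> Q x) -> exists i, (i < N)%N /\ forall x, p i x -> Q x.
Proof.
move=> hN hI; apply: nnpp => hno.
pose good (J : R -> Prop) := exists N (p : nat -> R -> Prop), (forall i, (i < N)%N -> is_prime (p i) /\ forall x, J x -> p i x) /\
  forall Q, is_prime Q -> (forall x, J x -> Q x) -> exists i, (i < N)%N /\ forall x, p i x -> Q x.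
have [||J [[hJ hbad] hmax]] := @noeth_max R (fun J => is_ideal J /\ ~ good J) hN.
- by move=> J [].
- by exists I.
apply: hbad; case: (lem (J 1)) => h1.
  by exists 0%N, (fun _ _ => True); split=> // Q hQ hJQ; case: (prime1 hQ); exact: hJQ.
case: (lem (is_prime J)) => hp.
  by exists 1%N, (fun _ => J); split=> // Q hQ hJQ; exists 0%N.
have [a [b [hab ha hb]]] : exists a b, [/\ J (a * b), ~ J a & ~ J b].
  apply: nnpp => h; apply: hp; apply: mk_prime => // a b hab; apply: nnpp => h'; apply: h; exists a, b.
  by split=> // hh; apply: h'; [left | right].
have bigger c : ~ J c -> good (Kf J c).
  move=> hc; apply: nnpp => hg; apply: hc.
  by apply: (hmax (Kf J c)); [split=> //; exact: Kf_ideal | move=> x; exact: Kf_le | exact: Kf_mem].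
have [N1 [p1 [h1a h1b]]] := bigger a ha; have [N2 [p2 [h2a h2b]]] := bigger b hb.
exists (N1 + N2)%N, (fun i => if (i < N1)%N then p1 i else p2 (i - N1)%N); split.
  move=> i hi; case: (ltnP i N1) => h.
    by have [h3 h4] := h1a i h; split=> // x hx; apply: h4; exact: Kf_le.
  have [|h3 h4] := h2a (i - N1)%N; first by rewrite ltn_subLR.
  by split=> // x hx; apply: h4; exact: Kf_le.
have Kf_Q Q c : is_prime Q -> (forall x, J x -> Q x) -> Q c -> forall x, Kf J c x -> Q x.
  move=> hQ hJQ hc x [u hu]; have hQi := prime_ideal hQ.
  by rewrite -(subrK (u * c) x); apply: (idD hQi); [exact: hJQ | exact: (idM _ hQi)].
move=> Q hQ hJQ; case: (primeM hQ (hJQ _ hab)) => hc.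
  have [i [hi hiQ]] := h1b Q hQ (Kf_Q Q a hQ hJQ hc).
  by exists i; rewrite (leq_trans hi (leq_addr _ _)) hi.
have [i [hi hiQ]] := h2b Q hQ (Kf_Q Q b hQ hJQ hc).
by exists (N1 + i)%N; rewrite ltn_add2l hi ltnNge leq_addr /= addKn.
Qed.

(** The vectors have constant coordinates, so each monomial of the relation is itself a relation;
    one is picked where [th i1] has a coefficient outside m. *)
Lemma relation_descent (R : comNzRingType) (m : R -> Prop) e k (T : finType) (Y : T -> 'rV[R]_e)
  (th : T -> tower R k) i1 : \sum_i th i *: map_mx (cmap R k) (Y i) = 0 -> ~ exts m (th i1) ->
  exists t : T -> R, ~ m (t i1) /\ \sum_i t i *: Y i = 0.
Proof.
elim: k th => [|k IH] th h0 hm.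
  exists th; split=> //; rewrite -[RHS]h0; apply: eq_bigr => i _; congr (_ *: _).
  by apply/rowP => j; rewrite mxE.
have [j hj] := not_forall hm.
apply: (IH (fun i => (th i)`_j)) => //.
apply/rowP => s; have := congr1 (fun v : 'rV[{poly tower R k}]_e => (v 0 s)`_j) h0.
rewrite /= summxE coef_sum !mxE coef0 => h; rewrite -[RHS]h summxE; apply: eq_bigr => i _.
by rewrite !mxE /= coefMC.
Qed.

Lemma lin_inj (S : comNzRingType) e : injective (@lin S e).
Proof.
move=> u v h; apply/rowP => i.
have key (w : 'rV[S]_e) : (lin w).@[fun j => (j == i)%:R] = w 0 i.
  by rewrite lin_eval (bigD1 i) //= eqxx mulr1 big1 ?addr0 // => j /negbTE ->; rewrite mulr0.
by rewrite -!key h.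
Qed.

Lemma AI_zero (S : comNzRingType) e n (x : 'I_n -> {mpoly S[e]}) d p : AI x (@zeroI S) d p -> p = 0.
Proof.
by elim=> [//|c ->|d1 p1 l1 _ ->|d1 p1 p2 _ -> _ ->]; rewrite ?mpolyC0 ?mul0r ?addr0.
Qed.

Lemma AI_const (S : comNzRingType) e n (x : 'I_n -> {mpoly S[e]}) p : AI x (@allB S) 0 p -> exists c, p = c%:MP.
Proof.
suff h d : AI x (@allB S) d p -> d = 0%N -> exists c, p = c%:MP by move/h; apply.
elim=> [d'|c _|//|d' q1 q2 _ IH1 _ IH2] hd.
- by exists 0; rewrite mpolyC0.
- by exists c.
- by have [a ->] := IH1 hd; have [b ->] := IH2 hd; exists (a + b); rewrite mpolyCD.
Qed.

Lemma Red1_spanz (S : comNzRingType) e n r (W : 'I_n -> 'rV[S]_e) Z h :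
  Red r (fun l => lin (W l)) Z (@zeroI S) 1 h -> forall l, spanz r W Z (h *: W l).
Proof.
move=> hR l; have [g [hg1 /AI_zero /subr0_eq hg2]] := hR _ (x_AI (fun l => lin (W l)) l).
have [c hc] := choose_fun 0 (fun j (_ : True) => AI_const (hg1 j)).
exists c; apply: lin_inj; rewrite linZ hg2 lin_sum; apply: eq_bigr => j _.
by rewrite zf_lin linZ -hc.
Qed.

Lemma LL_spanz (S : comNzRingType) e n r (W : 'I_n -> 'rV[S]_e) Z v : LL (zv W Z) e r v <-> spanz r W Z v.
Proof.
have e0 (w : 'rV[S]_e) : base e w <-> w = 0.
  split=> [h|-> i _]; last by rewrite /iL !mxE mul0rn.
  by apply/rowP => i; have := h i (ltn_ord i); rewrite /iL !mxE eqxx mulr1n.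
rewrite LL_span; split=> [[c /e0 /subr0_eq ->]|[c ->]]; first by exists c.
exists (fun j => oapp c 0 (insub j)); apply/e0/eqP; rewrite subr_eq0; apply/eqP.
by apply: eq_bigr => j _; rewrite valK.
Qed.

Lemma D_of_reg_mod (R : comNzRingType) k (K : R -> Prop) s w : is_ideal K -> {subset s <= w} -> reg K s ->
  D k (iL (Ks K s)) w -> D (size s + k) (iL K) w.
Proof.
elim: s K => [|a s IH] K hK hs // [h1 h2] hD.
apply: (@D_reg _ _ _ a); [exact: iL_sub|by apply: hs; rewrite mem_head|exact: iL_nzd|].
by rewrite iL_addf; apply: IH => // [|b hb]; [exact: Kf_ideal | apply: hs; rewrite inE hb orbT].
Qed.

Lemma Rees_GA (R : comNzRingType) e (E : 'rV[R]_e -> Prop) n (X : 'I_n -> 'rV[R]_e) : generated_by E X ->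
  Rees E = GA (fun l => lin (X l)) (@allB R).
Proof.
move=> hX; apply: predext => p; split.
  elim=> [c|v /hX [c ->]|p1 p2 _ h1 _ h2|p1 p2 _ h1 _ h2].
  - exact: GAc.
  - rewrite -/(lin _) lin_sum; apply: GA_sum => // l _; rewrite linZ; apply: GA_scale => //.
    by rewrite -[lin _]mul1r -mpolyC1; apply: GAx; apply: GAc.
  - exact: GAadd.
  - exact: GA_mul.
elim=> [c _|p1 l _ h1|p1 p2 _ h1 _ h2]; [exact: Rees_const | | exact: Rees_add].
by apply: Rees_mul => //; apply: Rees_lin; exact: (gen_mem hX).
Qed.

Lemma drop_generator (R : comNzRingType) e (E : 'rV[R]_e -> Prop) n (X : 'I_n -> 'rV[R]_e) (t : 'I_n -> R) l u :
  generated_by E X -> t l * u = 1 -> \sum_i t i *: X i = 0 -> exists X' : 'I_n.-1 -> 'rV[R]_e, generated_by E X'.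
Proof.
case: n X t l => [|n] X t l hX hu h0; first by case: l hu.
exists (fun i => X (lift l i)) => v; split=> [/hX [a ->]|[a ->]].
  exists (fun i => a (lift l i) - a l * u * t (lift l i)).
  under [RHS]eq_bigr do rewrite scalerBl -scalerA.
  rewrite sumrB -scaler_sumr (bigD1_ord l) //= addrC; congr (_ + _).
  move/eqP: h0; rewrite (bigD1_ord l) //= addr_eq0 => /eqP h0.
  by rewrite -scalerN -[- _]opprK -h0 opprK scalerA -mulrA [u * _]mulrC hu mulr1.
apply/hX; exists (fun i => oapp a 0 (unlift l i)).
rewrite (bigD1_ord l) //= unlift_none scale0r add0r; apply: eq_bigr => i _; by rewrite liftK.
Qed.

(** * The two implications *)

Section Main.
Variables (R : comNzRingType) (m : R -> Prop) (e : nat) (E : 'rV[R]_e -> Prop).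
Hypotheses (hCM : cohen_macaulay_local m) (hE : ideal_module E) (hnf : ~ free_module E).
Notation I := (Fitting e E).
Notation c := (height I).

Let hN : noetherian R. Proof. by case: hCM. Qed.
Let hloc : local_ring m. Proof. by case: hCM => _ []. Qed.
Let hgr : grade_ge m (krull_dim R). Proof. by case: hCM => _ []. Qed.
Let hm := local_prime hloc.
Let hsub : is_submodule E. Proof. by case: hE => _ []. Qed.

Lemma ann_quot_proper : ~ ann_quot E 1.
Proof.
move=> h; apply: hnf; exists e, (fun i => delta_mx 0 i); split.
  move=> v; split=> [_|_]; last by rewrite -[v]scale1r.
  by exists (v 0); rewrite [LHS]row_sum_delta.
move=> a h0 i; have := congr1 (fun v : 'rV_e => v 0 i) h0; rewrite summxE (bigD1 i) //= big1 ?addr0.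
  by rewrite !mxE !eqxx mulr1.
by move=> j /negbTE hj; rewrite !mxE eq_sym hj andbF mulr0.
Qed.

Lemma ann_quot_local x : ann_quot E x -> m x.
Proof.
move=> hx; apply: nnpp => /(local_unit hloc) [y hy]; apply: ann_quot_proper.
by rewrite -hy; apply: (idMr _ (ann_quot_ideal hsub)).
Qed.

Lemma height_primes : (exists Q, [/\ is_prime Q, (forall x, I x -> Q x) & height_prime Q = c]) /\
  forall Q, is_prime Q -> (forall x, ann_quot E x -> Q x) -> (c <= height_prime Q)%N.
Proof.
have [|h1 h2] := @heightP R I.
  by exists m; split=> //; apply/(Fitting_prime hE hm); exact: ann_quot_local.
by split=> // Q hQ hle; apply: h2 => //; apply/(Fitting_prime hE hQ).
Qed.

(** Two descents with [prime_below] from a prime over the Fitting ideal: the first removes x1 modulo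
    x0, the second x0. *)
Lemma height_ge2 : (2 <= c)%N.
Proof.
have [[Q [hQ hIQ <-]] _] := height_primes.
have haQ := (Fitting_prime hE hQ).1 hIQ.
case: hE => _ [_ [_ [/ann_quot_proper //|[x [hx /regular_seq2 [h1 h2]]]]]].
have h0 : nzdI (@zeroI R) (x ord0) by move=> v; exact: h1.
have h3 : nzdI (Kf (@zeroI R) (x ord0)) (x ord_max).
  move=> v [u /subr0_eq hu]; have [c' hc'] := h2 v u hu; exists c'; apply/eqP; by rewrite subr_eq0 hc'.
have hK := Kf_ideal (x ord0) (@zeroI_ideal R).
have [|Q' [q1 q2 q3 q4]] := prime_below hK hQ _ (haQ _ (hx ord_max)) h3.
  by move=> z [u /subr0_eq ->]; apply: (idM _ (prime_ideal hQ)); apply: haQ; exact: hx.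
have q5 : Q' (x ord0) by apply: q2; apply: Kf_mem; exact: zeroI_ideal.
have [|Q'' [p1 p2 p3 p4]] := prime_below (@zeroI_ideal R) q1 _ q5 h0.
  by move=> z ->; exact: (id0 (prime_ideal q1)).
have l1 := height_prime_lt hN hloc p1 q1 p3 (ex_intro _ _ (conj q5 p4)).
have l2 := height_prime_lt hN hloc q1 hQ q3 (ex_intro _ _ (conj (haQ _ (hx ord_max)) q4)).
exact: leq_ltn_trans (leq_ltn_trans (leq0n _) l1) l2.
Qed.

Lemma mu_gens : exists X : 'I_(mu E) -> 'rV[R]_e, generated_by E X.
Proof. by case: hE => _ [_ [hfg _]]; have [] := min_natP hfg. Qed.

Lemma mu_le n (X : 'I_n -> 'rV[R]_e) : generated_by E X -> (mu E <= n)%N.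
Proof. by move=> h; case: hE => _ [_ [hfg _]]; have [_] := min_natP hfg; apply; exists X. Qed.

Variable X : 'I_(mu E) -> 'rV[R]_e.
Hypothesis hX : generated_by E X.

Lemma spread_Fin : (analytic_spread m E <= mu E)%N /\ exists s y (K : finType) (b : K -> {mpoly R[e]}) del,
  VD (fun l => lin (X l)) m y b s del /\ (s <= analytic_spread m E)%N.
Proof.
have hh l : lin (X l) \is 1.-homog by exact: lin_homog.
have [s [y [K [b [hF hP]]]]] := fiber_Fin hloc hh.
have [||[P hP'] h2] := @sup_natP (fun n => exists P, prime_chain (Rees E) (fun p => exists c, m c /\ p = c%:MP) n P) (mu E).
- by exists s; rewrite (Rees_GA hX).
- by move=> k [P]; rewrite (Rees_GA hX); exact: (fiber_chain_bound hloc).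
split; first by rewrite /analytic_spread /krull_dim_over; move: hP'; rewrite (Rees_GA hX); exact: (fiber_chain_bound hloc).
have [del hV] := Fin_VD hF.
by exists s, y, K, b, del; split=> //; apply: h2; rewrite (Rees_GA hX).
Qed.

(** The minors come last: [refines] preserves the reductions at m and at the primes [p i], but says
    nothing about regular sequences of minors. *)
Lemma generic_reduction r N (p : nat -> R -> Prop) : (analytic_spread m E <= r)%N ->
  (forall i, (i < N)%N -> is_prime (p i) /\ exists (gam : nat -> 'I_(mu E) -> R) s, ~ p i s /\
     forall l, exists a : 'I_r -> R, s *: X l = \sum_j a j *: \sum_l' gam j l' *: X l') ->
  exists k Z d f, [/\ ~ @exts R m k f, Red r (xk X k) Z (@zeroI _) d f,
    minors_reg c r (ent (zv (Wk X k) Z)) e 0 & forall i, (i < N)%N -> @Good R e _ r X k Z (p i) 1].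
Proof.
move=> hr hp.
have [_ [s [y [K [b [del [hV hs]]]]]]] := spread_Fin.
have [k1 [Z1 h1]] := stage_generators hp.
have [k2 [Z2 [d [h2 hd h3]]]] := stage_reduction hm hV (leq_trans hs hr) Z1.
have [_ hheight] := height_primes.
have [a [hsz hreg hann]] := exists_reg hN hloc hgr (ann_quot_ideal hsub) hheight.
have [kap hkap] := @choose_fun (nat * 'I_e) ('I_(mu E) -> R) (fun _ => 0) (fun it => (it.1 < size a)%N)
  (fun it kp => a`_(it.1) *: delta_mx 0 it.2 = \sum_l kp l *: X l)
  (fun it hi => (hX _).1 (hann _ (mem_nth 0 hi) (delta_mx 0 it.2))).
have [k3 [Z3 [h4 h5]]] := stage_minors r (kap := fun i t => kap (i, t)) hreg hsz (fun i t hi => hkap (i, t) hi) Z2.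
have [f [hf1 hf2]] := h4 m d hm hd h3.
exists k3, Z3, d, f; split=> // i hi; have [hpi _] := hp i hi.
by apply: h4 => //; apply: h2 => //; exact: h1.
Qed.

Section Span.
Variables (r k : nat) (Z : nat -> 'I_(mu E) -> tower R k) (d : nat) (f : tower R k).
Hypotheses (hf : ~ exts m f) (hR : Red r (xk X k) Z (@zeroI _) d f).
Notation U := (spanz r (Wk X k) Z).
Let hU := @spanz_sub (tower R k) e (mu E) r (Wk X k) Z.

(** The contraction to R of the annihilator of S^e / U localized at f. Being an ideal of R, it is
    subject to the height theory of R although U lives over S. *)
Definition absorbed (x : R) := exists N, forall v, U (f ^+ N * cmap R k x *: v).

Lemma U_mono N x N' v : (N <= N')%N -> U (f ^+ N * cmap R k x *: v) -> U (f ^+ N' * cmap R k x *: v).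
Proof.
move=> h hv; rewrite -(subnK h) exprD -mulrA -scalerA; exact: (subZ hU).
Qed.

Lemma absorbed_ideal : is_ideal absorbed.
Proof.
split; first by exists 0%N => v; rewrite rmorph0 mulr0 scale0r; exact: (sub0 hU).
split=> [x y [N hx] [N' hy]|a x [N hx]].
  exists (maxn N N') => v; rewrite rmorphD mulrDr scalerDl; apply: (subD hU).
    exact: U_mono (leq_maxl _ _) (hx v).
  exact: U_mono (leq_maxr _ _) (hy v).
by exists N => v; rewrite rmorphM mulrCA -scalerA; apply: (subZ hU).
Qed.

(** By [conductor], a power of every annihilator of R^e / E is absorbed. *)
Lemma absorbed_ann Q : is_prime Q -> (forall x, absorbed x -> Q x) -> forall x, ann_quot E x -> Q x.
Proof.
move=> hQ hle x hx.
have [|N hNv] := @conductor _ _ _ r (Wk X k) Z d f (cmap R k x) hR.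
  move=> v; have [h hh] := choose_fun (fun _ => 0) (fun i (_ : True) => (hX _).1 (hx (delta_mx 0 i))).
  exists (fun l => \sum_i v 0 i * cmap R k (h i l)).
  under eq_bigr do rewrite scaler_suml.
  rewrite exchange_big /= [in LHS](row_sum_delta v) scaler_sumr; apply: eq_bigr => i _.
  rewrite scalerA mulrC -scalerA; under [RHS]eq_bigr do rewrite -scalerA.
  rewrite -scaler_sumr; congr (_ *: _).
  transitivity (map_mx (cmap R k) (\sum_l h i l *: X l)).
    by rewrite -hh // map_mxZ map_delta_mx.
  by rewrite map_mx_sum; apply: eq_bigr => l _; rewrite map_mxZ.
apply: (primeX hQ (n := N)); apply: hle; exists N => v.
by rewrite rmorphXn -exprMn.
Qed.

Lemma absorbed_height Q : is_prime Q -> (forall x, absorbed x -> Q x) -> (c <= height_prime Q)%N.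
Proof. by move=> hQ hle; apply height_primes => //; exact: absorbed_ann. Qed.

Lemma absorbed_common (s : seq R) : (forall x, x \in s -> absorbed x) ->
  exists N, forall x, x \in s -> forall v, U (cmap R k x *: (f ^+ N *: v)).
Proof.
elim: s => [|a s IH] h; first by exists 0%N.
have [|N hNs] := IH; first by move=> x hx; apply: h; rewrite inE hx orbT.
have [N' hN'] := h a (mem_head _ _).
exists (maxn N N') => x; rewrite inE => hx v; rewrite scalerA mulrC; case/orP: hx => [/eqP ->|hx].
  exact: U_mono (leq_maxr _ _) (hN' v).
apply: U_mono (leq_maxl N N') _; rewrite mulrC -scalerA; exact: hNs.
Qed.

Lemma pow_notin N : ~ exts m (f ^+ N).
Proof. by move/(primeX (exts_prime k hm)). Qed.

Lemma spanz_W v : U v -> exists a, v = \sum_l a l *: Wk X k l.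
Proof.
move=> [a ->]; exists (fun l => \sum_j a j * Z j l).
under [RHS]eq_bigr do rewrite scaler_suml.
rewrite exchange_big /=; apply: eq_bigr => j _; rewrite scaler_sumr.
by apply: eq_bigr => l _; rewrite scalerA.
Qed.

(** For v over R, f ^+ N v in U is a relation between v and the generators with a coefficient
    outside m S; descended to R it puts v into E, so E would be R^e. *)
Lemma not_all_absorbed N : ~ forall v, U (f ^+ N *: v).
Proof.
move=> h; apply: ann_quot_proper => v; rewrite scale1r.
have [a ha] := spanz_W (h (map_mx (cmap R k) v)).
pose Y (i : unit + 'I_(mu E)) := if i is inr l then X l else v.
pose th (i : unit + 'I_(mu E)) := if i is inr l then - a l else f ^+ N.
have [|t [ht]] := @relation_descent R m e k _ Y th (inl tt) _ (@pow_notin N).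
  rewrite big_sumType /= (big_pred1 tt); last by case.
  by rewrite ha; under [X in _ + X]eq_bigr do rewrite scaleNr; rewrite sumrN subrr.
rewrite big_sumType /= (big_pred1 tt); last by case.
move=> h0; have [u hu] := local_unit hloc ht.
rewrite -[v]scale1r -hu mulrC -scalerA; apply: (subZ hsub).
rewrite -[_ *: v](addrK (\sum_i t (inr i) *: X i)) h0; apply: (subB hsub); first exact: (sub0 hsub).
by apply/hX; exists (fun l => t (inr l)).
Qed.

Lemma absorbed_gens_le : (exists N, forall l, U (f ^+ N *: Wk X k l)) -> (mu E <= r)%N.
Proof.
move=> [N hW]; rewrite leqNgt; apply/negP => hlt.
have hmk := exts_prime k hm; have hmki := prime_ideal hmk.
have [a ha] := choose_fun (fun _ => 0) (fun l (_ : True) => hW l).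
have [lam [[l1 hl1] hlam]] := elim_ord a hmk hlt.
pose th l := lam l * f ^+ N - \sum_j (\sum_i lam i * a i j) * Z j l.
have [||t [ht h0]] := @relation_descent R m e k _ X th l1.
- rewrite /th; under eq_bigr do rewrite scalerBl -scalerA.
  rewrite sumrB; apply/eqP; rewrite subr_eq0; apply/eqP.
  transitivity (\sum_j (\sum_i lam i * a i j) *: zv (Wk X k) Z j).
    under eq_bigr => l _ do rewrite -[map_mx _ _]/(Wk X k l) (ha l) // scaler_sumr.
    rewrite exchange_big /=; apply: eq_bigr => j _; rewrite scaler_suml.
    by apply: eq_bigr => l _; rewrite scalerA.
  under [RHS]eq_bigr do rewrite scaler_suml.
  rewrite exchange_big /=; apply: eq_bigr => j _; rewrite scaler_sumr.
  by apply: eq_bigr => l _; rewrite scalerA.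
- move=> hth; apply: (primeNM hmk hl1 (@pow_notin N)).
  rewrite -(subrK (\sum_j (\sum_i lam i * a i j) * Z j l1) (_ * _)); apply: (idD hmki) => //.
  by apply: id_sum => // j _; apply: (idMr _ hmki); exact: hlam.
have [u hu] := local_unit hloc ht.
have [X' hX'] := drop_generator hX hu h0.
by have := mu_le hX'; rewrite leqNgt prednK ?leqnn //; exact: leq_ltn_trans (leq0n _) hlt.
Qed.
End Span.

Lemma mu_loc_le p : is_prime p -> (mu_loc E p <= mu E)%N /\
  exists (gam : nat -> 'I_(mu E) -> R) s, ~ p s /\
     forall l, exists a : 'I_(mu_loc E p) -> R, s *: X l = \sum_j a j *: \sum_l' gam j l' *: X l'.
Proof.
move=> hp.
have [|[Y [s [hY [hs hYs]]]] h2] := @min_natP (fun n => exists (Y : 'I_n -> 'rV[R]_e) (s : R),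
    (forall i, E (Y i)) /\ ~ p s /\ forall v, E v -> exists a : 'I_n -> R, s *: v = \sum_(i < n) a i *: Y i).
  exists (mu E), X, 1; split; first exact: (gen_mem hX).
  by split; [exact: (prime1 hp) | move=> v /hX [a ->]; exists a; rewrite scale1r].
split.
  apply: h2; exists X, 1; split; first exact: (gen_mem hX).
  by split; [exact: (prime1 hp) | move=> v /hX [a ->]; exists a; rewrite scale1r].
have [gam hg] := choose_fun (fun _ => 0) (fun i (_ : True) => (hX _).1 (hY i)).
exists (fun j => oapp gam (fun _ => 0) (insub j)), s; split=> // l.
have [a ha] := hYs _ (gen_mem hX l); exists a.
by rewrite ha; apply: eq_bigr => j _; rewrite valK /= -hg.
Qed.

Lemma ci_equimultiple : mu E = (c + e - 1)%N -> analytic_spread m E = (c + e - 1)%N.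
Proof.
move=> hmu; have [hle _] := spread_Fin; apply/eqP; rewrite eqn_leq -{1}hmu hle /=.
rewrite leqNgt; apply/negP => hlt.
have hc2 := height_ge2; have he : (0 < e)%N by case: hE.
pose r := (c.-1 + e - 1)%N.
have hr : (analytic_spread m E <= r)%N by rewrite /r; lia.
have [k [Z [d [f [hf hR hmin _]]]]] := @generic_reduction r 0 (fun _ => m) hr (fun _ h => False_ind _ (notF h)).
have [s [hsz hreg hs]] := exists_reg hN hloc hgr (absorbed_ideal r Z f) (absorbed_height hR).
have [N hNs] := absorbed_common hs.
apply: (not_all_absorbed hf (N := N)) => v; apply/LL_spanz.
have hD : D c (iL (@zeroI (tower R k))) (map (cmap R k) s).
  by rewrite -hsz -(size_map (cmap R k)); apply: D_of_reg; [exact: zeroI_ideal | | exact: reg_cmap].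
have hD1 : D 1 (LL (zv (Wk X k) Z) e r) (map (cmap R k) s).
  (* [depth_flag] at rank e, with excess r - e + 1 = c - 1. *)
  have -> : 1%N = (c - c.-1)%N by lia.
  by apply: (depth_flag hmin) hD => //; rewrite /r; lia.
have [htf _] := hD1; apply: htf => _ /mapP [b hb ->]; apply/LL_spanz; exact: hNs.
Qed.

Lemma equimultiple_ci : generically_ci E -> analytic_spread m E = (c + e - 1)%N -> mu E = (c + e - 1)%N.
Proof.
move=> hgci hl; pose r := (c + e - 1)%N.
have hc2 := height_ge2; have he : (0 < e)%N by case: hE.
have [[P [hP hIP hPc]] hheight] := height_primes.
have hPmin : minimal_prime I P by apply: (minimal_of_height hN hloc) => //; rewrite hPc.
have hmuP := hgci _ hPmin.
apply/eqP; rewrite eqn_leq -/r; apply/andP; split; last first.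
  by rewrite /r -hmuP; have [] := mu_loc_le hP.
have [N0 [p0 [hp0 hp0c]]] := finite_primes hN (ann_quot_ideal hsub).
(* Primes of the list that are not minimal over the Fitting ideal are replaced by the minimal prime
   P, so that the hypothesis on local generators applies to every index. *)
pose p i : R -> Prop := if excluded_middle_informative (minimal_prime I (p0 i)) then p0 i else P.
have hp i : minimal_prime I (p i) by rewrite /p; case: excluded_middle_informative.
have [||k [Z [d [f [hf hR hmin hgood]]]]] := @generic_reduction r N0 p.
- by rewrite hl.
- move=> i _; have [hpi _] := hp i; split=> //.
  by have [_] := mu_loc_le hpi; rewrite (hgci _ (hp i)).
have hAi := absorbed_ideal r Z f.
have [s [hsz hreg hs]] := exists_reg hN hloc hgr hAi (absorbed_height hR).
have [g hg] := exists_fin_gens hN hAi.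
have hsg x : x \in s ++ g -> absorbed r Z f x.
  by rewrite mem_cat => /orP [/hs //|hx]; apply/hg; exact: Ks_mem.
have [N hNs] := absorbed_common hsg.
have [h hh] := choose_fun 0 hgood.
pose w := map (cmap R k) (s ++ g) ++ [seq h i | i <- iota 0 N0].
(* The sequence s gives depth c; the generators g of the absorbed ideal and the [h i] give one more,
   because the extension of no associated prime of s contains them all. *)
have hD : D c.+1 (iL (@zeroI (tower R k))) w.
  rewrite -addn1 -hsz -(size_map (cmap R k)); apply: D_of_reg_mod; [exact: zeroI_ideal | | exact: reg_cmap |].
    by move=> x hx; rewrite mem_cat map_cat mem_cat hx.
  split=> // v hv; rewrite exts_Ks; apply: nnpp => hn.
  have hKi : is_ideal (Ks (@zeroI R) s) by apply/Ks_ideal/zeroI_ideal.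
  have [|gam [hg1 hg2]] := mccoy_tower (W := fun x => x \in w) hKi hn.
    by move=> x hx; have := hv x hx; rewrite exts_Ks /iL mxE.
  (* This prime has height at most c and turns out to lie over the Fitting ideal; so it is one of
     the [p i], whose extension does not contain [h i]. *)
  have [g0 [q1 q2 q3 _]] := exists_max_ann hN hKi hg1.
  have hq := height_ass hN hloc hgr hreg q2 q1; rewrite hsz in hq.
  set Q := ann _ g0 in q2 q3 hq.
  have hwQ x : x \in w -> exts Q x.
    move=> /hg2; elim: (k) x => [|k' IH] x; first exact: q3.
    by move=> hx i; apply: IH; exact: hx.
  have hAQ x : absorbed r Z f x -> Q x.
    move/hg; apply: Ks_le; first exact: prime_ideal.
    move=> b hb; apply/(exts_cmap k _ (prime_ideal q2)); apply: hwQ.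
    by rewrite mem_cat map_f // mem_cat hb orbT.
  have haQ := absorbed_ann hR q2 hAQ.
  have hIQ : forall x, I x -> Q x by apply/(Fitting_prime hE q2).
  have hQmin := minimal_of_height hN hloc q2 hIQ hq.
  have [i [hi hiQ]] := hp0c Q q2 haQ.
  have [hpi1 hpi2] := hp0 i hi.
  have eQ : p0 i = Q.
    apply: predext => x; split; first exact: hiQ.
    by case: hQmin => _ [_ hmin']; apply: hmin' => //; apply/(Fitting_prime hE hpi1).
  have epi : p i = Q by rewrite /p eQ; case: excluded_middle_informative.
  have [hhi _] := hh i hi; apply: hhi; rewrite epi; apply: hwQ.
  by rewrite mem_cat (map_f h) ?orbT // mem_iota.
apply: (absorbed_gens_le hf (Z := Z)); exists N => l; apply/LL_spanz.
have hD1 : D 1 (LL (zv (Wk X k) Z) e r) w.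
  have -> : 1%N = (c.+1 - c)%N by lia.
  by apply: (depth_flag hmin) hD => //; rewrite /r; lia.
(* All of w carries f ^+ N W_l into U: the absorbed elements by the choice of N, the [h i] because
   they already carry W_l there. *)
have [htf _] := hD1; apply: htf => x; rewrite mem_cat => /orP [/mapP [b hb ->]|/mapP [i hi ->]]; apply/LL_spanz.
  exact: hNs.
have hi' : (i < N0)%N by rewrite mem_iota in hi.
have [_ hRed] := hh i hi'.
rewrite scalerA mulrC -scalerA; apply: (subZ (spanz_sub _ _ _)).
exact: (Red1_spanz hRed).
Qed.
End Main.

Theorem theorem5p3 (R : comNzRingType) (m : R -> Prop) (e : nat) (E : 'rV[R]_e -> Prop) :
  cohen_macaulay_local m ->
  ideal_module E -> ~ free_module E ->
  generically_ci E ->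
  (complete_intersection E <-> equimultiple m E).
Proof.
move=> hCM hE hnf hgci; have [X hX] := mu_gens hE.
by split; [exact: ci_equimultiple hX | exact: equimultiple_ci hX hgci].
Qed.
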